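(* Let $D\subset\mathbb{R}^2$ be a bounded plane domain convex in the direction $x_2$ whose boundary $\Gamma$ is a Lyapunov line, and let $u$ be a solution of the boundary value problem $$\frac{\partial^2u(x)}{\partial x_2^2}+i\,\frac{\partial^2u(x)}{\partial x_1\,\partial x_2}=0,\quad x\in D,$$ $$\frac{\partial u(x)}{\partial x_2}\Big|_{x_2=\gamma_k(x_1)}+\alpha_k\,u(x_1,\gamma_k(x_1))=\varphi_k(x_1),\quad k=1,2;\ x_1\in[a_1,b_1],$$ with nonzero constants $\alpha_1,\alpha_2$. If $\varphi_k(x_1)$, $k=1,2$, are continuously differentiable functions vanishing at the ends of the interval $(a_1,b_1)$, then the relation $$\frac{\varphi_1(\xi_1)}{\alpha_1}+\frac{\varphi_2(\xi_1)}{\alpha_2}-\big[u_1(\xi_1)+u_2(\xi_1)\big]=\frac{i}{\pi}\int_{a_1}^{b_1}\Big[\frac{\varphi_1(x_1)}{\alpha_1}-\frac{\varphi_2(x_1)}{\alpha_2}\Big]\frac{dx_1}{x_1-\xi_1}$$ $$-\frac{i}{\pi}\int_{a_1}^{b_1}\Big\{-2\int_{a_1}^{b_1}[\varphi_2(\eta_1)-\alpha_2u_2(\eta_1)]\,U_{21}(\eta_1,x_1)\,[1-i\gamma_2'(\eta_1)]\,d\eta_1$$ $$\qquad+2\int_{a_1}^{b_1}[\varphi_1(\eta_1)-\alpha_1u_1(\eta_1)]\,U_{11}(\eta_1,x_1)\,[1-i\gamma_1'(\eta_1)]\,d\eta_1\Big\}\frac{dx_1}{x_1-\xi_1}+\frac{R_1(\xi_1)}{\alpha_1}+\frac{R_2(\xi_1)}{\alpha_2}$$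 for the boundary values $u_1,u_2$ of $u$ is regular (with $u_k,U_{jk},R_k$ and ''regular'' as in the context).
   Context: $i=\sqrt{-1}$. $D$ is convex in the direction $x_2$: every line parallel to the $x_2$-axis meets $D$ in an interval (or not at all). $\Gamma=\overline{D}\setminus D=\Gamma_1\cup\Gamma_2$, where $\Gamma_k$ is the open line $x_2=\gamma_k(x_1)$, $k=1,2$, obtained by orthogonal projection of $D$ on the $x_1$-axis ($\Gamma_1$ lower, $\Gamma_2$ upper), and $[a_1,b_1]$ is the common projection of $\Gamma_1,\Gamma_2$ on the $x_1$-axis. The two boundary conditions are assumed linearly independent and the $\varphi_k$ sufficiently smooth. Put $u_k(x_1)=u(x_1,\gamma_k(x_1))$. Let $$U(x-\xi)=\frac{1}{2\pi}\int_0^{x_2}\frac{\theta(t-\xi_2)+\theta(\xi_2-t)}{t-\xi_2+i(x_1-\xi_1)}\,dt,$$ where $\theta$ is the Heaviside function and $\theta(s)+\theta(-s)=1$. For $j,k\in\{1,2\}$, $U_{jk}(x_1,\xi_1)$ is the value of $U(x-\xi)$ at $x_2=\gamma_j(x_1)$, $\xi_2=\gamma_k(\xi_1)$, and $$E_{jk}(x_1,\xi_1)=\frac{1}{2\pi}\,\frac{1}{\gamma_j(x_1)-\gamma_k(\xi_1)+i(x_1-\xi_1)}.$$ The terms $R_1,R_2$ collect the non-singular summands: with $p_k=\varphi_k-\alpha_ku_k$, $$R_1(\xi_1)=2\int_{a_1}^{b_1}p_2(x_1)E_{21}(x_1,\xi_1)[1-i\gamma_2'(x_1)]dx_1-\int_{a_1}^{b_1}p_1(x_1)\Big\{2E_{11}(x_1,\xi_1)[1-i\gamma_1'(x_1)]+\frac{i}{\pi}\frac{1}{x_1-\xi_1}\Big\}dx_1,$$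 $$R_2(\xi_1)=\int_{a_1}^{b_1}p_2(x_1)\Big\{2E_{22}(x_1,\xi_1)[1-i\gamma_2'(x_1)]+\frac{i}{\pi}\frac{1}{x_1-\xi_1}\Big\}dx_1-2\int_{a_1}^{b_1}p_1(x_1)E_{12}(x_1,\xi_1)[1-i\gamma_1'(x_1)]dx_1.$$ Integrals with kernel $1/(x_1-\xi_1)$ are Cauchy principal values. The relation is called regular if, after interchanging the order of integration in the double integrals, it contains no singular integral of the unknown functions: $u_1,u_2$ occur under integral signs only with kernels having at most a weak singularity, and the remaining singular integrals involve only the known functions $\varphi_1,\varphi_2$ and exist. *)

(* Defs.v *)
(* Written against MathComp-Analysis, over an arbitrary R : realType; complex
   numbers are the R[i] of mathcomp-real-closed. *)
From HB Require Import structures.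
From mathcomp Require Import all_boot all_order all_algebra.
From mathcomp Require Export complex.
From mathcomp Require Import all_classical all_reals all_analysis.
Import Order.TTheory GRing.Theory Num.Theory.
Import numFieldNormedType.Exports.

Set Implicit Arguments.
Unset Strict Implicit.
Unset Printing Implicit Defensive.

Local Open Scope classical_set_scope.
Local Open Scope ring_scope.
Local Open Scope complex_scope.

(* Limits, derivatives and integrals of R[i]-valued functions are taken on real
   and imaginary parts. *)
Section complex_valued.
Context {R : realType}.
Implicit Types (f : R -> R[i]) (A : set R).

Definition ccvg {T : Type} (F : set_system T) (f : T -> R[i]) (l : R[i]) : Prop :=
  ((complex.Re (f t)) @[t --> F] --> complex.Re l) /\
  ((complex.Im (f t)) @[t --> F] --> complex.Im l).

Definition ccontinuous_on {T : topologicalType} (A : set T) (f : T -> R[i]) : Prop :=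
  {within A, continuous (fun t => complex.Re (f t))} /\
  {within A, continuous (fun t => complex.Im (f t))}.

Definition cderivable f (t : R) : Prop :=
  derivable (fun s => complex.Re (f s)) t 1 /\
  derivable (fun s => complex.Im (f s)) t 1.

Definition cderive f (t : R) : R[i] :=
  derive1 (fun s => complex.Re (f s)) t +i* derive1 (fun s => complex.Im (f s)) t.

Definition cintegrable A f : Prop :=
  lebesgue_measure.-integrable A (fun t => (complex.Re (f t))%:E) /\
  lebesgue_measure.-integrable A (fun t => (complex.Im (f t))%:E).

Definition cint A f : R[i] :=
  (\int[lebesgue_measure]_(t in A) complex.Re (f t)) +i*
  (\int[lebesgue_measure]_(t in A) complex.Im (f t)).

(* \int_0^y f(t) dt, oriented. *)
Definition cint0 f (y : R) : R[i] :=
  if 0 <= y then cint `[0, y] f else - cint `[y, 0] f.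

(* [a, b] minus the open e-neighbourhood of xi. *)
Definition excised (a b xi e : R) : set R := `[a, b] `&` [set x | e <= `|x - xi|].

Definition cauchy_integrand f (xi x : R) : R[i] := f x / (x - xi)%:C.

Definition is_pv (a b : R) f (xi : R) (l : R[i]) : Prop :=
  (forall e : R, 0 < e -> cintegrable (excised a b xi e) (cauchy_integrand f xi)) /\
  ccvg 0^'+ (fun e : R => cint (excised a b xi e) (cauchy_integrand f xi)) l.

Definition pv_exists (a b : R) f (xi : R) : Prop := exists l, is_pv a b f xi l.

(* The principal value of \int_a^b f(x) dx / (x - xi); meaningful under
   pv_exists. *)
Definition pv (a b : R) f (xi : R) : R[i] :=
  lim ((complex.Re (cint (excised a b xi e) (cauchy_integrand f xi)))
         @[e --> 0^'+]) +i*
  lim ((complex.Im (cint (excised a b xi e) (cauchy_integrand f xi)))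
         @[e --> 0^'+]).

(* N eta xi = O(|eta - xi|^-mu) with mu < 1 on compact subsets of ]a, b[^2, and
   N is integrable in eta up to the ends.  The bound cannot be asked for
   uniformly up to a and b: the boundary curve has vertical tangents there, so
   that the derivatives gamma_k' contained in the kernels are unbounded. *)
Definition weakly_singular (a b : R) (N : R -> R -> R[i]) : Prop :=
  (forall xi, a < xi < b -> cintegrable `]a, b[ (N ^~ xi)) /\
  (forall c d : R, a < c -> c < d -> d < b ->
    exists C mu : R, 0 <= mu < 1 /\
      forall eta xi, c <= eta <= d -> c <= xi <= d -> eta != xi ->
        `|N eta xi| <= (C * `|eta - xi| `^ (- mu))%:C).

Definition C1_on (a b : R) f : Prop :=
  ccontinuous_on `[a, b] f /\
  exists2 df : R -> R[i], ccontinuous_on `[a, b] df &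
    forall x, a < x < b -> cderivable f x /\ cderive f x = df x.

End complex_valued.

Section domain.
Context {R : realType}.
Implicit Types (D G : set (R * R)).

Definition bounded_domain D : Prop :=
  [/\ D !=set0, open D, connected D & bounded_set D].

Definition convex_in_x2 D : Prop :=
  forall x1 : R, is_interval [set x2 | D (x1, x2)].

(* A simple closed curve, parametrized L-periodically by arc length, whose unit
   tangent vector is Hoelder continuous. *)
Definition lyapunov_curve G : Prop :=
  exists (L : R) (x y : R -> R),
    [/\ 0 < L /\ (forall s, x (s + L) = x s /\ y (s + L) = y s),
        (forall s t, 0 <= s < L -> 0 <= t < L -> x s = x t -> y s = y t -> s = t),
        G = range (fun s => (x s, y s)),
        (forall s, [/\ derivable x s 1, derivable y s 1 &
                       derive1 x s ^+ 2 + derive1 y s ^+ 2 = 1]) &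
        exists C lam : R, 0 < lam <= 1 /\
          forall s t, `|derive1 x s - derive1 x t| <= C * `|s - t| `^ lam /\
                      `|derive1 y s - derive1 y t| <= C * `|s - t| `^ lam].

Definition graph_over (a b : R) (g : R -> R) : set (R * R) :=
  [set p | a <= p.1 <= b /\ p.2 = g p.1].

Definition boundary_lines D (a b : R) (g1 g2 : R -> R) : Prop :=
  [/\ a < b,
      closure D `\` D = graph_over a b g1 `|` graph_over a b g2,
      (forall x, a <= x <= b -> g1 x <= g2 x),
      {within `[a, b], continuous g1} /\ {within `[a, b], continuous g2} &
      forall x, a < x < b -> derivable g1 x 1 /\ derivable g2 x 1].

End domain.

Section problem.
Context {R : realType}.
Implicit Types (D : set (R * R)) (u : R * R -> R[i]).

Definition cderivable1 u (x : R * R) : Prop := cderivable (fun t => u (t, x.2)) x.1.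
Definition cderivable2 u (x : R * R) : Prop := cderivable (fun t => u (x.1, t)) x.2.
Definition pd1 u (x : R * R) : R[i] := cderive (fun t => u (t, x.2)) x.1.
Definition pd2 u (x : R * R) : R[i] := cderive (fun t => u (x.1, t)) x.2.

Definition solves_equation D u : Prop :=
  ccontinuous_on (closure D) u /\
  forall x, D x ->
    [/\ cderivable2 u x, cderivable2 (pd2 u) x, cderivable1 (pd2 u) x &
        pd2 (pd2 u) x + 'i * pd1 (pd2 u) x = 0].

(* The value of du/dx2 at a boundary point is its limit from inside D. *)
Definition boundary_condition D (a b : R) u (g : R -> R) (al : R[i])
    (ph : R -> R[i]) : Prop :=
  exists w : R -> R[i], forall x1, a <= x1 <= b ->
    ccvg (within D (nbhs (x1, g x1))) (pd2 u) (w x1) /\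
    w x1 + al * u (x1, g x1) = ph x1.

End problem.

Section kernels.
Context {R : realType}.
Implicit Types (g gj gk : R -> R).

Definition heaviside (s : R) : R :=
  if 0 < s then 1 else if s == 0 then 2^-1 else 0.

Definition fundU (x xi : R * R) : R[i] :=
  ((2 * pi)^-1)%:C *
  cint0 (fun t => (heaviside (t - xi.2) + heaviside (xi.2 - t))%:C /
                  ((t - xi.2) +i* (x.1 - xi.1))) x.2.

Definition Ubd gj gk (x1 xi1 : R) : R[i] := fundU (x1, gj x1) (xi1, gk xi1).

Definition Ebd gj gk (x1 xi1 : R) : R[i] :=
  ((2 * pi)^-1)%:C * ((gj x1 - gk xi1) +i* (x1 - xi1))^-1.

Definition i_over_pi : R[i] := 'i / pi%:C.

Definition normal_factor g (x1 : R) : R[i] := 1 - 'i * (derive1 g x1)%:C.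

Definition crossE gj gk (x1 xi1 : R) : R[i] :=
  Ebd gj gk x1 xi1 * normal_factor gj x1.

Definition diagE g (x1 xi1 : R) : R[i] :=
  2 * crossE g g x1 xi1 + i_over_pi * ((x1 - xi1)^-1)%:C.

(* The kernel of the double integral after the interchange: the singular
   integration acts on U_{jk}(eta, .) only. *)
Definition crossU (a b : R) gj gk (eta xi : R) : R[i] :=
  pv a b (Ubd gj gk eta) xi * normal_factor gj eta.

End kernels.

Section relation.
Context {R : realType}.
Variables (a b : R) (g1 g2 : R -> R) (al1 al2 : R[i]) (ph1 ph2 : R -> R[i]).
Variable u : R * R -> R[i].

Definition u1 (x : R) : R[i] := u (x, g1 x).
Definition u2 (x : R) : R[i] := u (x, g2 x).
Definition p1 (x : R) : R[i] := ph1 x - al1 * u1 x.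
Definition p2 (x : R) : R[i] := ph2 x - al2 * u2 x.

Definition R1 (xi : R) : R[i] :=
  2 * cint `]a, b[ (fun x => p2 x * crossE g2 g1 x xi)
  - cint `]a, b[ (fun x => p1 x * diagE g1 x xi).

Definition R2 (xi : R) : R[i] :=
  cint `]a, b[ (fun x => p2 x * diagE g2 x xi)
  - 2 * cint `]a, b[ (fun x => p1 x * crossE g1 g2 x xi).

Definition known_density (x : R) : R[i] := ph1 x / al1 - ph2 x / al2.

Definition inner1 (x eta : R) : R[i] :=
  p1 eta * Ubd g1 g1 eta x * normal_factor g1 eta.
Definition inner2 (x eta : R) : R[i] :=
  p2 eta * Ubd g2 g1 eta x * normal_factor g2 eta.

Definition inner (x : R) : R[i] :=
  - 2 * cint `]a, b[ (inner2 x) + 2 * cint `]a, b[ (inner1 x).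

Definition iterated (xi : R) : R[i] := pv a b inner xi.

Definition interchanged (xi : R) : R[i] :=
  - 2 * cint `]a, b[ (fun eta => p2 eta * crossU a b g2 g1 eta xi)
  + 2 * cint `]a, b[ (fun eta => p1 eta * crossU a b g1 g1 eta xi).

(* The relation at the point xi, the double integral being evaluated by dbl. *)
Definition relation_with (dbl : R -> R[i]) (xi : R) : Prop :=
  ph1 xi / al1 + ph2 xi / al2 - (u1 xi + u2 xi) =
    i_over_pi * pv a b known_density xi
    - i_over_pi * dbl xi
    + R1 xi / al1 + R2 xi / al2.

Definition relation : R -> Prop := relation_with iterated.
Definition interchanged_relation : R -> Prop := relation_with interchanged.

(* The term \int (ph - al * uk)(eta) N(eta, xi) d eta may be split, and the
   unknown uk then occurs under a weakly singular kernel only. *)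
Definition regular_term (N : R -> R -> R[i]) (ph uk : R -> R[i]) : Prop :=
  weakly_singular a b N /\
  forall xi, a < xi < b ->
    cintegrable `]a, b[ (fun eta => uk eta * N eta xi) /\
    cintegrable `]a, b[ (fun eta => ph eta * N eta xi).

(* In interchanged_relation the principal values act on known functions only:
   on known_density and, inside crossU, on Ubd.  All its other integrals are the
   terms listed in the fields rr_ui_*, where the suffix tells whether the term
   comes from the double integral (U) or from R1, R2.  Since the densities ph1,
   ph2 vanish at a and b, their principal value exists there too; the relation
   itself is considered at interior points, where the gk have derivatives.

   Regularity concerns the form of the relation: that the relation holds is not
   part of it. *)
Record regular_relation : Prop := RegularRelation {
  rr_known : forall xi, a <= xi <= b -> pv_exists a b known_density xi;
  rr_inner : forall x, a < x < b ->
    cintegrable `]a, b[ (inner1 x) /\ cintegrable `]a, b[ (inner2 x);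
  rr_outer : forall xi, a < xi < b -> pv_exists a b inner xi;
  rr_kernel : forall eta xi, a < eta < b -> a < xi < b -> eta != xi ->
    pv_exists a b (Ubd g1 g1 eta) xi /\ pv_exists a b (Ubd g2 g1 eta) xi;
  rr_interchange : forall xi, a < xi < b -> iterated xi = interchanged xi;
  rr_relation : forall xi, a < xi < b ->
    (relation xi <-> interchanged_relation xi);
  rr_u1_U : regular_term (crossU a b g1 g1) ph1 u1;
  rr_u2_U : regular_term (crossU a b g2 g1) ph2 u2;
  rr_u1_R1 : regular_term (diagE g1) ph1 u1;
  rr_u2_R1 : regular_term (crossE g2 g1) ph2 u2;
  rr_u1_R2 : regular_term (crossE g1 g2) ph1 u1;
  rr_u2_R2 : regular_term (diagE g2) ph2 u2
}.

End relation.

(* Main.v *)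
(* Off the diagonal, Re U_jk and Im U_jk are combinations of
   ln ((h s - g t)^2 + (s - t)^2) and atan ((h s - g t) / (s - t)).  Such a kernel
   K is O(|s - t|^(-1/8)) on the whole square and, for t in a compact part of
   ]a, b[, Lipschitz in t at distance r from the diagonal, with constant O(r^-2).
   The integral of K(s, t) / (t - xi) over |t - xi| >= e is then split at
   |t - xi| ~ |s - xi|^2: near xi one uses that 1/(t - xi) is odd, far from xi
   the bound on K, and gets O(|s - xi|^(-1/2)) uniformly in e.  This dominates
   the truncated integrals, so that Fubini's theorem for e > 0 passes to the limit
   e -> 0: the order of integration may be interchanged, and the kernel of the
   interchanged integral is weakly singular.

   For R_1 and R_2 one needs that gamma_k' is integrable on ]a, b[ and locally
   Hoelder.  The part of the boundary curve (x, y) that lies on the graph of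
   gamma_k over ]a, b[ is a single arc, on which x' does not vanish because the
   tangent is not vertical; if sigma is the inverse of x on this arc, then
   gamma_k' = (y'/x') o sigma and |gamma_k'| <= |sigma'|, where sigma is monotone
   and bounded.  In 2 E_kk (1 - i gamma_k') + i / (pi (x - xi)) the singular parts
   cancel, leaving the first order Taylor remainder of gamma_k over |x - xi|^2;
   and E_21, E_12 are locally bounded because gamma_1 < gamma_2 inside. *)
Require Import Defs.
From mathcomp Require Import all_boot all_order all_algebra.
From mathcomp Require Import all_classical all_reals all_analysis.
From mathcomp Require Import measurable_realfun.
From mathcomp Require Import ring lra.
Import Order.TTheory GRing.Theory Num.Theory.
Import numFieldNormedType.Exports.
Set Implicit Arguments.
Unset Strict Implicit.
Unset Printing Implicit Defensive.
Local Open Scope classical_set_scope.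
Local Open Scope ring_scope.
Local Open Scope complex_scope.

(** * Integrals of real functions *)

(** The two arguments of U_jk play different roles. The boundary curve may have vertical tangents
    over a and b, so the weight p_j (1 - i gamma_j') in the first argument s can be unbounded there,
    while gamma_k is Lipschitz in the second argument t only on compact parts of ]a, b[. Hence the
    estimates are uniform for s in all of [a, b] but local in xi and t. The bound |s - xi|^(-1/2) is
    then integrable against the weight: near xi the weight is bounded, away from xi the power is.
    The splitting radius is quadratic in |s - xi| because, with the Lipschitz constant O(|s -
    xi|^-2), a linear one would leave a non-integrable O(|s - xi|^-1). Kernels are total functions
    whose values have no meaning where a denominator vanishes. Estimates are therefore stated off
    the diagonal, and single points and the ends are removed from the integrals. *)

Section integration.
Context {R : realType}.
Implicit Types (f g F : R -> R) (a b c x M m l e r : R) (A : set R).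
Notation mu := (@lebesgue_measure R).

Lemma integrable_le A f g : measurable A -> measurable_fun A f ->
  (forall x, A x -> `|f x| <= g x) ->
  mu.-integrable A (EFin \o g) -> mu.-integrable A (EFin \o f).
Proof.
move=> mA mf fg ig; apply: le_integrable ig => //; first exact/measurable_EFinP.
move=> x Ax /=; rewrite lee_fin (le_trans (fg _ Ax))// ler_norm//.
Qed.

Lemma integrableZ_real A f (k : R) : measurable A ->
  mu.-integrable A (EFin \o f) -> mu.-integrable A (EFin \o (fun x => k * f x)).
Proof.
move=> mA fi; rewrite (_ : _ \o _ = (fun x => k%:E * (EFin \o f) x)%E).
  exact: integrableZl.
by apply/funext => x /=; rewrite EFinM. Qed.

Lemma integrableD_real A f g : measurable A ->
  mu.-integrable A (EFin \o f) -> mu.-integrable A (EFin \o g) ->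
  mu.-integrable A (EFin \o (fun x => f x + g x)).
Proof.
move=> mA fi gi; rewrite (_ : _ \o _ = (EFin \o f) \+ (EFin \o g))%E.
  exact: integrableD.
by apply/funext => x /=; rewrite EFinD. Qed.

Lemma integrableB_real A f g : measurable A ->
  mu.-integrable A (EFin \o f) -> mu.-integrable A (EFin \o g) ->
  mu.-integrable A (EFin \o (fun x => f x - g x)).
Proof.
move=> mA fi gi; rewrite (_ : _ \o _ = (EFin \o f) \- (EFin \o g))%E.
  exact: integrableB.
by apply/funext => x /=; rewrite EFinB. Qed.

Lemma integrable_norm_real A f :
  mu.-integrable A (EFin \o f) -> mu.-integrable A (EFin \o (fun x => `|f x|)).
Proof. by move=> fi; exact: (integrable_norm fi). Qed.

Lemma integrable_cst_itv A (k : R) a b : measurable A -> A `<=` `[a, b] ->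
  mu.-integrable A (EFin \o (fun=> k)).
Proof.
move=> mA Aab; apply: (@integrableS _ _ _ mu `[a, b]%classic) => //.
apply: continuous_compact_integrable; first exact: segment_compact.
by apply: continuous_subspaceT => x; exact: cst_continuous.
Qed.

Lemma measurable_inv : measurable_fun setT (fun x : R => x^-1).
Proof.
(* Inversion is not continuous at 0; as a product with a real power of x^2 it is measurable on the
   whole line, both sides being 0 at 0. *)
have -> : (fun x : R => x^-1) = (fun x => x * (x ^+ 2) `^ (-1)).
  apply/funext => x; rewrite powR_inv1 ?sqr_ge0//.
  have [->|x0] := eqVneq x 0; first by rewrite invr0 mul0r.
  by rewrite expr2 invfM mulrA mulfV// mul1r.
apply: measurable_funM => //.
apply: (measurableT_comp (@measurable_powR R (-1))).
exact: exprn_measurable.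
Qed.

Lemma continuous_itv_oo f a b : (forall x, a < x < b -> {for x, continuous f}) ->
  measurable_fun `]a, b[ f.
Proof.
move=> cf; apply: open_continuous_measurable_fun; first exact: interval_open.
by move=> x; rewrite inE/= in_itv/=; exact: cf.
Qed.

Lemma Rintegral_FTC2 a b f F : a <= b ->
  (forall x, a <= x <= b -> {for x, continuous f}) ->
  (forall x, a <= x <= b -> is_derive x 1 F (f x)) ->
  mu.-integrable `[a, b] (EFin \o f) /\
  \int[mu]_(x in `[a, b]) f x = F b - F a.
Proof.
rewrite le_eqVlt => /predU1P[<- _ _|ab cf dF].
  rewrite set_itv1 Rintegral_set1 subrr; split=> //.
  apply: null_set_integrable => //; last exact: lebesgue_measure_set1.
  by apply/measurable_EFinP; exact: measurable_fun_set1.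
have cF x : a <= x <= b -> {for x, continuous F}.
  move=> /dF dFx; apply/differentiable_continuous/derivable1_diffP.
  exact: ex_derive.
have cfw : {within `[a, b], continuous f}.
  by apply: continuous_in_subspaceT => x; rewrite inE/= in_itv/=; exact: cf.
split.
  by apply: continuous_compact_integrable => //; exact: segment_compact.
rewrite /Rintegral (@continuous_FTC2 _ f F)//.
- split.
  + move=> x; rewrite in_itv/= => /andP[/ltW ax /ltW xb].
    by have := dF x; rewrite ax xb => /(_ isT) ?; exact: ex_derive.
  + by apply: cvg_at_right_filter; apply: cF; rewrite lexx ltW.
  + by apply: cvg_at_left_filter; apply: cF; rewrite lexx ltW.
- move=> x; rewrite in_itv/= => /andP[/ltW ax /ltW xb].
  have := dF x; rewrite ax xb => /(_ isT) ?.
  by rewrite derive1E derive_val.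
Qed.

(** An improper fundamental theorem: [f] may blow up at both ends, and a bound on the primitive
    replaces its limits there. Monotone convergence along an exhaustion by compact intervals gives
    it. It serves for the powers |x - c|^(-m) and for the inverse of the abscissa along the boundary
    curve. *)
Lemma integrable_bounded_primitive a b M f F : a < b ->
  (forall x, a < x < b -> 0 <= f x) ->
  (forall x, a < x < b -> {for x, continuous f}) ->
  (forall x, a < x < b -> is_derive x 1 F (f x)) ->
  (forall x, a < x < b -> `|F x| <= M) ->
  mu.-integrable `]a, b[ (EFin \o f) /\
  \int[mu]_(x in `]a, b[) f x <= 2 * M.
Proof.
move=> ab f0 cf dF FM.
have M0 : 0 <= M.
  have mid : a < (a + b) / 2 < b by apply/andP; split; lra.
  by apply: le_trans (FM _ mid).
pose c n : R := a + n.+1%:R^-1; pose d n : R := b - n.+1%:R^-1.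
have ac n : a < c n by rewrite ltrDl invr_gt0.
have db n : d n < b by rewrite ltrBlDr ltrDl invr_gt0.
have cd_ab n x : c n <= x <= d n -> a < x < b.
  by move=> /andP[cx xd]; rewrite (lt_le_trans (ac n))//= (le_lt_trans xd).
have part n : (\int[mu]_(x in `[c n, d n]) (f x)%:E <= (2 * M)%:E)%E.
  (* For small n the interval may be empty or a single point. *)
  have [dc|cd] := leP (d n) (c n).
    have -> : (\int[mu]_(x in `[c n, d n]) (f x)%:E = 0)%E; last first.
      by rewrite lee_fin mulr_ge0.
    have [->|ndc] := eqVneq (d n) (c n).
      by rewrite set_itv1 integral_set1.
    by rewrite set_itv_ge ?integral_set0// bnd_simp -ltNge lt_neqAle ndc dc.
  have [ic] := @Rintegral_FTC2 (c n) (d n) f F (ltW cd)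
    (fun x xcd => cf x (cd_ab n x xcd)) (fun x xcd => dF x (cd_ab n x xcd)).
  rewrite -[leLHS]fineK ?integrable_fin_num// -/(Rintegral _ _ _) lee_fin => ->.
  have /cd_ab/FM /ler_normlP[? ?] : c n <= c n <= d n by rewrite lexx ltW.
  have /cd_ab/FM /ler_normlP[? ?] : c n <= d n <= d n by rewrite lexx ltW.
  lra.
have mf : measurable_fun `]a, b[ f by exact: continuous_itv_oo.
have cup : `]a, b[%classic = \bigcup_n `[c n, d n]%classic.
  apply/seteqP; split => x /=; last first.
    by move=> [n _] /=; rewrite !in_itv/=; exact: cd_ab.
  rewrite in_itv/= => /andP[ax xb].
  have [k hk] := ltr_add_invr ax; have [l hl] := ltr_add_invr xb.
  exists (maxn k l) => //=; rewrite in_itv/=; apply/andP; split.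
    rewrite (le_trans _ (ltW hk))// lerD2l lef_pV2 ?posrE// ler_nat.
    by rewrite ltnS leq_maxl.
  rewrite lerBrDr (le_trans _ (ltW hl))// lerD2l lef_pV2 ?posrE// ler_nat.
  by rewrite ltnS leq_maxr.
have bnd : (\int[mu]_(x in `]a, b[) (f x)%:E <= (2 * M)%:E)%E.
  have cv : (\int[mu]_(x in `[c n, d n]) (f x)%:E)%E @[n --> \oo] -->
      (\int[mu]_(x in \bigcup_n `[c n, d n]%classic) (f x)%:E)%E.
    apply: (@ge0_nondecreasing_set_cvg_integral _ (measurableTypeR R) R
      (fun n => `[c n, d n]%classic) (EFin \o f) mu) => //.
    - apply/nondecreasing_seqP => n; rewrite subsetEset => x /=.
      rewrite !in_itv/= => /andP[cx xd].
      have : (n.+2%:R^-1 <= n.+1%:R^-1 :> R).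
        by rewrite lef_pV2 ?posrE// ler_nat.
      move=> h; rewrite (le_trans _ cx) ?lerD2l//= (le_trans xd)// lerD2l lerN2//.
    - move=> n; apply/measurable_EFinP; apply: measurable_funS mf => // x /=.
      by rewrite !in_itv/=; exact: cd_ab.
    - by move=> n x /=; rewrite in_itv/= => /cd_ab/f0; rewrite lee_fin.
  rewrite cup; by apply: (cvge_to_le cv); exact: nearW.
have intf : mu.-integrable `]a, b[ (EFin \o f).
  apply/integrableP; split; first exact/measurable_EFinP.
  under eq_integral => x.
    rewrite inE/= in_itv/= => xab /=; rewrite ger0_norm ?f0//; over.
  by rewrite (le_lt_trans bnd)// ltry.
by split=> //; rewrite /Rintegral -lee_fin fineK ?integrable_fin_num//.
Qed.

Lemma ge0_integral_setU_le A B (g : R -> \bar R) :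
  measurable A -> measurable B -> measurable_fun (A `|` B) g ->
  (forall x, (A `|` B) x -> 0 <= g x)%E ->
  (\int[mu]_(x in A `|` B) g x <=
   \int[mu]_(x in A) g x + \int[mu]_(x in B) g x)%E.
Proof.
move=> mA mB mg g0.
have AB : A `|` B = A `|` (B `\` A).
  by rewrite setUDr setDv setD0.
rewrite AB ge0_integral_setU -?AB//; last by rewrite disj_set2E setDIK.
  rewrite leeD2l// ge0_subset_integral//.
  - exact: measurableD.
  - by apply: measurable_funS mg => //; exact: measurableU.
  - by move=> x Bx; apply: g0; right.
exact: measurableD.
Qed.

Lemma integrable_setU A B f : measurable A -> measurable B ->
  mu.-integrable A (EFin \o f) -> mu.-integrable B (EFin \o f) ->
  mu.-integrable (A `|` B) (EFin \o f).
Proof.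
move=> mA mB iA iB.
have [mfA iA'] := integrableP _ _ _ iA; have [mfB iB'] := integrableP _ _ _ iB.
have mAB : measurable_fun (A `|` B) (EFin \o f) by exact/measurable_funU.
apply/integrableP; split; first by [].
apply: (le_lt_trans (ge0_integral_setU_le _ _ _ _)) => //.
  exact: measurableT_comp.
by rewrite lte_add_pinfty.
Qed.

Lemma ge0_Rintegral_setU_le A B f : measurable A -> measurable B ->
  mu.-integrable A (EFin \o f) -> mu.-integrable B (EFin \o f) ->
  (forall x, (A `|` B) x -> 0 <= f x) ->
  \int[mu]_(x in A `|` B) f x <=
   \int[mu]_(x in A) f x + \int[mu]_(x in B) f x.
Proof.
move=> mA mB iA iB f0; have iAB := integrable_setU mA mB iA iB.
have mAB : measurable (A `|` B) by exact: measurableU.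
rewrite /Rintegral -lee_fin EFinD !fineK; try by apply: integrable_fin_num.
by apply: ge0_integral_setU_le => //; exact: measurable_int iAB.
Qed.

Lemma ge0_Rintegral_subset A B f : measurable A -> measurable B ->
  mu.-integrable B (EFin \o f) -> (forall x, B x -> 0 <= f x) -> A `<=` B ->
  \int[mu]_(x in A) f x <= \int[mu]_(x in B) f x.
Proof.
move=> mA mB iB f0 AB.
have iA : mu.-integrable A (EFin \o f) by exact: integrableS iB.
rewrite /Rintegral -lee_fin !fineK; try by apply: integrable_fin_num.
by apply: ge0_subset_integral => //; exact: measurable_int iB.
Qed.

Lemma measurable_fun_off_point A c f g : measurable A -> measurable_fun A g ->
  (forall x, A x -> x != c -> f x = g x) -> measurable_fun A f.
Proof.
move=> mA mg fg.
apply: (@eq_measurable_fun _ _ _ _ _ (fun x => if x == c then f c else g x)).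
  by move=> x; rewrite inE => Ax; have [->//|/fg->] := eqVneq x c.
apply: measurable_fun_if => //; first exact: measurable_fun_eqr.
by apply: measurable_funS mg => //; exact: subIsetl.
Qed.

(** This discards the diagonal: kernels are compared only where no denominator vanishes, and their
    value at the remaining point is arbitrary. *)
Lemma integrable_off_point A c f g : measurable A ->
  (forall x, A x -> x != c -> f x = g x) ->
  mu.-integrable A (EFin \o g) -> mu.-integrable A (EFin \o f) /\
  \int[mu]_(x in A) f x = \int[mu]_(x in A) g x.
Proof.
move=> mA fg ig.
have mg : measurable_fun A g by apply/measurable_EFinP; exact: measurable_int ig.
have mf := measurable_fun_off_point mA mg fg.
have efg : ae_eq mu A (EFin \o f) (EFin \o g).
  exists [set c]; split => //; first exact: lebesgue_measure_set1.
  move=> x /= h; apply/eqP/negPn/negP => xc; apply: h => Ax; congr EFin.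
  by apply: fg.
have mfE : measurable_fun A (EFin \o f) by exact/measurable_EFinP.
have mgE : measurable_fun A (EFin \o g) by exact/measurable_EFinP.
split; last by congr fine; exact: ae_eq_integral.
apply/integrableP; split => //.
have [_] := integrableP _ _ _ ig; congr (_ < _)%E.
apply: ae_eq_integral => //; try exact: measurableT_comp.
by apply: filterS efg => x h Ax; rewrite h.
Qed.

Lemma le_Rintegral_off_point A c f g : measurable A ->
  mu.-integrable A (EFin \o f) -> mu.-integrable A (EFin \o g) ->
  (forall x, A x -> x != c -> f x <= g x) ->
  \int[mu]_(x in A) f x <= \int[mu]_(x in A) g x.
Proof.
move=> mA fi gi fg.
have [hi <-] := @integrable_off_point A c (fun x => if x == c then g c else f x) f mA
  (ltac:(by move=> x _ /negbTE ->)) fi.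
by apply: le_Rintegral => // x Ax; have [->//|xc] := eqVneq x c; exact: fg.
Qed.

(** The model weak singularity. At x = c its value is 0 for m nonzero, not infinity, so upper bounds
    by it are only asked off c. *)
Definition dpow (m c x : R) : R := `|x - c| `^ (- m).

Lemma continuous_dpow m c x : x != c -> {for x, continuous (dpow m c)}.
Proof.
move=> xc; rewrite (_ : dpow m c = (@powR R) ^~ (- m) \o (fun x => `|x - c|))//.
apply: continuous_comp.
  rewrite (_ : (fun x => `|x - c|) = @Num.norm _ R \o (fun x => x - c))//.
  apply: continuous_comp; last exact: norm_continuous.
  by apply: continuousB => //; exact: cst_continuous.
apply: differentiable_continuous; apply/derivable1_diffP.
by apply: derivable_powR; rewrite in_itv/= andbT normr_gt0 subr_eq0.
Qed.

Lemma integral_dpow_right m c l : 0 <= m < 1 -> 0 < l ->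
  mu.-integrable `]c, (c + l)[ (EFin \o dpow m c) /\
  \int[mu]_(x in `]c, (c + l)[) dpow m c x <= 2 * (l `^ (1 - m) / (1 - m)).
Proof.
move=> /andP[m0 m1] l0.
apply: (@integrable_bounded_primitive _ _ _ _ (fun x => (x - c) `^ (1 - m) / (1 - m))).
- by rewrite ltrDl.
- by move=> x _; rewrite /dpow powR_ge0.
- by move=> x /andP[cx _]; apply: continuous_dpow; rewrite gt_eqF.
- move=> x /andP[cx _]; rewrite /dpow gtr0_norm ?subr_gt0//.
  have h : is_derive (x - c) 1 ((@powR R) ^~ (1 - m)) ((1 - m) * (x - c) `^ (1 - m - 1)).
    by apply: is_derive1_powR; rewrite subr_gt0.
  have h2 : is_derive x 1 (fun x : R => x - c) 1.
    by apply: is_derive_eq; rewrite subr0.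
  have h3 := @is_derive1_comp R ((@powR R) ^~ (1 - m)) (fun x => x - c) x _ _ h h2.
  have -> : (fun x => (x - c) `^ (1 - m) / (1 - m)) =
    (1 - m)^-1 *: (fun x => (x - c) `^ (1 - m)).
    by apply/funext => y; rewrite mulrC.
  apply: is_derive_eq; rewrite /GRing.scale/= mulr1 mulrA mulVf ?mul1r; last by lra.
  by congr (_ `^ _); ring.
- move=> x /andP[cx xl].
  have m1' : 0 < 1 - m by lra.
  rewrite ger0_norm; last by rewrite divr_ge0 ?powR_ge0// ltW.
  rewrite ler_pM2r ?invr_gt0//; apply: ge0_ler_powR; rewrite ?nnegrE; lra.
Qed.

Lemma integral_dpow_left m c l : 0 <= m < 1 -> 0 < l ->
  mu.-integrable `](c - l), c[ (EFin \o dpow m c) /\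
  \int[mu]_(x in `](c - l), c[) dpow m c x <= 2 * (l `^ (1 - m) / (1 - m)).
Proof.
move=> /andP[m0 m1] l0.
apply: (@integrable_bounded_primitive _ _ _ _ (fun x => - ((c - x) `^ (1 - m) / (1 - m)))).
- by rewrite ltrBlDr ltrDl.
- by move=> x _; rewrite /dpow powR_ge0.
- by move=> x /andP[_ xc]; apply: continuous_dpow; rewrite lt_eqF.
- move=> x /andP[_ xc]; rewrite /dpow distrC gtr0_norm ?subr_gt0//.
  have h : is_derive (c - x) 1 ((@powR R) ^~ (1 - m)) ((1 - m) * (c - x) `^ (1 - m - 1)).
    by apply: is_derive1_powR; rewrite subr_gt0.
  have h2 : is_derive x 1 (fun x : R => c - x) (- 1).
    by rewrite -[-1]add0r; apply: is_deriveB.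
  have h3 := @is_derive1_comp R ((@powR R) ^~ (1 - m)) (fun x => c - x) x _ _ h h2.
  have -> : (fun x => - ((c - x) `^ (1 - m) / (1 - m))) =
    (- (1 - m)^-1) *: (fun x => (c - x) `^ (1 - m)).
    by apply/funext => y; rewrite mulrC -mulNr.
  apply: is_derive_eq; rewrite /GRing.scale/= mulrN1 mulrN mulNr opprK mulrA.
  rewrite mulVf ?mul1r; last by lra.
  by congr (_ `^ _); ring.
- move=> x /andP[xl xc].
  have m1' : 0 < 1 - m by lra.
  rewrite normrN ger0_norm; last by rewrite divr_ge0 ?powR_ge0// ltW.
  rewrite ler_pM2r ?invr_gt0//; apply: ge0_ler_powR; rewrite ?nnegrE; lra.
Qed.

Lemma measurable_dpow m c A : measurable_fun A (dpow m c).
Proof.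
apply: (@measurable_funS _ _ _ _ setT) => //.
apply: (measurableT_comp (@measurable_powR R (- m))).
apply: (measurableT_comp (@normr_measurable R setT)).
exact: measurable_funB.
Qed.


Lemma integral_dpow m c l : 0 <= m < 1 -> 0 < l ->
  mu.-integrable `](c - l), (c + l)[ (EFin \o dpow m c) /\
  \int[mu]_(x in `](c - l), (c + l)[) dpow m c x <= 4 * (l `^ (1 - m) / (1 - m)).
Proof.
move=> m01 l0.
have -> : `](c - l), (c + l)[%classic = `](c - l), c[ `|` ([set c] `|` `]c, (c + l)[).
  apply/seteqP; split => x /=; rewrite !in_itv/=.
    move=> /andP[? ?]; have [xc|xc|->] := ltgtP x c; [left|right; right|right; left] => //; exact/andP.
  move=> [/andP[? ?]|[->|/andP[? ?]]]; apply/andP; split; lra.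
have [il bl] := integral_dpow_left c m01 l0.
have [ir br] := integral_dpow_right c m01 l0.
have i1 : mu.-integrable [set c] (EFin \o dpow m c).
  apply: null_set_integrable => //; last exact: lebesgue_measure_set1.
  by apply/measurable_EFinP; exact: measurable_dpow.
have ic := integrable_setU (measurable_set1 c) (measurable_itv _) i1 ir.
have mc : measurable ([set c] `|` `]c, (c + l)[) by exact: measurableU.
split; first exact: integrable_setU.
apply: (le_trans (ge0_Rintegral_setU_le _ _ il ic _)) => //.
  by move=> x _; rewrite powR_ge0.
have := @ge0_Rintegral_setU_le [set c] `]c, (c + l)[ (dpow m c)
  (measurable_set1 c) (measurable_itv _) i1 ir (fun x _ => powR_ge0 _ _).
rewrite Rintegral_set1; lra.
Qed.

Lemma integral_dpow_itv m a b : 0 <= m < 1 -> a < b -> exists2 C : R, 0 <= C &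
  forall c, a <= c <= b -> forall A, measurable A -> A `<=` `[a, b] ->
  mu.-integrable A (EFin \o dpow m c) /\ \int[mu]_(x in A) dpow m c x <= C.
Proof.
(* With the extra 1, the open interval ]c - l, c + l[ contains [a, b] for every c in [a, b], which
   makes the constant independent of c. *)
move=> m01 ab; pose l := b - a + 1; have l0 : 0 < l by rewrite /l; lra.
exists (4 * (l `^ (1 - m) / (1 - m))).
  by rewrite mulr_ge0// divr_ge0 ?powR_ge0//; lra.
move=> c /andP[ac cb] A mA Aab.
have [ic bc] := integral_dpow c m01 l0.
have Al : A `<=` `](c - l), (c + l)[.
  by move=> x /Aab/=; rewrite !in_itv/= /l => /andP[? ?]; apply/andP; split; lra.
split; first exact: integrableS ic.
apply: le_trans bc; apply: ge0_Rintegral_subset => // x _; exact: powR_ge0.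
Qed.

End integration.

(** * Truncated singular integrals *)

Section real_principal_value.
Context {R : realType}.
Implicit Types (f g F : R -> R) (a b c x M m l e r xi : R) (A : set R).
Notation mu := (@lebesgue_measure R).

Lemma measurable_excised a b xi e : measurable (excised a b xi e).
Proof.
have mf : measurable_fun setT (fun x : R => `|x - xi|).
  by apply: (measurableT_comp (@normr_measurable R setT)); exact: measurable_funB.
apply: measurableI => //.
rewrite (_ : [set x | _] = (fun x : R => `|x - xi|) @^-1` `[e, +oo[%classic).
  by rewrite -[_ @^-1` _]setTI; exact: mf.
by apply/seteqP; split => x /=; rewrite in_itv/= andbT.
Qed.

Lemma excised_sub a b xi e : excised a b xi e `<=` `[a, b].
Proof. by move=> x []. Qed.

Lemma measurable_div_dist f xi A : measurable_fun A f ->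
  measurable_fun A (fun x => f x / (x - xi)).
Proof.
move=> mf; apply: measurable_funM => //.
apply: (measurableT_comp (@measurable_inv R)).
by apply: measurable_funB.
Qed.

Lemma integrable_excised_div a b f xi e : 0 < e ->
  mu.-integrable `[a, b] (EFin \o f) ->
  mu.-integrable (excised a b xi e) (fun x => (f x / (x - xi))%:E).
Proof.
move=> e0 fi.
have mX := measurable_excised a b xi e.
have fX : mu.-integrable (excised a b xi e) (EFin \o f).
  by apply: integrableS fi => //; exact: excised_sub.
apply: (@integrable_le _ _ _ (fun x => e^-1 * `|f x|)) => //.
- by apply: measurable_div_dist; apply/measurable_EFinP; exact: measurable_int fX.
- move=> x [_ /= ex]; rewrite normrM mulrC normfV ler_wpM2r//.
  by rewrite lef_pV2 ?posrE// (lt_le_trans e0).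
- by apply: integrableZ_real => //; exact: integrable_norm_real.
Qed.

(** The primitives ln (xi - x) and ln (x - xi) on the two sides of xi have opposite increments. *)
Lemma Rintegral_inv_annulus xi e r : 0 < e -> e <= r ->
  \int[mu]_(x in [set x | e <= `|x - xi| <= r]) (x - xi)^-1 = 0.
Proof.
move=> e0 er.
have -> : [set x | e <= `|x - xi| <= r] = `[xi - r, xi - e] `|` `[xi + e, xi + r].
  apply/seteqP; split => x /=; rewrite !in_itv/=.
    have [xx|xx] := leP xi x.
      by rewrite ger0_norm ?subr_ge0// => /andP[? ?]; right; apply/andP; split; lra.
    by rewrite ltr0_norm ?subr_lt0// => /andP[? ?]; left; apply/andP; split; lra.
  move=> [/andP[? ?]|/andP[? ?]].
    by rewrite ltr0_norm ?subr_lt0; [apply/andP; split|]; lra.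
  by rewrite gtr0_norm ?subr_gt0; [apply/andP; split|]; lra.
have cf x : x != xi -> {for x, continuous (fun x => (x - xi)^-1)}.
  move=> xx; apply: continuousV; first by rewrite subr_eq0.
  by apply: continuousB => //; exact: cst_continuous.
have [i1 E1] : mu.-integrable `[xi - r, xi - e] (EFin \o (fun x => (x - xi)^-1)) /\
  \int[mu]_(x in `[xi - r, xi - e]) (x - xi)^-1 = ln e - ln r.
  have -> : ln e - ln r = (fun x => ln (xi - x)) (xi - e) - (fun x => ln (xi - x)) (xi - r).
    by congr (ln _ - ln _); ring.
  apply: (@Rintegral_FTC2 _ _ _ _ (fun x => ln (xi - x))); first lra.
    by move=> x /andP[_ xe]; apply: cf; rewrite lt_eqF//; lra.
  move=> x /andP[_ xe]; have h0 : 0 < xi - x by lra.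
  have h2 : is_derive x 1 (fun x : R => xi - x) (- 1).
    by rewrite -[-1]add0r; apply: is_deriveB.
  have := @is_derive1_comp R (@ln R) (fun x => xi - x) x _ _ (is_derive1_ln h0) h2.
  by rewrite mulrN1 -invrN opprB.
have [i2 E2] : mu.-integrable `[xi + e, xi + r] (EFin \o (fun x => (x - xi)^-1)) /\
  \int[mu]_(x in `[xi + e, xi + r]) (x - xi)^-1 = ln r - ln e.
  have -> : ln r - ln e = (fun x => ln (x - xi)) (xi + r) - (fun x => ln (x - xi)) (xi + e).
    by congr (ln _ - ln _); ring.
  apply: (@Rintegral_FTC2 _ _ _ _ (fun x => ln (x - xi))); first lra.
    by move=> x /andP[xe _]; apply: cf; rewrite gt_eqF//; lra.
  move=> x /andP[xe _]; have h0 : 0 < x - xi by lra.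
  have h2 : is_derive x 1 (fun x : R => x - xi) 1.
    by apply: is_derive_eq; rewrite subr0.
  have := @is_derive1_comp R (@ln R) (fun x => x - xi) x _ _ (is_derive1_ln h0) h2.
  by rewrite mulr1.
rewrite Rintegral_setU//; last first.
- apply/disj_setPS => x /=; rewrite !in_itv/= => -[/andP[? ?] /andP[? ?]]; lra.
- exact: integrable_setU.
rewrite E1 E2; lra.
Qed.

Definition pv_cut a b f xi e : R :=
  \int[mu]_(x in excised a b xi e) (f x / (x - xi)).

Lemma Rintegral_bounded_le A f c e M : 0 <= e -> 0 <= M -> measurable A ->
  A `<=` `[c - e, c + e] -> mu.-integrable A (EFin \o f) ->
  (forall x, A x -> `|f x| <= M) -> \int[mu]_(x in A) `|f x| <= 2 * M * e.
Proof.
move=> e0 M0 mA Ae fi fM.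
apply: (@le_trans _ _ (\int[mu]_(x in A) M)).
  apply: le_Rintegral => //; first exact: integrable_norm_real.
  exact: integrable_cst_itv Ae.
apply: (@le_trans _ _ (\int[mu]_(x in `[c - e, c + e]) M)).
  apply: ge0_Rintegral_subset => //.
  by apply: integrable_cst_itv => //; exact: subset_refl.
rewrite Rintegral_cst//= lebesgue_measure_itv/= lte_fin.
case: ifPn => [_|_] /=; last by rewrite mulr0 !mulr_ge0.
lra.
Qed.

(* In both cases the constant part f xi contributes nothing on |x - xi| <= r: it
   vanishes, or the truncated interval is symmetric around xi and 1 / (x - xi) is
   odd.  The first case covers the end points xi = a and xi = b. *)
Lemma pv_cut_lipschitz a b f xi r M : 0 < r -> 0 <= M -> a <= xi <= b ->
  mu.-integrable `[a, b] (EFin \o f) ->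
  (forall x, a <= x <= b -> `|x - xi| <= r -> `|f x - f xi| <= M * `|x - xi|) ->
  f xi = 0 \/ (a <= xi - r /\ xi + r <= b) ->
  (forall e, 0 < e -> `|pv_cut a b f xi e| <=
     2 * M * r + \int[mu]_(x in excised a b xi r) `|f x / (x - xi)|) /\
  exists l, pv_cut a b f xi e @[e --> 0^'+] --> l.
Proof.
move=> r0 M0 /andP[axi xib] fi fL fr.
pose near := [set x | `|x - xi| <= r].
(* Subtracting the odd part only within distance r leaves [g], bounded by M near xi and equal to f /
   (x - xi) farther away. It is integrable on [a, b], so the truncated integrals converge to its
   integral. *)
pose k x : R := if `|x - xi| <= r then (x - xi)^-1 else 0.
pose g x : R := f x / (x - xi) - f xi * k x.
have gnear x : a <= x <= b -> `|x - xi| <= r -> `|g x| <= M.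
  move=> xab xr; rewrite /g /k xr -mulrBl normrM normfV.
  have [->|xx] := eqVneq x xi; first by rewrite !subrr normr0 mul0r.
  by rewrite ler_pdivrMr ?normr_gt0 ?subr_eq0//; exact: fL.
have gfar x : r < `|x - xi| -> g x = f x / (x - xi).
  by move=> xr; rewrite /g /k leNgt xr mulr0 subr0.
have mk A : measurable A -> measurable_fun A k.
  move=> mA; apply: measurable_fun_if => //.
  - apply: measurable_fun_ler => //.
    apply: (measurableT_comp (@normr_measurable R setT)).
    exact: measurable_funB.
  - apply: (measurableT_comp (@measurable_inv R)).
    exact: measurable_funB.
have mf : measurable_fun `[a, b] f.
  by apply/measurable_EFinP; exact: measurable_int fi.
have mg : measurable_fun `[a, b] g.
  apply: measurable_funB; first exact: measurable_div_dist.
  by apply: measurable_funM => //; exact: mk.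
have gi : mu.-integrable `[a, b] (EFin \o g).
  apply: (@integrable_le _ _ _ (fun x => M + r^-1 * `|f x|)) => //.
    move=> x /=; rewrite in_itv/= => xab; have [xr|xr] := leP `|x - xi| r.
      by rewrite ler_wpDr ?gnear// mulr_ge0// invr_ge0 ltW.
    rewrite gfar// normrM mulrC normfV ler_wpDl// ler_wpM2r//.
    by rewrite lef_pV2 ?posrE// ?ltW// (lt_trans r0).
  apply: integrableD_real => //.
    exact: (integrable_cst_itv _ _ (@subset_refl _ _)).
  by apply: integrableZ_real => //; exact: integrable_norm_real.
have cutE e : 0 < e -> pv_cut a b f xi e = \int[mu]_(x in excised a b xi e) g x.
  move=> e0; have mX := measurable_excised a b xi e.
  have giX : mu.-integrable (excised a b xi e) (EFin \o g).
    by apply: integrableS gi => //; exact: excised_sub.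
  have kiX : mu.-integrable (excised a b xi e) (EFin \o k).
    apply: (@integrable_le _ _ _ (fun=> e^-1)) => //; first exact: mk.
      move=> x [_ /= xe]; rewrite /k; case: ifPn => _; last by rewrite normr0 invr_ge0 ltW.
      by rewrite normfV lef_pV2 ?posrE// (lt_le_trans e0).
    exact: (integrable_cst_itv _ _ (@excised_sub _ _ _ _)).
  have -> : pv_cut a b f xi e =
      \int[mu]_(x in excised a b xi e) (g x + f xi * k x).
    by apply: eq_Rintegral => x _; rewrite /g subrK.
  rewrite RintegralD//; last exact: integrableZ_real.
  rewrite RintegralZl//.
  case: fr => [->|[ar rb]]; first by rewrite mul0r addr0.
  suff -> : \int[mu]_(x in excised a b xi e) k x = 0 by rewrite mulr0 addr0.
  have -> : \int[mu]_(x in excised a b xi e) k x =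
      \int[mu]_(x in excised a b xi e `&` near) (x - xi)^-1.
    rewrite [RHS]Rintegral_mkcondr; apply: eq_Rintegral => x _; rewrite patchE /k.
    by case: ifPn => [xr|/negP xr]; [rewrite mem_set|rewrite memNset].
  (* For e <= r the domain is the full symmetric annulus, contained in [a, b] by the second case of
     [fr]; for e > r it is empty. *)
  have [er|re] := leP e r.
    rewrite -(Rintegral_inv_annulus xi e0 er); congr (Rintegral _ _ _).
    apply/seteqP; split => x /=.
      by move=> [[_ /= ->]].
    move=> /andP[ex xr]; split => //; split => //=; rewrite in_itv/=.
    by move: xr; rewrite ler_norml => /andP[? ?]; apply/andP; split; lra.
  have -> : excised a b xi e `&` near = set0.
    by apply/seteqP; split => x // -[[_ /= xe]]; rewrite /near/= leNgt (lt_le_trans re).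
  exact: Rintegral_set0.
split=> [e e0|].
  have mX := measurable_excised a b xi e.
  rewrite cutE//; apply: (le_trans (le_normr_Rintegral _ _)) => //.
    by apply: integrableS gi => //; exact: excised_sub.
  apply: (@le_trans _ _ (\int[mu]_(x in `[a, b]) `|g x|)).
    apply: ge0_Rintegral_subset => //; first exact: integrable_norm_real.
    exact: excised_sub.
  have mnear : measurable near.
    rewrite (_ : near = `[xi - r, xi + r]%classic)//.
    apply/seteqP; split => x; rewrite /near/= in_itv/= ler_norml.
      by move=> /andP[? ?]; apply/andP; split; lra.
    by move=> /andP[? ?]; apply/andP; split; lra.
  have mN : measurable (`[a, b] `&` near) by exact: measurableI.
  have mD : measurable (`[a, b] `\` near) by exact: measurableD.
  have mXr := measurable_excised a b xi r.
  have iN : mu.-integrable (`[a, b] `&` near) (EFin \o g).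
    by apply: integrableS gi => //; exact: subIsetl.
  have iF : mu.-integrable (excised a b xi r) (EFin \o (fun x => `|g x|)).
    apply: integrable_norm_real; apply: integrableS gi => //; exact: excised_sub.
  have iD : mu.-integrable (`[a, b] `\` near) (EFin \o (fun x => `|g x|)).
    apply: integrable_norm_real; apply: integrableS gi => //.
  have Eab : `[a, b]%classic = (`[a, b] `&` near) `|` (`[a, b] `\` near).
    by rewrite setUIDK.
  rewrite {1}Eab.
  have := ge0_Rintegral_setU_le mN mD (integrable_norm_real iN) iD
    (fun x _ => normr_ge0 (g x)).
  move=> /le_trans; apply.
  apply: lerD.
    apply: (@Rintegral_bounded_le _ _ xi) => //; first exact: ltW.
      move=> x [_]; rewrite /near/= in_itv/= ler_norml => /andP[? ?].
      by apply/andP; split; lra.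
    by move=> x [/=]; rewrite in_itv/=; exact: gnear.
  rewrite (_ : \int[mu]_(x in `[a, b] `\` near) `|g x| =
     \int[mu]_(x in `[a, b] `\` near) `|f x / (x - xi)|); last first.
    apply: eq_Rintegral => x; rewrite inE => -[_ /negP]; rewrite -ltNge => xr.
    by rewrite gfar.
  apply: ge0_Rintegral_subset => //.
    by apply: integrable_norm_real; exact: integrable_excised_div.
  by move=> x [xab /negP]; rewrite -ltNge => xr; split => //=; exact: ltW.
exists (\int[mu]_(x in `[a, b]) g x).
apply/cvgrPdist_le => e e0.
(* The integrals differ by the part |x - xi| < d, which is at most 2 M d; the 1 allows M = 0. *)
have M1 : 0 < 2 * M + 1 by lra.
have eM : 0 < e / (2 * M + 1) by rewrite divr_gt0.
near=> d.
have d0 : 0 < d by near: d; exact: nbhs_right_gt.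
have dr : d <= r by near: d; exact: nbhs_right_le.
have mX := measurable_excised a b xi d.
have giX : mu.-integrable (excised a b xi d) (EFin \o g).
  by apply: integrableS gi => //; exact: excised_sub.
have mC : measurable (`[a, b] `\` excised a b xi d) by exact: measurableD.
have giC : mu.-integrable (`[a, b] `\` excised a b xi d) (EFin \o g).
  by apply: integrableS gi.
rewrite cutE// -{1}(setDUK (@excised_sub a b xi d)) Rintegral_setU//; last 2 first.
  exact: integrable_setU.
  by apply/disj_setPS => x [? []].
rewrite addrAC subrr add0r.
apply: (le_trans (le_normr_Rintegral _ _)) => //.
have Cd x : (`[a, b] `\` excised a b xi d) x -> `|x - xi| < d.
  by move=> [xab xX]; rewrite ltNge; apply/negP => dx; apply: xX.
apply: (@le_trans _ _ (2 * M * d)).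
  apply: (@Rintegral_bounded_le _ _ xi) => //.
    move=> x /Cd/ltW; rewrite /=in_itv/= ler_norml => /andP[? ?].
    by apply/andP; split; lra.
  move=> x xX; have [xab _] := xX; apply: gnear; first by move: xab; rewrite /= in_itv.
  by apply: le_trans dr; exact/ltW/Cd.
have dM : d <= e / (2 * M + 1) by near: d; exact: nbhs_right_le.
apply: (@le_trans _ _ ((2 * M + 1) * d)); first by rewrite ler_wpM2r ?ltW//; lra.
by rewrite mulrC -ler_pdivlMr.
Unshelve. all: by end_near. Qed.

End real_principal_value.

(** * Fubini's theorem for real-valued integrals over product sets *)

Section real_fubini.
Context {R : realType}.
Notation mu := (@lebesgue_measure R).

(** The inner integrals in Fubini's theorem are extended reals, finite almost everywhere; this makes
    them real without changing their integral. *)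
Lemma integrable_fine (A : set R) (g : R -> \bar R) : measurable A ->
  mu.-integrable A g ->
  mu.-integrable A (EFin \o (fine \o g)) /\
  \int[mu]_(x in A) fine (g x) = fine (\int[mu]_(x in A) g x).
Proof.
move=> mA ig; have mg := measurable_int _ ig.
have mf : measurable_fun A (EFin \o (fine \o g)).
  apply/measurable_EFinP; exact: (measurableT_comp (fine_measurable measurableT)).
have efg : ae_eq mu A (EFin \o (fine \o g)) g.
  have := @integrable_ae _ (measurableTypeR R) R mu A mA g ig.
  apply: filterS => x h Ax /=.
  by rewrite fineK// h.
split; last by congr fine; exact: ae_eq_integral.
apply/integrableP; split => //.
have [_] := integrableP _ _ _ ig; congr (_ < _)%E.
apply: ae_eq_integral => //; try exact: measurableT_comp.
by apply: filterS efg => x h Ax; rewrite h.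
Qed.

(** By Tonelli's theorem the majorant [h] of the inner absolute integrals makes [F], extended by 0
    outside A x B, integrable on the plane, where Fubini's theorem applies. *)
Lemma Rintegral_Fubini (A B : set R) (F : R -> R -> R) (h : R -> R) :
  measurable A -> measurable B ->
  measurable_fun (A `*` B) (fun z : R * R => F z.1 z.2) ->
  (forall s, A s -> mu.-integrable B (EFin \o F s)) ->
  (forall s, A s -> \int[mu]_(t in B) `|F s t| <= h s) ->
  mu.-integrable A (EFin \o h) ->
  [/\ mu.-integrable A (EFin \o (fun s => \int[mu]_(t in B) F s t)),
      mu.-integrable B (EFin \o (fun t => \int[mu]_(s in A) F s t)) &
      \int[mu]_(s in A) \int[mu]_(t in B) F s t =
      \int[mu]_(t in B) \int[mu]_(s in A) F s t].
Proof.
move=> mA mB mF iF hF ih.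
pose T := measurableTypeR R; pose f : T * T -> \bar R := (EFin \o (fun z : R * R => F z.1 z.2)) \_ (A `*` B).
have mf : measurable_fun setT f.
  apply/(measurable_restrictT _ (measurableX mA mB)).
  exact/measurable_EFinP.
(* Taken once with the absolute value, for integrability, and once with the identity, for the
   iterated integral. *)
have row (phi : \bar R -> \bar R) : phi 0%E = 0%E -> forall s, (\int[mu]_t phi (f (s, t)) =
    ((fun s => \int[mu]_(t in B) phi (F s t)%:E) \_ A) s)%E.
  move=> phi0 s; rewrite patchE; case: ifPn => sA.
    rewrite [RHS]integral_mkcond; apply: eq_integral => t _.
    by rewrite /f !patchE in_setX sA/=; case: ifPn.
  rewrite -[RHS](integral0 mu setT); apply: eq_integral => t _.
  by rewrite /f patchE in_setX (negbTE sA).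
have col t : (\int[mu]_s f (s, t) =
    ((fun t => \int[mu]_(s in A) (F s t)%:E) \_ B) t)%E.
  rewrite patchE; case: ifPn => tB.
    rewrite [RHS]integral_mkcond; apply: eq_integral => s _.
    by rewrite /f !patchE in_setX tB/= andbT; case: ifPn.
  rewrite -[RHS](integral0 mu setT); apply: eq_integral => s _.
  by rewrite /f patchE in_setX (negbTE tB) andbF.
have intf : (mu \x mu)%E.-integrable setT f.
  apply/(@integrable12ltyP _ _ T T R mu mu f mf).
  under eq_integral do rewrite (row abse abse0).
  rewrite -integral_mkcond.
  have [_] := integrableP _ _ _ ih; apply: le_lt_trans.
  apply: ge0_le_integral => //.
  - by move=> s _; apply: integral_ge0.
  - apply: (@eq_measurable_fun _ _ _ _ _ (fun s => \int[mu]_t `|f (s, t)|)%E).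
      by move=> s sA; rewrite (row abse abse0) patchE sA.
    apply: measurable_funTS.
    apply: (@measurable_fun_fubini_tonelli_F _ _ T T R mu (abse \o f)).
      exact: measurableT_comp.
    by move=> z /=; exact: abse_ge0.
  - exact: measurable_int (integrable_norm_real ih).
  - move=> s As /=; have iN := integrable_norm_real (iF _ As).
    rewrite (_ : (\int[mu]_(t in B) `|(F s t)%:E|)%E = (\int[mu]_(t in B) `|F s t|)%:E).
      by rewrite lee_fin (le_trans (hF _ As))// ler_norm.
    by rewrite /Rintegral fineK//; exact: integrable_fin_num iN.
pose G1 s := (\int[mu]_(t in B) (F s t)%:E)%E.
pose G2 t := (\int[mu]_(s in A) (F s t)%:E)%E.
have E1 : fubini_F mu f = G1 \_ A by apply/funext => s; exact: (row id).
have E2 : fubini_G mu f = G2 \_ B by apply/funext => t; exact: col.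
have i1 : mu.-integrable A G1.
  by apply/(@integrable_mkcond _ T R mu A G1 mA); rewrite -E1;
    exact: (@integrable_fubini_F _ _ T T R mu mu f intf).
have i2 : mu.-integrable B G2.
  apply/(@integrable_mkcond _ T R mu B G2 mB); rewrite -E2.
  apply/integrableP; split; first exact: (@measurable_fubini_G _ _ T T R mu mu f intf).
  have := (@integrable21ltyP _ _ T T R mu mu f mf).1 intf.
  apply: le_lt_trans; apply: ge0_le_integral => //.
  - by apply: measurableT_comp => //; exact: (@measurable_fubini_G _ _ T T R mu mu f intf).
  - apply: (@measurable_fun_fubini_tonelli_G _ _ T T R mu (abse \o f)).
      exact: measurableT_comp.
    by move=> z /=; exact: abse_ge0.
  - move=> t _; apply: le_abse_integral => //.
    by apply: (@measurableT_comp _ _ _ _ _ _ f) => //; exact: measurable_pair2.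
have [j1 e1] := integrable_fine mA i1; have [j2 e2] := integrable_fine mB i2.
split; [exact: j1|exact: j2|].
rewrite [LHS]e1 [RHS]e2; congr fine.
rewrite integral_mkcond [RHS]integral_mkcond -E1 -E2.
exact: (@Fubini _ _ T T R mu mu f intf).
Qed.
End real_fubini.

(** * Kernels with a weak singularity on the diagonal, and their truncated Cauchy integrals *)

Section singular_kernel.
Context {R : realType}.
Implicit Types (f g F : R -> R) (a b c d x y M m l e r xi s t eta : R) (A : set R).
Implicit Types (K : R -> R -> R).
Notation mu := (@lebesgue_measure R).

Lemma powR_anti m x y : 0 <= m -> 0 < x -> x <= y -> y `^ (- m) <= x `^ (- m).
Proof.
move=> m0 x0 xy; have y0 := lt_le_trans x0 xy.
by rewrite !powRN lef_pV2 ?posrE ?powR_gt0// ge0_ler_powR// ?nnegrE ltW.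
Qed.

Lemma dpow_ge0 m c x : 0 <= dpow m c x. Proof. exact: powR_ge0. Qed.

Lemma dpow_sym m c x : dpow m c x = dpow m x c.
Proof. by rewrite /dpow distrC. Qed.

(** Replacing the larger of the two distances by the smaller one only increases the product, which
    becomes a single power. *)
Lemma dpow_mul_le m1 m2 c d x : 0 <= m1 -> 0 <= m2 -> x != c -> x != d ->
  dpow m1 c x * dpow m2 d x <= dpow (m1 + m2) c x + dpow (m1 + m2) d x.
Proof.
move=> m10 m20 xc xd.
have p0 : 0 < `|x - c| by rewrite normr_gt0 subr_eq0.
have q0 : 0 < `|x - d| by rewrite normr_gt0 subr_eq0.
rewrite /dpow !opprD !powRD; last 2 first.
- by rewrite (gt_eqF q0) implybT.
- by rewrite (gt_eqF p0) implybT.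
have [pq|qp] := leP `|x - c| `|x - d|.
  rewrite ler_wpDr ?mulr_ge0 ?powR_ge0// ler_wpM2l ?powR_ge0//.
  exact: powR_anti.
rewrite ler_wpDl ?mulr_ge0 ?powR_ge0// ler_wpM2r ?powR_ge0//.
exact/powR_anti/ltW.
Qed.

(* The factor r^-2 is what the quotient in atan ((h s - g t) / (s - t)) costs; the
   exponent 1/8 is an arbitrary small one, absorbing the logarithm. *)
Record singular_kernel a b K : Prop := SingularKernel {
  sk_meas : measurable_fun setT (fun z : R * R => K z.1 z.2);
  sk_bound : exists2 C : R, 0 <= C & forall s t, a <= s <= b -> a <= t <= b ->
    s != t -> `|K s t| <= C * dpow 8^-1 s t;
  sk_lip : forall c d, a < c -> c <= d -> d < b -> exists2 C : R, 0 <= C &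
    forall r s t t', 0 < r -> a <= s <= b -> c <= t <= d -> c <= t' <= d ->
      r <= `|t - s| -> r <= `|t' - s| ->
      `|K s t - K s t'| <= C / r ^+ 2 * `|t - t'| }.

Lemma singular_kernel_integrable a b K s : a < b -> a <= s <= b ->
  singular_kernel a b K -> mu.-integrable `[a, b] (EFin \o K s).
Proof.
move=> ab sab [mK [C C0 KC] _].
have [J J0 HJ] := @integral_dpow_itv R 8^-1 a b (ltac:(lra)) ab.
have [iJ _] := HJ s sab `[a, b]%classic (measurable_itv _) (@subset_refl _ _).
(* The constant summand takes care of t = s, where [sk_bound] says nothing. *)
apply: (@integrable_le _ _ _ (fun t => C * dpow 8^-1 s t + `|K s s|)) => //.
- apply: measurable_funTS.
  exact: (@measurableT_comp _ _ _ _ _ _ (fun z : R * R => K z.1 z.2) _ (pair s)).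
- move=> t /=; rewrite in_itv/= => tab; have [<-|st] := eqVneq s t.
    by rewrite ler_wpDl// mulr_ge0// dpow_ge0.
  by rewrite ler_wpDr// KC.
- apply: integrableD_real => //; first exact: integrableZ_real.
  exact: (integrable_cst_itv _ _ (@subset_refl _ _)).
Qed.

Lemma singular_kernel_norm_le a b K : a < b -> singular_kernel a b K ->
  exists2 C : R, 0 <= C & forall s, a <= s <= b -> \int[mu]_(t in `[a, b]) `|K s t| <= C.
Proof.
move=> ab sk; have [mK [C C0 KC] _] := sk.
have [J J0 HJ] := @integral_dpow_itv R 8^-1 a b (ltac:(lra)) ab.
exists (C * J) => [|s sab]; first exact: mulr_ge0.
have [iJ lJ] := HJ s sab `[a, b]%classic (measurable_itv _) (@subset_refl _ _).
have iK := singular_kernel_integrable ab sab sk.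
apply: (@le_trans _ _ (\int[mu]_(t in `[a, b]) (C * dpow 8^-1 s t))).
  apply: (@le_Rintegral_off_point _ _ s) => //.
  - exact: integrable_norm_real.
  - exact: integrableZ_real.
  - move=> t /=; rewrite in_itv/= => tab ts; rewrite KC// eq_sym//.
by rewrite RintegralZl// ler_wpM2l.
Qed.

Lemma singular_kernel_cut a b K c d : a < c -> c <= d -> d < b ->
  singular_kernel a b K -> exists2 C : R, 0 <= C &
  forall xi s, c <= xi <= d -> a <= s <= b -> s != xi ->
    (forall e, 0 < e -> `|pv_cut a b (K s) xi e| <= C * dpow 2^-1 xi s) /\
    exists l, pv_cut a b (K s) xi e @[e --> 0^'+] --> l.
Proof.
move=> ac cd db sk; have [mK [A A0 KA] KL] := sk.
have ab : a < b by lra.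
have h8 : 0 <= 8^-1 :> R by [].
have h34 : 0 <= 3 / 4 :> R by lra.
pose l := b - a; have l0 : 0 < l by rewrite /l; lra.
(* Points t close to xi may leave [c, d], so the Lipschitz bound is taken on [c - r0, d + r0]; the
   factor 2 keeps this inside ]a, b[. *)
have [r0 r00 [r0c r0d]] : exists2 r0 : R, 0 < r0 & 2 * r0 <= c - a /\ 2 * r0 <= b - d.
  exists (Num.min (c - a) (b - d) / 2).
    by rewrite divr_gt0// lt_min; apply/andP; split; lra.
  by rewrite mulrCA mulfV// mulr1 !ge_min !lexx orbT.
have [M M0 HM] := KL (c - r0) (d + r0) (ltac:(lra)) (ltac:(lra)) (ltac:(lra)).
have [J J0 HJ] := @integral_dpow_itv R (8^-1 + 3 / 4) a b (ltac:(lra)) ab.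
(* With p = |s - xi| and r = k p^2: the part |t - xi| <= r costs O(r / p^2), and
   on |t - xi| >= r one has 1/|t - xi| <= r^(-1/4) |t - xi|^(-3/4), which costs
   O(r^(-1/4)) = O(p^(-1/2)). *)
pose k := r0 / l ^+ 2.
have k0 : 0 < k by rewrite divr_gt0// exprn_gt0.
have kge := ltW k0; have lge := ltW l0; have r0ge := ltW r00.
exists (8 * M * k * l `^ 2^-1 + A * k `^ (- 4^-1) * (2 * J)).
  by apply: addr_ge0; do ?apply: mulr_ge0 => //; exact: powR_ge0.
move=> xi s /andP[cxi xid] sab sxi.
pose p : R := `|s - xi|; have p0 : 0 < p by rewrite normr_gt0 subr_eq0.
have pge := ltW p0.
have pl : p <= l.
  rewrite /p /l ler_norml; move: sab => /andP[h1 h2].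
  by clear -cxi xid ac db h1 h2; apply/andP; split; lra.
pose r := k * p ^+ 2.
have r_gt0 : 0 < r by rewrite mulr_gt0// exprn_gt0.
have rge := ltW r_gt0.
(* Since p <= l, the choice of k makes r <= r0, which keeps t in the enlarged interval, and r <= p /
   2, which keeps t at distance at least p / 2 from s. *)
have rr0 : r <= r0.
  rewrite /r /k mulrAC ler_pdivrMr ?exprn_gt0// ler_wpM2l//.
  by rewrite lerXn2r.
have rp : r <= p / 2.
  rewrite /r /k mulrAC ler_pdivrMr ?exprn_gt0//.
  have r0l : r0 <= l / 2 by rewrite /l; lra.
  apply: (@le_trans _ _ (l / 2 * p ^+ 2)); first by rewrite ler_wpM2r ?sqr_ge0.
  rewrite (_ : l / 2 * p ^+ 2 = p / 2 * (l * p)); last by ring.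
  by rewrite ler_wpM2l ?divr_ge0// expr2 ler_wpM2l.
have iK := singular_kernel_integrable ab sab sk.
have near t : a <= t <= b -> `|t - xi| <= r ->
    `|K s t - K s xi| <= (4 * M / p ^+ 2) * `|t - xi|.
  move=> tab tr.
  have := HM (p / 2) s t xi (ltac:(by rewrite divr_gt0)) sab.
  rewrite (_ : M / (p / 2) ^+ 2 = 4 * M / p ^+ 2); last by field; rewrite gt_eqF.
  apply.
  - move: tr; rewrite ler_norml => /andP[h1 h2].
    by clear -cxi xid rr0 h1 h2; apply/andP; split; lra.
  - by clear -cxi xid r00; apply/andP; split; lra.
  - have := ler_distD t s xi; rewrite -/p (distrC s t) => h; clear -tr rp h; lra.
  - by rewrite distrC -/p; clear -p0; lra.
have M'0 : 0 <= 4 * M / p ^+ 2 by rewrite divr_ge0 ?sqr_ge0// mulr_ge0.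
have xiab : a <= xi <= b by clear -cxi xid ac db; apply/andP; split; lra.
have rab : a <= xi - r /\ xi + r <= b by clear -cxi xid rr0 r0c r0d r00; split; lra.
have [bnd lim] := pv_cut_lipschitz r_gt0 M'0 xiab iK near (or_intror rab).
split=> // e e0; apply: (le_trans (bnd e e0)); rewrite [leRHS]mulrDl; apply: lerD.
  (* The near part is constant because r / p^2 = k; since p <= l, the factor l^(1/2) p^(-1/2) is at
     least 1 and absorbs it into the required power. *)
  rewrite (_ : 2 * (4 * M / p ^+ 2) * r = 8 * M * k); last first.
    by rewrite /r; field; rewrite gt_eqF.
  have Mk0 : 0 <= 8 * M * k by apply: mulr_ge0 => //; exact: mulr_ge0.
  rewrite -[leRHS]mulrA ler_peMr//.
  have E1 : l `^ 2^-1 * l `^ (- 2^-1) = 1.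
    by rewrite -powRD ?subrr ?powRr0// (gt_eqF l0) implybT.
  by rewrite -[leLHS]E1 ler_wpM2l ?powR_ge0//; exact: powR_anti.
have mX := measurable_excised a b xi r.
have [i1 l1] := HJ s sab _ mX (@excised_sub R a b xi r).
have [i2 l2] := HJ xi xiab _ mX (@excised_sub R a b xi r).
apply: (@le_trans _ _ (\int[mu]_(t in excised a b xi r)
   (A * r `^ (- 4^-1) * (dpow (8^-1 + 3 / 4) s t + dpow (8^-1 + 3 / 4) xi t)))).
  apply: (@le_Rintegral_off_point _ _ s) => //.
  - by apply: integrable_norm_real; exact: integrable_excised_div.
  - by apply: integrableZ_real => //; exact: integrableD_real.
  move=> t [tab /= rt] ts.
  have txi : t != xi by apply: contraTneq rt => ->; rewrite subrr normr0 -ltNge.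
  rewrite normrM normfV.
  apply: (@le_trans _ _ (A * dpow 8^-1 s t * `|t - xi|^-1)).
    rewrite ler_wpM2r// KA 1?eq_sym//; by move: tab; rewrite /= in_itv.
  rewrite -!mulrA ler_wpM2l//.
  apply: le_trans (ler_wpM2l (powR_ge0 _ _) (dpow_mul_le h8 h34 ts txi)).
  rewrite mulrCA ler_wpM2l ?dpow_ge0//.
  have q0 : 0 < `|t - xi| by rewrite normr_gt0 subr_eq0.
  have -> : `|t - xi|^-1 = `|t - xi| `^ (- 4^-1) * dpow (3 / 4) xi t.
    rewrite /dpow -powRD; last by rewrite (gt_eqF q0) implybT.
    by rewrite -[LHS]powR_inv1//; congr (_ `^ _); field.
  by rewrite ler_wpM2r ?dpow_ge0//; exact: powR_anti.
rewrite RintegralZl//; last exact: integrableD_real.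
rewrite RintegralD//.
have -> : r `^ (- 4^-1) = k `^ (- 4^-1) * dpow 2^-1 xi s.
  rewrite /r powRM ?sqr_ge0// /dpow -/p -[p ^+ 2]powR_mulrn//.
  by rewrite -powRrM; congr (_ * _ `^ _); field.
rewrite [leRHS]mulrAC mulrA; apply: ler_wpM2l; last first.
  by rewrite [leRHS]mulr_natl mulr2n; exact: lerD.
by apply: mulr_ge0; [apply: mulr_ge0 => //; exact: powR_ge0|exact: dpow_ge0].
Qed.


End singular_kernel.

(** * Interchange of a principal value with a weighted integral, for real functions *)

Section singular_interchange.
Context {R : realType}.
Implicit Types (f g F w : R -> R) (a b c d x y M m l e r xi s t eta : R) (A : set R).
Implicit Types (K : R -> R -> R).
Notation mu := (@lebesgue_measure R).

Definition locally_bounded_oo a b w : Prop :=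
  forall c d, a < c -> d < b -> exists W : R, forall s, c <= s <= d -> `|w s| <= W.

(** [w] may blow up at the ends and [g] at c, but never together: within distance r of c the weight
    is bounded, and farther away the power is at most r^(-m) while [w] is integrable. *)
Lemma integrable_weight_dpow a b w g m c C : a < c < b -> 0 <= m < 1 -> 0 <= C ->
  mu.-integrable `]a, b[ (EFin \o w) -> locally_bounded_oo a b w ->
  measurable_fun `]a, b[ (fun s => w s * g s) ->
  (forall s, a < s < b -> s != c -> `|g s| <= C * dpow m c s) ->
  mu.-integrable `]a, b[ (EFin \o (fun s => w s * g s)).
Proof.
move=> /andP[ac cb] m01 C0 iw bw mwg gC; have /andP[m0 m1] := m01.
have ab := lt_trans ac cb.
have [r r0 [rc rd]] : exists2 r : R, 0 < r & a < c - r /\ c + r < b.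
  exists (Num.min (c - a) (b - c) / 2).
    by rewrite divr_gt0// lt_min; apply/andP; split; lra.
  have [h|h] := leP (c - a) (b - c); split; lra.
have [W HW] := bw _ _ rc rd.
have W0 : 0 <= W by apply: le_trans (HW c _) => //; apply/andP; split; lra.
have [J J0 HJ] := integral_dpow_itv m01 ab.
have cab : a <= c <= b by rewrite !ltW.
have sub : `]a, b[ `<=` `[a, b] by exact: subset_itv_oo_cc.
have [iJ _] := HJ c cab `]a, b[%classic (measurable_itv _) sub.
apply: (@integrable_le _ _ _
  (fun s => W * C * dpow m c s + C * r `^ (- m) * `|w s| + `|w c * g c|)) => //.
  move=> s /=; rewrite in_itv/= => sab.
  have [->|sc] := eqVneq s c.
    by rewrite ler_wpDl// addr_ge0// !mulr_ge0// ?dpow_ge0 ?powR_ge0.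
  rewrite ler_wpDr// normrM.
  apply: (@le_trans _ _ (`|w s| * (C * dpow m c s))).
    by rewrite ler_wpM2l// gC.
  have [sr|sr] := leP `|s - c| r.
    rewrite ler_wpDr ?mulr_ge0 ?powR_ge0// mulrA ler_wpM2r ?dpow_ge0//.
    rewrite ler_wpM2r// HW//; move: sr; rewrite ler_norml => /andP[? ?].
    by apply/andP; split; lra.
  rewrite ler_wpDl ?mulr_ge0 ?dpow_ge0// mulrC -!mulrA ler_wpM2l//.
  by rewrite ler_wpM2r// powR_anti// ltW.
apply: integrableD_real => //.
  apply: integrableD_real => //; apply: integrableZ_real => //.
  exact: integrable_norm_real.
exact: integrable_cst_itv sub.
Qed.

Lemma integrable_off_ends a b f g A : measurable A -> A `<=` `[a, b] ->
  (forall x, A x -> a < x < b -> f x = g x) ->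
  mu.-integrable A (EFin \o g) -> mu.-integrable A (EFin \o f) /\
  \int[mu]_(x in A) f x = \int[mu]_(x in A) g x.
Proof.
move=> mA Aab fg ig.
have [i1 e1] := @integrable_off_point R A a (fun x => if x == a then f x else g x) g mA
  (ltac:(by move=> x _ /negbTE ->)) ig.
rewrite -e1; apply: (@integrable_off_point _ _ b) i1 => // x Ax xb.
have [//|xa] := eqVneq x a; apply: fg => //.
by have := Aab x Ax; rewrite /= in_itv/= !lt_neqAle xb eq_sym xa.
Qed.

Lemma measurable_section a b K t : singular_kernel a b K ->
  measurable_fun setT (K ^~ t).
Proof.
move=> [mK _ _].
exact: (@measurableT_comp _ _ _ _ _ _ (fun z : R * R => K z.1 z.2) _ (pair^~ t)).
Qed.

Lemma integrable_weight_kernel a b K w t : singular_kernel a b K ->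
  mu.-integrable `]a, b[ (EFin \o w) -> locally_bounded_oo a b w ->
  a < t < b -> mu.-integrable `]a, b[ (EFin \o (fun s => w s * K s t)).
Proof.
move=> sk iw bw tab; have [_ [C C0 KC] _] := sk.
apply: (integrable_weight_dpow tab (ltac:(lra) : 0 <= 8^-1 < 1) C0) => //.
  apply: measurable_funM; last by apply: measurable_funTS; exact: measurable_section sk.
  by apply/measurable_EFinP; exact: measurable_int iw.
move=> s /andP[? ?] st; rewrite dpow_sym; apply: KC => //; first by rewrite !ltW.
by case/andP : tab => ? ?; rewrite !ltW.
Qed.

Section interchange.
Variables (a b xi : R) (K : R -> R -> R) (w T : R -> R).
Hypotheses (sk : singular_kernel a b K) (xiab : a < xi < b)
  (iw : mu.-integrable `]a, b[ (EFin \o w)) (bw : locally_bounded_oo a b w)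
  (KT : forall s, a < s < b -> s != xi ->
     pv_cut a b (K s) xi e @[e --> 0^'+] --> T s).

Let ab : a < b. Proof. by case/andP : xiab => /lt_trans; apply. Qed.

Let mw : measurable_fun `]a, b[ w.
Proof. by apply/measurable_EFinP; exact: measurable_int iw. Qed.

(** On the truncated set 1/|t - xi| is at most 1/e, so a constant multiple of |w| dominates the
    inner integrals and Fubini's theorem applies. *)
Let cut_interchange e : 0 < e ->
  [/\ mu.-integrable `]a, b[ (EFin \o (fun s => w s * pv_cut a b (K s) xi e)),
      mu.-integrable (excised a b xi e) (EFin \o (fun t =>
        (\int[mu]_(s in `]a, b[) (w s * K s t)) / (t - xi))) &
      pv_cut a b (fun t => \int[mu]_(s in `]a, b[) (w s * K s t)) xi e =
      \int[mu]_(s in `]a, b[) (w s * pv_cut a b (K s) xi e)].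
Proof.
move=> e0; have mX := measurable_excised a b xi e.
have [C C0 HC] := singular_kernel_norm_le ab sk.
pose F s t := w s * K s t / (t - xi).
have sab s : `]a, b[%classic s -> a <= s <= b.
  by rewrite /= in_itv/= => /andP[? ?]; rewrite !ltW.
have iKX s : `]a, b[%classic s -> mu.-integrable (excised a b xi e) (EFin \o (fun t => K s t / (t - xi))).
  move=> /sab sab'; apply: integrable_excised_div => //.
  exact: singular_kernel_integrable.
have mF : measurable_fun (`]a, b[ `*` excised a b xi e) (fun z : R * R => F z.1 z.2).
  apply: measurable_funM; last first.
    apply: measurable_funTS; apply: (measurableT_comp (@measurable_inv R)).
    by apply: measurable_funB.
  apply: measurable_funM; last by apply: measurable_funTS; exact: sk_meas sk.
  apply: (measurable_comp (F := `]a, b[%classic)) => //.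
    by move=> _ [z [z1 _] <-].
  exact: measurable_funTS.
have iF s : `]a, b[%classic s -> mu.-integrable (excised a b xi e) (EFin \o F s).
  move=> sab'; have := integrableZ_real (w s) mX (iKX s sab').
  by apply: eq_integrable => // t _; rewrite /F /= mulrA.
have ih : mu.-integrable `]a, b[ (EFin \o (fun s => C * e^-1 * `|w s|)).
  by apply: integrableZ_real => //; exact: integrable_norm_real.
have hF s : `]a, b[%classic s ->
    \int[mu]_(t in excised a b xi e) `|F s t| <= C * e^-1 * `|w s|.
  move=> sab'; have iK := singular_kernel_integrable ab (sab s sab') sk.
  have iKe : mu.-integrable (excised a b xi e) (EFin \o (fun t => `|K s t|)).
    apply: integrable_norm_real; apply: integrableS iK => //; exact: excised_sub.
  apply: (@le_trans _ _ (\int[mu]_(t in excised a b xi e) (`|w s| * e^-1 * `|K s t|))).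
    apply: le_Rintegral => //.
    - by apply: integrable_norm_real; exact: iF.
    - exact: integrableZ_real.
    move=> t [_ /= et]; rewrite /F !normrM normfV -mulrA -[leRHS]mulrA ler_wpM2l//.
    rewrite [leRHS]mulrC ler_wpM2l// lef_pV2 ?posrE//.
    exact: lt_le_trans et.
  rewrite RintegralZl// [leRHS]mulrC -!mulrA; apply: ler_wpM2l => //.
  rewrite [leRHS]mulrC; apply: ler_wpM2l; first by rewrite invr_ge0 ltW.
  apply: le_trans (HC s (sab s sab')).
  apply: ge0_Rintegral_subset => //; first exact: integrable_norm_real.
  exact: excised_sub.
have [iA iB FE] := Rintegral_Fubini (measurable_itv _) mX mF iF hF ih.
have FA s : `]a, b[%classic s ->
    \int[mu]_(t in excised a b xi e) F s t = w s * pv_cut a b (K s) xi e.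
  move=> sab'; rewrite /pv_cut -RintegralZl//; last exact: iKX.
  by apply: eq_Rintegral => t _; rewrite /F mulrA.
(* [integrable_weight_kernel] controls the section at t only for interior t; the two ends are then
   removed by [integrable_off_ends]. *)
have inn t : excised a b xi e t -> a < t < b ->
    (\int[mu]_(s in `]a, b[) (w s * K s t)) / (t - xi) = \int[mu]_(s in `]a, b[) F s t.
  by move=> _ tab; rewrite -RintegralZr//; exact: integrable_weight_kernel sk iw bw tab.
have [jB jE] := integrable_off_ends mX (@excised_sub _ _ _ _ _) inn iB.
split=> //.
  by apply: eq_integrable iA => // s; rewrite inE /= => /FA ->.
rewrite [LHS]jE -FE; apply: eq_Rintegral => s; rewrite inE; exact: FA.
Qed.


(** Dominated convergence concerns sequences, so the truncation runs through an arbitrary null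
    sequence; the majorant comes from [singular_kernel_cut] and does not depend on n. *)
Let dominated (u : nat -> R) : (forall n, 0 < u n) -> u n @[n --> \oo] --> (0 : R) ->
  mu.-integrable `]a, b[ (EFin \o (fun s => w s * T s)) /\
  (\int[mu]_(s in `]a, b[) (w s * pv_cut a b (K s) xi (u n))) @[n --> \oo] -->
    \int[mu]_(s in `]a, b[) (w s * T s).
Proof.
move=> u0 ucv; have /andP[axi xib] := xiab.
have [C C0 HC] := singular_kernel_cut axi (lexx xi) xib sk.
have sab s : `]a, b[%classic s -> a <= s <= b.
  by rewrite /= in_itv/= => /andP[? ?]; rewrite !ltW.
have cutT s : `]a, b[%classic s -> s != xi ->
    (w s * pv_cut a b (K s) xi (u n)) @[n --> \oo] --> w s * T s.
  move=> sab' sxi; apply: cvgM; first exact: cvg_cst.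
  have := sab'; rewrite /= in_itv/= => /KT -/(_ sxi) /cvg_at_rightP; exact.
(* [T] is known only as a limit, and only off xi; setting the functions to 0 at xi makes the
   convergence hold everywhere. *)
have mwT : measurable_fun `]a, b[ (fun s => w s * T s).
  apply: (@measurable_fun_off_point R _ xi _ (fun s => if s == xi then 0 else w s * T s)) => //.
    apply: (@measurable_fun_cvg _ _ R _ (fun n s =>
      if s == xi then 0 else w s * pv_cut a b (K s) xi (u n))) => //.
      move=> n; apply: (@measurable_fun_off_point R _ xi _
        (fun s => w s * pv_cut a b (K s) xi (u n))) => //.
        have [iA _ _] := cut_interchange (u0 n).
        by apply/measurable_EFinP; exact: measurable_int iA.
      by move=> s _ /negbTE ->.
    move=> s sab'; case: ifPn => [_|sxi]; first exact: cvg_cst.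
    exact: cutT.
  by move=> s _ /negbTE ->.
have iD : mu.-integrable `]a, b[ (EFin \o (fun s => `|w s| * (C * dpow 2^-1 xi s))).
  have iw' := integrable_norm_real iw.
  apply: (integrable_weight_dpow xiab (ltac:(lra) : 0 <= 2^-1 < 1) C0) => //.
  - by move=> c d ac db; have [W HW] := bw ac db; exists W => s /HW; rewrite normr_id.
  - apply: measurable_funM.
      by apply/measurable_EFinP; exact: measurable_int iw'.
    by apply: measurable_funM => //; exact: measurable_dpow.
  - by move=> s _ _; rewrite ger0_norm// mulr_ge0// dpow_ge0.
pose f_ n s := (w s * pv_cut a b (K s) xi (u n))%:E.
pose f s := (w s * T s)%:E.
pose g := EFin \o (fun s => `|w s| * (C * dpow 2^-1 xi s)).
have mf_ n : measurable_fun `]a, b[ (f_ n).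
  by have [iA _ _] := cut_interchange (u0 n); exact: measurable_int iA.
have mf : measurable_fun `]a, b[ f by exact/measurable_EFinP.
have ae_off (P : R -> Prop) : (forall s, s != xi -> P s) -> {ae mu, forall s, P s}.
  move=> PP; exists [set xi]; split => //; first exact: lebesgue_measure_set1.
  by move=> s /= nP; apply/eqP/negPn/negP => /PP.
have cvf : {ae mu, forall s, `]a, b[%classic s -> f_ n s @[n --> \oo] --> f s}.
  apply: ae_off => s sxi sab'; apply/cvg_EFin; first by near=> n.
  exact: cutT.
have bndf : {ae mu, forall s, forall n, `]a, b[%classic s ->
    (`|f_ n s| <= g s)%E}.
  apply: ae_off => s sxi n sab'; rewrite /f_ /g /= lee_fin normrM ler_wpM2l//.
  by have [h _] := HC xi s (ltac:(by rewrite lexx)) (sab s sab') sxi; exact: h.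
have [i1 _ lim1] := @dominated_convergence _ (measurableTypeR R) R mu `]a, b[%classic
  (measurable_itv _) f_ f _ mf_ mf cvf iD bndf.
split; first exact: i1.
rewrite /Rintegral; apply: fine_cvg; rewrite fineK //; exact: (integrable_fin_num _ i1).
Unshelve. all: by end_near. Qed.

Lemma singular_interchange :
  [/\ mu.-integrable `]a, b[ (EFin \o (fun s => w s * T s)),
      (forall e, 0 < e -> mu.-integrable (excised a b xi e) (EFin \o (fun t =>
        (\int[mu]_(s in `]a, b[) (w s * K s t)) / (t - xi)))) &
      pv_cut a b (fun t => \int[mu]_(s in `]a, b[) (w s * K s t)) xi e @[e --> 0^'+] -->
        \int[mu]_(s in `]a, b[) (w s * T s)].
Proof.
split.
- by have [] := @dominated (fun n => n.+1%:R^-1) (fun n => harmonic_gt0 n) (@cvg_harmonic R).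
- by move=> e /cut_interchange[].
- apply/cvg_at_rightP => u [u0 ucv].
  have [_ lim] := dominated u0 ucv; rewrite (_ : (fun n => pv_cut a b _ xi (u n)) =
    (fun n => \int[mu]_(s in `]a, b[) (w s * pv_cut a b (K s) xi (u n))))//.
  by apply/funext => n; have [_ _ ->] := cut_interchange (u0 n).
Qed.
End interchange.
End singular_interchange.

(** * The fundamental solution on the boundary lines *)

Section kernels.
Context {R : realType}.
Implicit Types (f g h F w gj gk : R -> R) (a b c d x y p q M B L m l e r xi s t eta : R) (A : set R).
Implicit Types (K : R -> R -> R).
Notation mu := (@lebesgue_measure R).

Lemma singular_kernelD a b K1 K2 : singular_kernel a b K1 -> singular_kernel a b K2 ->
  singular_kernel a b (fun s t => K1 s t + K2 s t).
Proof.
move=> [m1 [C1 C10 b1] l1] [m2 [C2 C20 b2] l2]; split.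
- exact: measurable_funD.
- exists (C1 + C2) => [|s t sab tab st]; first exact: addr_ge0.
  by rewrite mulrDl (le_trans (ler_normD _ _))// lerD ?b1 ?b2.
- move=> c d ac cd db; have [D1 D10 L1] := l1 c d ac cd db.
  have [D2 D20 L2] := l2 c d ac cd db; exists (D1 + D2); first exact: addr_ge0.
  move=> r s t t' r0 sab tcd t'cd rt rt'.
  rewrite !mulrDl opprD addrACA (le_trans (ler_normD _ _))// lerD//.
    exact: L1.
  exact: L2.
Qed.

Lemma singular_kernelZ a b k K : singular_kernel a b K ->
  singular_kernel a b (fun s t => k * K s t).
Proof.
move=> [m1 [C1 C10 b1] l1]; split.
- exact: measurable_funM.
- exists (`|k| * C1) => [|s t sab tab st]; first exact: mulr_ge0.
  by rewrite normrM -mulrA ler_wpM2l// b1.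
- move=> c d ac cd db; have [D1 D10 L1] := l1 c d ac cd db.
  exists (`|k| * D1) => [|r s t t' r0 sab tcd t'cd rt rt']; first exact: mulr_ge0.
  by rewrite -mulrBr normrM -!mulrA ler_wpM2l// mulrA L1.
Qed.

(** This absorbs bounded terms into the power |s - t|^(-m). *)
Lemma dpow_lower_bound m a b s t : 0 <= m -> a <= s <= b -> a <= t <= b -> s != t ->
  1 <= (b - a) `^ m * dpow m s t.
Proof.
move=> m0 /andP[? ?] /andP[? ?] st.
have p0 : 0 < `|t - s| by rewrite normr_gt0 subr_eq0 eq_sym.
have pl : `|t - s| <= b - a by rewrite ler_norml; apply/andP; split; lra.
have l0 := lt_le_trans p0 pl.
have E1 : (b - a) `^ m * (b - a) `^ (- m) = 1.
  by rewrite -powRD ?subrr ?powRr0// (gt_eqF l0) implybT.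
by rewrite -[leLHS]E1 ler_wpM2l ?powR_ge0//; exact: powR_anti.
Qed.

Lemma ln_lipschitz q x y : 0 < q -> q <= x -> q <= y -> `|ln x - ln y| <= q^-1 * `|x - y|.
Proof.
move=> q0; wlog xy : x y / x <= y.
  move=> h qx qy; have [xy|/ltW yx] := leP x y; first exact: h.
  by rewrite distrC [`|x - y|]distrC; exact: h.
move=> qx qy; have x0 := lt_le_trans q0 qx; have y0 := lt_le_trans q0 qy.
rewrite distrC [`|x - y|]distrC !ger0_norm ?subr_ge0//; last by rewrite ler_ln.
rewrite -ln_div ?posrE//.
have -> : y / x = 1 + x^-1 * (y - x) by field; rewrite gt_eqF.
apply: le_trans (le_ln1Dx _) _.
  by apply: (lt_le_trans (ltrN10 R)); rewrite mulr_ge0 ?invr_ge0 ?subr_ge0// ltW.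
by rewrite ler_wpM2r ?subr_ge0// lef_pV2.
Qed.

Lemma atan_lipschitz x y : `|atan x - atan y| <= `|x - y|.
Proof.
wlog xy : x y / x <= y.
  move=> h; have [xy|/ltW yx] := leP x y; first exact: h.
  by rewrite distrC [leRHS]distrC; exact: h.
rewrite distrC [leRHS]distrC.
have [] := @MVT_segment R atan (fun z => (1 + z ^+ 2)^-1) x y xy.
  by apply: continuous_subspaceT => z; exact: continuous_atan.
move=> z _ ->; rewrite normrM ler_piMl// normfV invf_le1.
  by rewrite ger0_norm ?addr_ge0 ?sqr_ge0// lerDl sqr_ge0.
by rewrite normr_gt0 gt_eqF// ltr_pwDl// sqr_ge0.
Qed.

Section ln_atan.
Variables (a b : R) (h g : R -> R) (B : R).
Hypotheses (ab : a < b) (mh : measurable_fun setT h) (mg : measurable_fun setT g)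
  (hB : forall s, a <= s <= b -> `|h s| <= B) (gB : forall t, a <= t <= b -> `|g t| <= B)
  (gL : forall c d, a < c -> d < b -> exists2 L : R, 0 <= L &
     forall t t', c <= t <= d -> c <= t' <= d -> `|g t - g t'| <= L * `|t - t'|).

Let B0 : 0 <= B.
Proof. by apply: le_trans (hB (s := a) _) => //; rewrite lexx ltW. Qed.

Let pB s t : a <= s <= b -> a <= t <= b -> `|h s - g t| <= 2 * B.
Proof.
move=> sab tab; apply: (le_trans (ler_normB _ _)).
by rewrite [leRHS]mulr_natl mulr2n lerD ?hB ?gB.
Qed.

Let dB s t : a <= s <= b -> a <= t <= b -> `|s - t| <= b - a.
Proof. by move=> /andP[? ?] /andP[? ?]; rewrite ler_norml; apply/andP; split; lra. Qed.

Let mhg : measurable_fun setT (fun z : R * R => h z.1 - g z.2).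
Proof. by apply: measurable_funB; exact: measurableT_comp. Qed.

Let md : measurable_fun setT (fun z : R * R => z.1 - z.2).
Proof. exact: measurable_funB. Qed.

Let kernel_var s t t' L : `|g t - g t'| <= L * `|t - t'| ->
  `|(h s - g t) - (h s - g t')| <= L * `|t - t'| /\ `|(s - t) - (s - t')| = `|t - t'|.
Proof.
have -> : (h s - g t) - (h s - g t') = - (g t - g t') by ring.
have -> : (s - t) - (s - t') = - (t - t') by ring.
by rewrite !normrN.
Qed.

(** Above, ln X < X <= Q. Below, X >= |s - t|^2 and ln z < z at z = |s - t|^(-1/8) give -ln X <= 16
    |s - t|^(-1/8). At distance r the argument is at least r^2, where ln has Lipschitz constant
    r^-2. *)
Lemma singular_kernel_ln :
  singular_kernel a b (fun s t => ln ((h s - g t) ^+ 2 + (s - t) ^+ 2)).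
Proof.
have l0 : 0 <= b - a by rewrite subr_ge0 ltW.
pose Q := (2 * B) ^+ 2 + (b - a) ^+ 2.
split.
- apply: measurableT_comp => //.
  by apply: measurable_funD; exact: measurable_funX.
- exists (Q * (b - a) `^ 8^-1 + 16) => [|s t sab tab st].
    by rewrite addr_ge0// mulr_ge0 ?powR_ge0// addr_ge0 ?sqr_ge0.
  set X := (X in `|ln X|).
  have p0 : 0 < `|t - s| by rewrite normr_gt0 subr_eq0 eq_sym.
  have pX : `|t - s| ^+ 2 <= X by rewrite /X distrC real_normK ?num_real// lerDr sqr_ge0.
  have X0 : 0 < X by apply: lt_le_trans pX; rewrite exprn_gt0.
  have XQ : X <= Q.
    by rewrite lerD// -[leLHS]real_normK ?num_real// lerXn2r ?nnegrE ?mulr_ge0 ?pB ?dB.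
  have Q0 : 0 <= Q by exact/ltW/(lt_le_trans X0).
  have Q_dpow : Q <= Q * (b - a) `^ 8^-1 * dpow 8^-1 s t.
    by rewrite -[leRHS]mulrA ler_peMr// dpow_lower_bound.
  have d0 := dpow_ge0 8^-1 s t.
  rewrite mulrDl ler_norml; apply/andP; split; last first.
    rewrite ler_wpDr ?mulr_ge0// (le_trans (ltW (ln_sublinear X0)))//.
    exact: le_trans XQ Q_dpow.
  rewrite lerNl ler_wpDl//; first exact: le_trans Q_dpow.
  have : ln (`|t - s| ^+ 2) <= ln X by rewrite ler_ln ?posrE ?exprn_gt0.
  rewrite lnXn// => lnp.
  have := ln_sublinear (powR_gt0 (- 8^-1) p0).
  rewrite ln_powR -/(dpow 8^-1 s t) => lnp2; lra.
- move=> c d ac cd db; have [L L0 HL] := gL ac db.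
  exists (L * (4 * B) + 2 * (b - a)) => [|r s t t' r0 sab tcd t'cd rt rt'].
    by rewrite addr_ge0 ?mulr_ge0.
  have tab x : c <= x <= d -> a <= x <= b by move=> /andP[? ?]; apply/andP; split; lra.
  have r2 t1 : r <= `|t1 - s| -> r ^+ 2 <= (h s - g t1) ^+ 2 + (s - t1) ^+ 2.
    move=> rt1; rewrite ler_wpDl ?sqr_ge0// -[leRHS]real_normK ?num_real// distrC.
    by rewrite lerXn2r ?nnegrE// ltW.
  apply: le_trans (ln_lipschitz _ (r2 t rt) (r2 t' rt')) _; first exact: exprn_gt0.
  rewrite [leRHS]mulrAC [leRHS]mulrC; apply: ler_wpM2l; first by rewrite invr_ge0 sqr_ge0.
  have [v1 v2] := kernel_var s (HL t t' tcd t'cd).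
  set p := h s - g t in v1 *; set p' := h s - g t' in v1 *.
  set e := s - t in v2 *; set e' := s - t' in v2 *.
  have -> : p ^+ 2 + e ^+ 2 - (p' ^+ 2 + e' ^+ 2) = (p - p') * (p + p') + (e - e') * (e + e').
    by ring.
  apply: (le_trans (ler_normD _ _)); rewrite !normrM v2 [leRHS]mulrDl; apply: lerD.
    rewrite [leRHS]mulrAC; apply: ler_pM => //.
    apply: (le_trans (ler_normD _ _)); have := pB sab (tab _ tcd); have := pB sab (tab _ t'cd).
    rewrite -/p -/p'; lra.
  rewrite mulrC; apply: ler_wpM2r => //; apply: (le_trans (ler_normD _ _)).
  have := dB sab (tab _ tcd); have := dB sab (tab _ t'cd); rewrite -/e -/e'; lra.
Qed.

Lemma singular_kernel_atan :
  singular_kernel a b (fun s t => atan ((h s - g t) / (s - t))).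
Proof.
have l0 : 0 <= b - a by rewrite subr_ge0 ltW.
have pi0 : 0 <= pi / 2 :> R by rewrite divr_ge0 ?pi_ge0.
split.
- apply: (@measurableT_comp _ _ _ _ _ _ (@atan R)).
    by apply: continuous_measurable_fun => x; exact: continuous_atan.
  by apply: measurable_funM => //; exact: (measurableT_comp (@measurable_inv R)).
- exists (pi / 2 * (b - a) `^ 8^-1) => [|s t sab tab st].
    by rewrite mulr_ge0 ?powR_ge0.
  apply: (@le_trans _ _ (pi / 2)).
    by rewrite ler_norml !ltW ?atan_ltpi2 ?atan_gtNpi2.
  by rewrite -[leRHS]mulrA ler_peMr// dpow_lower_bound.
- move=> c d ac cd db; have [L L0 HL] := gL ac db.
  exists (2 * B + L * (b - a)) => [|r s t t' r0 sab tcd t'cd rt rt'].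
    by rewrite addr_ge0 ?mulr_ge0.
  have tab x : c <= x <= d -> a <= x <= b by move=> /andP[? ?]; apply/andP; split; lra.
  have [v1 v2] := kernel_var s (HL t t' tcd t'cd).
  apply: (le_trans (atan_lipschitz _ _)).
  have {}rt : r <= `|s - t| by rewrite distrC.
  have {}rt' : r <= `|s - t'| by rewrite distrC.
  have pe := pB sab (tab _ tcd); have de := dB sab (tab _ tcd).
  have e0 : s - t != 0 by rewrite -normr_gt0 (lt_le_trans r0).
  have e'0 : s - t' != 0 by rewrite -normr_gt0 (lt_le_trans r0).
  move: v1 v2 rt rt' pe de e0 e'0.
  set p := h s - g t; set p' := h s - g t'; set e := s - t; set e' := s - t'.
  move=> v1 v2 rt rt' pe de e0 e'0.
  (* The numerator is O(|t - t'|), and both factors of the denominator are at least r in modulus. *)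
  have -> : p / e - p' / e' = (p * (e' - e) + (p - p') * e) / (e * e').
    by field; rewrite e0 e'0.
  rewrite normrM normfV mulrAC ler_pM ?invr_ge0//.
    apply: (le_trans (ler_normD _ _)); rewrite !normrM mulrDl; apply: lerD.
      by rewrite [`|e' - e|]distrC v2 ler_wpM2r.
    by rewrite mulrAC ler_pM.
  rewrite lef_pV2 ?posrE ?exprn_gt0// ?normr_gt0 ?mulf_neq0// normrM expr2.
  by rewrite ler_pM// ltW.
Qed.

End ln_atan.


Lemma Re_div_complex (v p q : R) :
  complex.Re (v%:C / (p +i* q)) = v * (p / (p ^+ 2 + q ^+ 2)).
Proof. by rewrite /= !mul0r subr0. Qed.

Lemma Im_div_complex (v p q : R) :
  complex.Im (v%:C / (p +i* q)) = v * (- q / (p ^+ 2 + q ^+ 2)).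
Proof. by rewrite /= !mul0r addr0 mulNr. Qed.

Lemma heaviside_sym (s : R) : heaviside s + heaviside (- s) = 1.
Proof.
rewrite /heaviside oppr_gt0 oppr_eq0.
by case: ltgtP => _; lra.
Qed.

Lemma RIntegral_oriented (f F : R -> R) (y : R) :
  (forall x, {for x, continuous f}) -> (forall x, is_derive x 1 F (f x)) ->
  (if 0 <= y then \int[mu]_(x in `[0, y]) f x else - \int[mu]_(x in `[y, 0]) f x) =
  F y - F 0.
Proof.
move=> cf dF; case: leP => [y0|/ltW y0].
  by have [_ ->] := Rintegral_FTC2 y0 (fun x _ => cf x) (fun x _ => dF x).
by have [_ ->] := Rintegral_FTC2 y0 (fun x _ => cf x) (fun x _ => dF x); rewrite opprB.
Qed.

(** The Heaviside factors add up to 1, and for d = x1 - xi1 nonzero the integrand 1 / (t - xi2 + i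
    d) is continuous on the whole line. Its parts have the primitives ln ((t - xi2)^2 + d^2) / 2 and
    - atan ((t - xi2) / d); the subtracted terms come from the lower limit 0. *)
Lemma fundUE (x1 x2 xi1 xi2 : R) : x1 != xi1 ->
  complex.Re (fundU (x1, x2) (xi1, xi2)) = (2 * pi)^-1 *
    (2^-1 * ln ((x2 - xi2) ^+ 2 + (x1 - xi1) ^+ 2) -
     2^-1 * ln ((0 - xi2) ^+ 2 + (x1 - xi1) ^+ 2)) /\
  complex.Im (fundU (x1, x2) (xi1, xi2)) = (2 * pi)^-1 *
    (- atan ((x2 - xi2) / (x1 - xi1)) - - atan ((0 - xi2) / (x1 - xi1))).
Proof.
rewrite -subr_eq0; set d := x1 - xi1 => d0.
have q0 (t : R) : 0 < (t - xi2) ^+ 2 + d ^+ 2.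
  by rewrite ltr_wpDl ?sqr_ge0// lt_neqAle sqr_ge0 eq_sym expf_eq0 d0.
have did (t : R) : is_derive t 1 (fun t : R => t - xi2) 1.
  by apply: is_derive_eq; rewrite subr0.
have dsq (t : R) : is_derive t 1 (fun t : R => (t - xi2) ^+ 2 + d ^+ 2) (2 * (t - xi2)).
  apply: is_derive_eq; rewrite /GRing.scale/=.
  ring.
have csq (t : R) : {for t, continuous (fun t : R => (t - xi2) ^+ 2 + d ^+ 2)}.
  by apply/differentiable_continuous/derivable1_diffP; exact: ex_derive.
have cid (t : R) : {for t, continuous (fun t : R => t - xi2)}.
  by apply/differentiable_continuous/derivable1_diffP; exact: ex_derive.
have cinv (t : R) : {for t, continuous (fun t : R => ((t - xi2) ^+ 2 + d ^+ 2)^-1)}.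
  by apply: continuousV; [rewrite gt_eqF|exact: csq].
rewrite /fundU /= -/d.
set f := (fun t : R => _ / _).
have fR t : complex.Re (f t) = (t - xi2) * ((t - xi2) ^+ 2 + d ^+ 2)^-1.
  by rewrite /f -(opprB t xi2) heaviside_sym Re_div_complex mul1r.
have fI t : complex.Im (f t) = - d * ((t - xi2) ^+ 2 + d ^+ 2)^-1.
  by rewrite /f -(opprB t xi2) heaviside_sym Im_div_complex mul1r.
have -> : cint0 f x2 =
    (if 0 <= x2 then \int[mu]_(x in `[0, x2]) complex.Re (f x)
     else - \int[mu]_(x in `[x2, 0]) complex.Re (f x)) +i*
    (if 0 <= x2 then \int[mu]_(x in `[0, x2]) complex.Im (f x)
     else - \int[mu]_(x in `[x2, 0]) complex.Im (f x)).
  by rewrite /cint0; case: ifP.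
have cR t : {for t, continuous (fun t => complex.Re (f t))}.
  rewrite (_ : (fun t => complex.Re (f t)) =
    (fun t => (t - xi2) * ((t - xi2) ^+ 2 + d ^+ 2)^-1)); last exact/funext.
  exact: continuousM.
have cI t : {for t, continuous (fun t => complex.Im (f t))}.
  rewrite (_ : (fun t => complex.Im (f t)) =
    (fun t => - d * ((t - xi2) ^+ 2 + d ^+ 2)^-1)); last exact/funext.
  by apply: continuousM; [exact: cst_continuous|exact: cinv].
have dR t : is_derive t 1 (fun t => 2^-1 * ln ((t - xi2) ^+ 2 + d ^+ 2)) (complex.Re (f t)).
  rewrite fR; have := @is_derive1_comp R (@ln R) _ t _ _ (is_derive1_ln (q0 t)) (dsq t).
  move=> hd; have -> : (fun t => 2^-1 * ln ((t - xi2) ^+ 2 + d ^+ 2)) =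
    2^-1 *: (@ln R \o (fun t : R => (t - xi2) ^+ 2 + d ^+ 2)) by [].
  by apply: is_derive_eq; rewrite /GRing.scale/=; field; rewrite gt_eqF.
have dI t : is_derive t 1 (fun t => - atan ((t - xi2) / d)) (complex.Im (f t)).
  rewrite fI; have dd : is_derive t 1 (fun t : R => (t - xi2) / d) d^-1.
    have -> : (fun t : R => (t - xi2) / d) = d^-1 *: (fun t => t - xi2).
      by apply/funext => z; rewrite mulrC.
    by apply: is_derive_eq; rewrite /GRing.scale/= mulr1.
  have hd := @is_derive1_comp R (@atan R) _ t _ _ (is_derive1_atan _) dd.
  have -> : (fun t => - atan ((t - xi2) / d)) =
    - (@atan R \o (fun t : R => (t - xi2) / d)) by [].
  by apply: is_derive_eq; field; rewrite gt_eqF ?q0// d0.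
rewrite (RIntegral_oriented x2 cR dR) (RIntegral_oriented x2 cI dI).
by split; rewrite /= !mul0r ?subr0 ?addr0.
Qed.

Lemma within_continuous_bounded a b f : a <= b -> {within `[a, b], continuous f} ->
  exists2 B : R, 0 <= B & forall x, a <= x <= b -> `|f x| <= B.
Proof.
move=> ab cf.
have [x1 _ h1] := EVT_max ab cf; have [x2 _ h2] := EVT_min ab cf.
exists (`|f x1| + `|f x2|) => [|x xab]; first exact: addr_ge0.
have := h1 x; have := h2 x; rewrite in_itv/= xab => /(_ isT) l2 /(_ isT) l1.
rewrite ler_norml; apply/andP; split.
  by have := ler_normr (f x2) (f x2); have := normr_ge0 (f x1);
     have := ler_norm (- f x2); rewrite normrN; lra.
by have := ler_norm (f x1); have := normr_ge0 (f x2); lra.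
Qed.

(** Each part of U_jk combines two kernels of the same type, one with h = gj for the upper limit and
    one with h = 0 for the lower limit of the integral. [KR] and [KI] agree with the parts of U_jk
    off the diagonal only. *)
Lemma Ubd_singular_kernel a b gj gk : a < b ->
  {within `[a, b], continuous gj} -> {within `[a, b], continuous gk} ->
  (forall c d, a < c -> d < b -> exists2 L : R, 0 <= L &
     forall t t', c <= t <= d -> c <= t' <= d -> `|gk t - gk t'| <= L * `|t - t'|) ->
  exists KR KI, [/\ singular_kernel a b KR, singular_kernel a b KI &
    forall s t, a <= s <= b -> a <= t <= b -> s != t ->
      complex.Re (Ubd gj gk s t) = KR s t /\ complex.Im (Ubd gj gk s t) = KI s t].
Proof.
move=> ab cj ck kL.
(* Cut off outside [a, b], where nothing is known about gj and gk, to get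
   kernels measurable on the whole plane. *)
pose h := gj \_ `[a, b]; pose g := gk \_ `[a, b].
have mitv : measurable (`[a, b]%classic : set R) by [].
have mh : measurable_fun setT h.
  by apply/(measurable_restrictT _ mitv); exact: subspace_continuous_measurable_fun.
have mg : measurable_fun setT g.
  by apply/(measurable_restrictT _ mitv); exact: subspace_continuous_measurable_fun.
have hE s : a <= s <= b -> h s = gj s.
  by move=> sab; rewrite /h patchE mem_set//= in_itv.
have gE s : a <= s <= b -> g s = gk s.
  by move=> sab; rewrite /g patchE mem_set//= in_itv.
have [Bj Bj0 HBj] := within_continuous_bounded (ltW ab) cj.
have [Bk Bk0 HBk] := within_continuous_bounded (ltW ab) ck.
pose B := Bj + Bk.
have hB s : a <= s <= b -> `|h s| <= B.
  by move=> sab; rewrite hE// ler_wpDr// HBj.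
have gB s : a <= s <= b -> `|g s| <= B.
  by move=> sab; rewrite gE// ler_wpDl// HBk.
have zB s : a <= s <= b -> `|(fun=> 0) s : R| <= B by rewrite normr0 addr_ge0.
have gL c d : a < c -> d < b -> exists2 L : R, 0 <= L &
    forall t t', c <= t <= d -> c <= t' <= d -> `|g t - g t'| <= L * `|t - t'|.
  move=> ac db; have [L L0 HL] := kL c d ac db; exists L => // t t' tcd t'cd.
  have tab x : c <= x <= d -> a <= x <= b by move=> /andP[? ?]; apply/andP; split; lra.
  by rewrite !gE ?tab// HL.
have mz : measurable_fun setT (fun _ : R => 0 : R) by exact: measurable_cst.
pose X1 := singular_kernel_ln ab mh mg hB gB gL.
pose X2 := singular_kernel_ln ab mz mg zB gB gL.
pose Y1 := singular_kernel_atan ab mh mg hB gB gL.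
pose Y2 := singular_kernel_atan ab mz mg zB gB gL.
have SR := singular_kernelZ (2 * pi)^-1 (singular_kernelD
  (singular_kernelZ 2^-1 X1) (singular_kernelZ (- 2^-1) X2)).
have SI := singular_kernelZ (2 * pi)^-1 (singular_kernelD
  (singular_kernelZ (- 1) Y1) (singular_kernelZ 1 Y2)).
do 2 eexists; split; [exact: SR|exact: SI|].
move=> s t sab tab st; have [-> ->] := fundUE (gj s) (gk t) st.
rewrite hE// gE//; split; first by rewrite mulNr.
by rewrite mulN1r mul1r opprK.
Qed.

End kernels.

(** * The boundary lines of a Lyapunov domain *)

Section domain_slices.
Context {R : realType}.

Lemma open_sup_boundary (S : set R) (y0 : R) : open S -> S y0 -> has_ubound S ->
  exists M, [/\ y0 < M, ~ S M & forall e : R, 0 < e -> exists2 y, S y & `|M - y| < e].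
Proof.
move=> oS Sy0 ubS; have hS : has_sup S by split; [exists y0|].
exists (sup S).
have nS : ~ S (sup S).
  move=> SM; have /nbhs_ballP[e /= e0 He] : nbhs (sup S) S by exact: open_nbhs_nbhs.
  have : S (sup S + e / 2).
    apply: He; rewrite /ball/= opprD addNKr normrN gtr0_norm; lra.
  by move=> /(ub_le_sup ubS); lra.
split=> //.
  rewrite lt_neqAle ub_le_sup// andbT; apply/eqP => E; apply: nS; by rewrite -E.
move=> e e0; have [y Sy ye] := sup_adherent e0 hS; exists y => //.
have := ub_le_sup ubS Sy; rewrite ltr_norml => yM; apply/andP; split; lra.
Qed.

Lemma open_inf_boundary (S : set R) (y0 : R) : open S -> S y0 -> has_lbound S ->
  exists M, [/\ M < y0, ~ S M & forall e : R, 0 < e -> exists2 y, S y & `|M - y| < e].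
Proof.
move=> oS Sy0 [m lbS].
have [|||M [yM nS adh]] := @open_sup_boundary (-%R @^-1` S) (- y0).
- by apply: open_comp => // x _; exact: opp_continuous.
- by rewrite /= opprK.
- by exists (- m) => x /= /lbS; rewrite lerNr.
exists (- M); split; [by rewrite ltrNl|by []|].
move=> e /adh[y Sy ye]; exists (- y) => //.
by rewrite opprK -normrN opprD opprK.
Qed.

(** The projection of the connected set [D] is an interval. The points of the first line over a and
    b are adherent to [D], so [D] has points on both sides of the vertical through x. *)
Lemma slice_nonempty (D : set (R * R)) (a b : R) (g1 g2 : R -> R) (x : R) :
  bounded_domain D -> boundary_lines D a b g1 g2 -> a < x < b ->
  exists y, D (x, y).
Proof.
move=> [_ _ cD _] [ab bd _ _ _] /andP[ax xb].
have cfst : connected (fst @` D).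
  apply: connected_continuous_connected cD _.
  by apply: continuous_subspaceT => p; exact: cvg_fst.
have itv : is_interval (fst @` D) by exact/connected_intervalP.
have clD t : a <= t <= b -> closure D (t, g1 t).
  move=> tab; have : (closure D `\` D) (t, g1 t) by rewrite bd; left.
  by case.
have [p [Dp /= pa]] : exists p, D p /\ p.1 < x.
  have [||p [Dp /= px]] := clD a _ [set p | p.1 < x]; first by rewrite lexx ltW.
    exists ([set t | t < x], setT); last by move=> p [].
    by split => /=; [exact: lt_nbhsl|exact: filterT].
  by exists p.
have [q [Dq /= qb]] : exists p, D p /\ x < p.1.
  have [||q [Dq /= qx]] := clD b _ [set p | x < p.1]; first by rewrite lexx ltW.
    exists ([set t | x < t], setT); last by move=> q [].
    by split => /=; [exact: lt_nbhsr|exact: filterT].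
  by exists q.
have [[x' y] Dxy /= E] : (fst @` D) x.
  apply: (itv p.1 q.1); [by exists p|by exists q|by rewrite !ltW].
by exists y; rewrite -E.
Qed.

(** The vertical slice of [D] is nonempty, open and bounded, so points of the boundary lie strictly
    above and strictly below any of its points; a common value of the two lines would leave only one
    boundary point over x. *)
Lemma boundary_lines_neq (D : set (R * R)) (a b : R) (g1 g2 : R -> R) (x : R) :
  bounded_domain D -> boundary_lines D a b g1 g2 -> a < x < b -> g1 x != g2 x.
Proof.
move=> bD bl xab; have [y0 Dy0] := slice_nonempty bD bl xab.
have [_ oD _ [N [_ HN]]] := bD; have [_ bd _ _ _] := bl.
pose S := [set y | D (x, y)].
have oS : open S.
  apply: (@open_comp _ _ (fun y => (x, y)) D) => // y _.
  exact: (cvg_pair (cvg_cst x) (@cvg_id _ (nbhs y))).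
have SN y : S y -> `|y| <= N + 1.
  move=> Sy; have := HN (N + 1) (ltac:(lra)) _ Sy.
  by rewrite /= prod_normE /= ge_max => /andP[].
have bdy M : ~ S M -> (forall e, 0 < e -> exists2 y, S y & `|M - y| < e) ->
    M = g1 x \/ M = g2 x.
  move=> nSM adh; have : (closure D `\` D) (x, M).
    split => // B /nbhs_ballP[e /= e0 He]; have [y Sy ye] := adh e e0.
    exists (x, y); split => //; apply: He; split => //=; exact: ballxx.
  by rewrite bd => -[[_ /= ->]|[_ /= ->]]; [left|right].
have [|M [yM nM aM]] := open_sup_boundary oS Dy0.
  by exists (N + 1) => y /SN; exact: le_trans (ler_norm _).
have [|m [ym nm am]] := open_inf_boundary oS Dy0.
  by exists (- (N + 1)) => y /SN; rewrite ler_norml => /andP[].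
apply/eqP => E; have := bdy M nM aM; have := bdy m nm am.
by rewrite E => -[|] em [|] eM; lra.
Qed.

End domain_slices.

Section maximal_interval.
Context {R : realType}.
Implicit Types (S : set R) (s u l : R).

(** The witness is the infimum of the points from s0 on that lie outside S; S being open, it lies
    outside S itself. *)
Lemma right_exit S s0 u1 : (forall s, S s -> \forall s' \near s, S s') ->
  S s0 -> s0 < u1 -> ~ S u1 ->
  exists u, [/\ s0 < u, ~ S u & forall s, s0 <= s -> s < u -> S s].
Proof.
move=> oS Ss0 su nSu; pose A := [set s | s0 <= s /\ ~ S s].
have lA : lbound A s0 by move=> s [].
have hA : has_inf A by split; [exists u1; split => //; exact: ltW|exists s0].
have nS : ~ S (inf A).
  move=> /oS/nbhs_ballP[e /= e0 He].
  have [s [s0s nSs] sA] := inf_adherent e0 hA.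
  have := ge_inf hA.2 (conj s0s nSs : A s); move=> {}h; apply: nSs; apply: He; move: h.
  by rewrite /ball/= ltr_norml => ?; apply/andP; split; lra.
exists (inf A); split=> //.
  rewrite lt_neqAle lb_le_inf//; last exact: hA.1.
  by rewrite andbT; apply/eqP => E; apply: nS; rewrite -E.
move=> s s0s sA; apply: contrapT => nSs.
by have := ge_inf hA.2 (conj s0s nSs : A s); lra.
Qed.

Lemma maximal_interval S s0 l1 u1 : (forall s, S s -> \forall s' \near s, S s') ->
  S s0 -> l1 < s0 < u1 -> ~ S l1 -> ~ S u1 ->
  exists l u, [/\ l < s0 < u, ~ S l, ~ S u & forall s, l < s < u -> S s].
Proof.
move=> oS Ss0 /andP[ls su] nSl nSu.
have [u [s0u nu Su]] := right_exit oS Ss0 su nSu.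
have [||||l [s0l nl Sl]] := @right_exit (-%R @^-1` S) (- s0) (- l1).
- move=> s /= /oS/nbhs_ballP[e /= e0 He]; apply/nbhs_ballP; exists e => //= t st.
  by apply: He; move: st; rewrite /ball/= -opprD normrN.
- by rewrite /= opprK.
- by rewrite ltrN2.
- by rewrite /= opprK.
exists (- l), u; split => //; first by apply/andP; split=> //; rewrite ltrNl.
move=> s /andP[lts stu]; have [/Su|ss0] := leP s0 s; first exact.
by have := Sl (- s); rewrite /= opprK; apply; [rewrite lerN2 ltW|rewrite ltrNl].
Qed.

End maximal_interval.

(** * The arc of the Lyapunov curve over the line g, the other line being h *)

Section curve_over_interval.
Context {R : realType}.
Variables (a b L lam C : R) (x y g h : R -> R).
Hypotheses (ab : a < b) (L0 : 0 < L)
  (per : forall s, x (s + L) = x s /\ y (s + L) = y s)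
  (dxy : forall s, [/\ derivable x s 1, derivable y s 1 &
                       derive1 x s ^+ 2 + derive1 y s ^+ 2 = 1])
  (lam01 : 0 < lam <= 1)
  (hoelder : forall s t, `|derive1 x s - derive1 x t| <= C * `|s - t| `^ lam /\
                         `|derive1 y s - derive1 y t| <= C * `|s - t| `^ lam)
  (onG : forall s, graph_over a b g (x s, y s) \/ graph_over a b h (x s, y s))
  (inG : forall t, a <= t <= b -> exists s, x s = t /\ y s = g t)
  (gh : forall t, a < t < b -> g t != h t)
  (dg : forall t, a < t < b -> derivable g t 1)
  (dh : forall t, a < t < b -> derivable h t 1).

Let derivable_continuous (f : R -> R) t : derivable f t 1 -> {for t, continuous f}.
Proof. by move=> df; apply/differentiable_continuous/derivable1_diffP. Qed.

Let cx (s : R) : {for s, continuous x}.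
Proof. by apply: derivable_continuous; have [] := dxy s. Qed.

Let cy (s : R) : {for s, continuous y}.
Proof. by apply: derivable_continuous; have [] := dxy s. Qed.

Let hoelder_continuous (f : R -> R) : (forall s t, `|f s - f t| <= C * `|s - t| `^ lam) ->
  forall s : R, {for s, continuous f}.
Proof.
move=> hf s; have /andP[l0 l1] := lam01.
apply/cvgrPdist_le => e e0.
have C0 : 0 < `|C| + 1 by rewrite ltr_pwDr.
pose d := (e / (`|C| + 1)) `^ lam^-1.
have d0 : 0 < d by rewrite powR_gt0// divr_gt0.
near=> t.
have td : `|s - t| <= d by near: t; apply: cvgr_dist_le => //; exact: cvg_id.
apply: (le_trans (hf s t)); apply: (@le_trans _ _ ((`|C| + 1) * `|s - t| `^ lam)).
  by rewrite ler_wpM2r ?powR_ge0// (le_trans (ler_norm C))// lerDl.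
rewrite mulrC -ler_pdivlMr//.
have -> : e / (`|C| + 1) = d `^ lam.
  by rewrite /d -powRrM mulVf ?gt_eqF// powRr1// ltW// divr_gt0.
by apply: ge0_ler_powR; rewrite ?nnegrE// ltW.
Unshelve. all: by end_near. Qed.

Let cdx (s : R) : {for s, continuous (derive1 x)}.
Proof. by apply: hoelder_continuous => t t'; have [] := hoelder t t'. Qed.

Let cdy (s : R) : {for s, continuous (derive1 y)}.
Proof. by apply: hoelder_continuous => t t'; have [] := hoelder t t'. Qed.

(* S is open, the lines being disjoint, and relatively closed in a < x s < b:
   a maximal interval of S is therefore mapped by x onto all of ]a, b[. *)
Let S s := a < x s < b /\ y s = g (x s).

Let x_ab s : a <= x s <= b. Proof. by have [[]|[]] := onG s. Qed.

Let near_neq (f : R -> R) s : {for x s, continuous f} -> y s != f (x s) ->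
  \forall s' \near s, y s' != f (x s').
Proof.
move=> cf nf.
have cyf : {for s, continuous (fun s => y s - f (x s))}.
  apply: continuousB; first exact: cy.
  by apply: (@continuous_comp _ _ _ x f).
have n0 : y s - f (x s) != 0 by rewrite subr_eq0.
near=> s'; rewrite -subr_eq0; near: s'; exact: (cvgr_neq0 _ cyf n0).
Unshelve. all: by end_near. Qed.

Let near_ab s : a < x s < b -> \forall s' \near s, a < x s' < b.
Proof.
move=> /andP[ax xb].
have h1 : \forall s' \near s, a < x s' by exact: (cvgr_gt _ (@cx s) _ ax).
have h2 : \forall s' \near s, x s' < b by exact: (cvgr_lt _ (@cx s) _ xb).
by near=> s'; apply/andP; split; near: s'.
Unshelve. all: by end_near. Qed.

Let S_near s : S s -> \forall s' \near s, S s'.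
Proof.
move=> [xab yg].
have neq : y s != h (x s) by rewrite yg gh.
have h1 := near_neq (derivable_continuous (dh xab)) neq.
have h2 := near_ab xab.
near=> s'; split; first by near: s'.
have [[]//|[_ /= E]] := onG s'.
have : y s' != h (x s') by near: s'.
by rewrite E eqxx.
Unshelve. all: by end_near. Qed.

Let notS_near s : a < x s < b -> ~ S s -> \forall s' \near s, ~ S s'.
Proof.
move=> xab nS.
have neq : y s != g (x s) by apply/eqP => E; apply: nS.
have h1 := near_neq (derivable_continuous (dg xab)) neq.
near=> s' => -[_ E].
have : y s' != g (x s') by near: s'.
by rewrite E eqxx.
Unshelve. all: by end_near. Qed.

(** Since S is open, y = g o x near s and the chain rule applies; if x' vanished, y' would vanish
    too, contradicting unit speed. *)
Let slope s : S s -> derive1 x s != 0 /\ derive1 g (x s) = derive1 y s / derive1 x s.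
Proof.
move=> Ss; have [xab yg] := Ss; have [dxs dys e1] := dxy s.
have near_eq : {near s, g \o x =1 y}.
  by near=> s'; have [] : S s' by near: s'; exact: S_near.
have E : derive1 y s = derive1 g (x s) * derive1 x s.
  rewrite -(derive1_comp dxs (dg xab)).
  by rewrite !derive1E; apply/esym/near_eq_derive => //.
have x0 : derive1 x s != 0.
  apply/eqP => x0; move: e1; rewrite E x0 mulr0 expr0n/= addr0 => /eqP.
  by rewrite eq_sym oner_eq0.
by split => //; rewrite E mulfK.
Unshelve. all: by end_near. Qed.

(* A vertical tangent is excluded on S, since g is differentiable there. *)
Let Rolle_x s t : s < t -> x s = x t -> (forall r, s < r < t -> S r) -> False.
Proof.
move=> st xst Sst.
have [r _||r rst] := @Rolle R x s t st _ _ xst.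
- by case: (dxy r).
- by apply: continuous_subspaceT => r; exact: cx.
move=> dr; have [/eqP + _] := slope (Sst r rst); apply.
by rewrite derive1E derive_val.
Qed.

(** The arc is a maximal interval of S around a parameter over the midpoint of [a, b]. Its end
    parameters lie outside S but are limits of S, so x takes there the value a or b, and not twice
    the same one by injectivity. *)
Let arc : exists l u, [/\ l < u, (forall s, l < s < u -> S s),
  ((x l = a /\ x u = b) \/ (x l = b /\ x u = a)) &
  {in `[l, u] &, injective x}].
Proof.
have [mid1 mid2] : a < (a + b) / 2 /\ (a + b) / 2 < b by rewrite !midf_lt.
have [|s0 [xs0 ys0]] := @inG ((a + b) / 2); first by rewrite !ltW.
have Ss0 : S s0 by rewrite /S xs0 mid1.
(* Otherwise S would contain a whole period, over which x returns to its initial value,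
   contradicting [Rolle_x]. *)
have [u1 [su1 nSu1]] : exists u1, s0 < u1 /\ ~ S u1.
  apply: contrapT => nex; apply: (@Rolle_x s0 (s0 + L)); first by rewrite ltrDl.
    by have [-> _] := per s0.
  by move=> r /andP[sr _]; apply: contrapT => nS; apply: nex; exists r.
have [l1 [sl1 nSl1]] : exists l1, l1 < s0 /\ ~ S l1.
  apply: contrapT => nex; apply: (@Rolle_x (s0 - L) s0); first by rewrite ltrBlDr ltrDl.
    by have [<- _] := per (s0 - L); rewrite subrK.
  by move=> r /andP[_ rs]; apply: contrapT => nS; apply: nex; exists r.
have [|l [u [/andP[ls su] nSl nSu Slu]]] := maximal_interval S_near Ss0 _ nSl1 nSu1.
  exact/andP.
have lu : l < u by exact: lt_trans su.
have inj : {in `[l, u] &, injective x}.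
  have inj' s t : l <= s -> t <= u -> s < t -> x s = x t -> False.
    move=> lls tu st xst; apply: (Rolle_x st xst) => r /andP[sr rt].
    by apply: Slu; rewrite (le_lt_trans lls)//= (lt_le_trans rt).
  move=> s t; rewrite !in_itv/= => /andP[ls' su'] /andP[lt' tu'] xst.
  by have [st|ts|//] := ltgtP s t; [have := inj' _ _ ls' tu' st xst|have := inj' _ _ lt' su' ts (esym xst)].
have nab s : ~ S s -> (forall e, 0 < e -> exists2 s', S s' & `|s - s'| < e) ->
    x s = a \/ x s = b.
  move=> nS adh; have /andP[ax xb] := x_ab s.
  have [xa|nxa] := eqVneq (x s) a; first by left.
  have [xb'|nxb] := eqVneq (x s) b; first by right.
  have xab : a < x s < b by rewrite !lt_neqAle ax xb nxb eq_sym nxa.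
  have /nbhs_ballP[e /= e0 He] := notS_near xab nS.
  by have [s' Ss' ss'] := adh e e0; case: (He s').
have xl : x l = a \/ x l = b.
  apply: nab => // e e0; pose d := Num.min e (u - l) / 2.
  have m0 : 0 < Num.min e (u - l) by rewrite lt_min e0 subr_gt0.
  have d0 : 0 < d by rewrite divr_gt0.
  have [de dul] : d < e /\ d < u - l.
    have := ge_min e e (u - l); have := ge_min (u - l) e (u - l); rewrite !lexx orbT/=.
    by move=> h1 h2; rewrite /d; split; lra.
  exists (l + d); first by apply: Slu; apply/andP; split; lra.
  by rewrite opprD addNKr normrN gtr0_norm.
have xu : x u = a \/ x u = b.
  apply: nab => // e e0; pose d := Num.min e (u - l) / 2.
  have m0 : 0 < Num.min e (u - l) by rewrite lt_min e0 subr_gt0.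
  have d0 : 0 < d by rewrite divr_gt0.
  have [de dul] : d < e /\ d < u - l.
    have := ge_min e e (u - l); have := ge_min (u - l) e (u - l); rewrite !lexx orbT/=.
    by move=> h1 h2; rewrite /d; split; lra.
  exists (u - d); first by apply: Slu; apply/andP; split; lra.
  by rewrite subKr gtr0_norm.
have xlu : x l <> x u.
  move=> E; have : l = u by apply: inj; rewrite ?in_itv/= ?lexx ?ltW.
  by move=> E'; move: lu; rewrite E' ltxx.
exists l, u; split=> //.
by case: xl xu => [xl|xl] [xu|xu]; [case: xlu|left|right|case: xlu]; rewrite ?xl ?xu.
Qed.

(** [sg] inverts x on the arc, and [e] is the constant sign of x' there, so that e sg is a bounded
    primitive of 1/|x' o sg|. *)
Let inverse_arc : exists l u (e : R) (sg : R -> R),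
  [/\ `|e| = 1,
      (forall t, a < t < b -> l < sg t < u /\ x (sg t) = t),
      (forall t, a < t < b -> S (sg t)),
      (forall t, a < t < b -> is_derive t 1 sg (derive1 x (sg t))^-1) &
      forall t, a < t < b -> e * (derive1 x (sg t))^-1 = `|derive1 x (sg t)|^-1].
Proof.
have [l [u [lu Slu xlu inj]]] := arc.
have /choice[sg Hsg] : forall t, exists s, a < t < b -> l < s < u /\ x s = t.
  move=> t; have [tab|tab] := boolP (a < t < b); last by exists 0.
  have [||s] := @IVT R x l u t (ltW lu).
  - by apply: continuous_subspaceT => r; exact: cx.
  - have /andP[/ltW at' /ltW tb] := tab; rewrite ge_min le_max.
    by case: xlu => [[-> ->]|[-> ->]]; rewrite ?at' ?tb ?orbT.
  rewrite in_itv/= => /andP[ls su] xst; exists s => _; split => //.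
  have /andP[at' tb] := tab; rewrite !lt_neqAle ls su !andbT.
  apply/andP; split; apply/eqP => E.
    by case: xlu => -[xl xu]; move: at' tb; rewrite -xst -E xl ltxx.
  by case: xlu => -[xl xu]; move: at' tb; rewrite -xst E xu ltxx.
have Ssg t : a < t < b -> S (sg t) by move=> /Hsg[/Slu].
have sgK s : l < s < u -> sg (x s) = s.
  move=> slu; have [xab _] := Slu s slu; have [/andP[h1 h2] h3] := Hsg _ xab.
  have /andP[h4 h5] := slu.
  by apply: inj => //; rewrite in_itv/= !ltW.
have dsg t : a < t < b -> is_derive t 1 sg (derive1 x (sg t))^-1.
  move=> tab; have [slu E] := Hsg t tab; rewrite -{1}E.
  have [ls su] := andP slu.
  apply: (@is_derive_inverse R x sg (derive1 x (sg t)) (sg t)).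
  - near=> s; apply: sgK; apply/andP; split; near: s.
      exact: lt_nbhsr.
    exact: lt_nbhsl.
  - by near=> s; exact: cx.
  - have [dxs _ _] := dxy (sg t); rewrite derive1E; exact/derivableP.
  - by have [] := slope (Ssg t tab).
(* x' is continuous and has no zero on the arc, so it cannot change sign. *)
have pos s1 s2 : l < s1 < u -> l < s2 < u -> s1 <= s2 -> 0 < derive1 x s1 * derive1 x s2.
  move=> /andP[h1 h2] /andP[h3 h4] s12; rewrite ltNge; apply/negP => neg.
  have [||c] := @IVT R (derive1 x) s1 s2 0 s12.
  - by apply: continuous_subspaceT => r; exact: cdx.
  - rewrite ge_min le_max; apply/andP; split; apply: contraLR neg;
      rewrite negb_or -!ltNge => /andP[p1 p2]; first exact: mulr_gt0.
    by rewrite nmulr_rgt0.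
  rewrite in_itv/= => /andP[c1 c2] c0.
  have [/eqP + _] := slope (Slu c (ltac:(by rewrite (lt_le_trans h1)//= (le_lt_trans c2)))).
  by rewrite c0.
pose s0 := (l + u) / 2.
have [m1 m2] : l < s0 /\ s0 < u by rewrite !midf_lt.
have s0lu : l < s0 < u by rewrite m1.
have [x0 _] := slope (Slu s0 s0lu).
have p t : a < t < b -> 0 < derive1 x s0 * derive1 x (sg t).
  move=> /Hsg[slu _]; have [le0|/ltW le0] := leP s0 (sg t); first exact: pos.
  by rewrite mulrC; exact: pos.
have [xs0|xs0|xs0] := ltgtP (derive1 x s0) 0; last by rewrite xs0 eqxx in x0.
- exists l, u, (- 1), sg; split => //; first by rewrite normrN1.
  move=> t /p; rewrite nmulr_rgt0// => xt.
  by rewrite ltr0_norm// invrN mulN1r.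
- exists l, u, 1, sg; split => //; first by rewrite normr1.
  move=> t /p; rewrite pmulr_rgt0// => xt.
  by rewrite gtr0_norm// mul1r.
Unshelve. all: by end_near. Qed.

Lemma graph_derivative_integrable :
  lebesgue_measure.-integrable `]a, b[ (EFin \o derive1 g).
Proof.
have [l [u [e [sg [e1 Hsg Ssg dsg esg]]]]] := inverse_arc.
have csg t : a < t < b -> {for t, continuous sg}.
  move=> tab; apply: derivable_continuous.
  by have := dsg t tab => ?; exact: ex_derive.
have cinv t : a < t < b -> {for t, continuous (fun t => (derive1 x (sg t))^-1)}.
  move=> tab; apply: continuousV; first by have [] := slope (Ssg t tab).
  by apply: (@continuous_comp _ _ _ sg (derive1 x)); [exact: csg|exact: cdx].
have gE t : a < t < b -> derive1 g t = derive1 y (sg t) * (derive1 x (sg t))^-1.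
  by move=> tab; have [_ <-] := slope (Ssg t tab); have [_ ->] := Hsg t tab.
have [iF _] : lebesgue_measure.-integrable `]a, b[
    (EFin \o (fun t => `|derive1 x (sg t)|^-1)) /\
    \int[lebesgue_measure]_(t in `]a, b[) `|derive1 x (sg t)|^-1 <= 2 * (`|l| + `|u|).
  apply: (@integrable_bounded_primitive _ _ _ _ _ (e *: sg)) => //.
  - move=> t tab; rewrite (_ : (fun t => _) = (fun t => `|(derive1 x (sg t))^-1|)).
      apply: (@continuous_comp _ _ _ (fun t => (derive1 x (sg t))^-1) (@Num.norm _ R)).
        exact: cinv.
      exact: norm_continuous.
    by apply/funext => r; rewrite normfV.
  - move=> t tab; have ds := dsg t tab; rewrite -esg//.
    exact: is_deriveZ.
  - move=> t tab; rewrite /GRing.scale/= normrM e1 mul1r.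
    have [/andP[h1 h2] _] := Hsg t tab.
    have := ler_norm (- l); have := ler_norm u; rewrite normrN ler_norml => h3 h4.
    have := normr_ge0 l; have := normr_ge0 u => h5 h6.
    by apply/andP; split; lra.
apply: integrable_le iF => //.
  apply: (@eq_measurable_fun _ _ _ _ _ (fun t => derive1 y (sg t) * (derive1 x (sg t))^-1)).
    by move=> t; rewrite inE/= in_itv/= => /gE.
  apply: continuous_itv_oo => t tab; apply: continuousM; last exact: cinv.
  by apply: (@continuous_comp _ _ _ sg (derive1 y)); [exact: csg|exact: cdy].
move=> t /=; rewrite in_itv/= => tab; rewrite gE// normrM normfV ler_piMl//.
have [_ _ E] := dxy (sg t).
rewrite -(@expr_le1 _ 2)// real_normK ?num_real// -E lerDr sqr_ge0//.
Qed.

Lemma graph_derivative_hoelder c d : a < c -> d < b ->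
  exists2 H : R, 0 <= H & forall s t, c <= s <= d -> c <= t <= d ->
    `|derive1 g s - derive1 g t| <= H * `|s - t| `^ lam.
Proof.
move=> ac db; have [cd|dc] := leP c d; last first.
  by exists 0 => // s t /andP[h1 h2]; have := le_trans h1 h2; rewrite leNgt dc.
have [l [u [e [sg [e1 Hsg Ssg dsg esg]]]]] := inverse_arc.
have tab t : c <= t <= d -> a < t < b.
  by move=> /andP[h1 h2]; rewrite (lt_le_trans ac)//= (le_lt_trans h2).
have csg t : a < t < b -> {for t, continuous sg}.
  move=> tab'; apply: derivable_continuous.
  by have := dsg t tab' => ?; exact: ex_derive.
have cinv t : a < t < b -> {for t, continuous (fun t => (derive1 x (sg t))^-1)}.
  move=> tab'; apply: continuousV; first by have [] := slope (Ssg t tab').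
  by apply: (@continuous_comp _ _ _ sg (derive1 x)); [exact: csg|exact: cdx].
have gE t : a < t < b -> derive1 g t = derive1 y (sg t) * (derive1 x (sg t))^-1.
  by move=> tab'; have [_ <-] := slope (Ssg t tab'); have [_ ->] := Hsg t tab'.
have [B B0 HB] : exists2 B : R, 0 <= B & forall t, c <= t <= d -> `|(derive1 x (sg t))^-1| <= B.
  apply: (within_continuous_bounded cd).
  by apply: continuous_in_subspaceT => t; rewrite inE/= in_itv/= => /tab; exact: cinv.
have lip s t : c <= s <= d -> c <= t <= d -> `|sg s - sg t| <= B * `|s - t|.
  wlog st : s t / s <= t.
    move=> wl; have [st|/ltW ts] := leP s t; first exact: wl.
    by move=> h1 h2; rewrite distrC [`|s - t|]distrC; exact: wl.
  move=> scd tcd; rewrite distrC [`|s - t|]distrC.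
  have sub r : r \in `[s, t] -> c <= r <= d.
    rewrite in_itv/= => /andP[sr rt]; have /andP[cs _] := scd; have /andP[_ td] := tcd.
    by rewrite (le_trans cs)//= (le_trans rt).
  have [||r rst ->] := @MVT_segment R sg (fun r => (derive1 x (sg r))^-1) s t st.
  - move=> r rst; apply: dsg; apply/tab/sub.
    exact: subset_itv_oo_cc rst.
  - by apply: continuous_in_subspaceT => r; rewrite inE => rst; apply/csg/tab/sub.
  by rewrite normrM ler_wpM2r// HB// sub.
have /andP[lam0 _] := lam01.
(* [sg] is B-Lipschitz, so x' o sg and y' o sg are Hoelder with constant |C| B^lam. In the
   difference of the quotients y'/x' the variation of y' is multiplied by at most B and that of x'
   by at most B^2. *)
pose H := (B + B * B) * (`|C| * B `^ lam).
exists H => [|s t scd tcd].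
  by rewrite mulr_ge0 ?addr_ge0 ?mulr_ge0 ?powR_ge0.
have [hx hy] := hoelder (sg s) (sg t).
have step (z : R) : z <= C * `|sg s - sg t| `^ lam -> z <= `|C| * B `^ lam * `|s - t| `^ lam.
  move=> /le_trans; apply; apply: (@le_trans _ _ (`|C| * `|sg s - sg t| `^ lam)).
    by rewrite ler_wpM2r ?powR_ge0// ler_norm.
  rewrite -mulrA ler_wpM2l// -powRM//.
  by apply: ge0_ler_powR; rewrite ?nnegrE ?mulr_ge0 ?lip// ltW.
rewrite !gE ?tab//.
have [x1 _] := slope (Ssg s (tab s scd)); have [x2 _] := slope (Ssg t (tab t tcd)).
have -> : derive1 y (sg s) / derive1 x (sg s) - derive1 y (sg t) / derive1 x (sg t) =
  (derive1 x (sg s))^-1 * (derive1 y (sg s) - derive1 y (sg t)) -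
  derive1 y (sg t) * (derive1 x (sg s))^-1 * (derive1 x (sg t))^-1 *
    (derive1 x (sg s) - derive1 x (sg t)).
  by field; rewrite x1 x2.
have -> : H * `|s - t| `^ lam = B * (`|C| * B `^ lam * `|s - t| `^ lam) +
    B * B * (`|C| * B `^ lam * `|s - t| `^ lam) by rewrite /H; ring.
apply: (le_trans (ler_normB _ _)); apply: lerD.
  by rewrite normrM ler_pM// ?HB// step.
have y1 : `|derive1 y (sg t)| <= 1.
  have [_ _ E] := dxy (sg t).
  by rewrite -(@expr_le1 _ 2)// real_normK ?num_real// -E lerDr sqr_ge0.
rewrite normrM; apply: ler_pM => //; last exact: step.
rewrite 2!normrM; apply: ler_pM => //; last exact: HB.
by apply: (le_trans _ (HB s scd)); rewrite ler_piMl.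
Qed.

End curve_over_interval.


(** * Complex-valued integrals and principal values *)

Section complex_tools.
Context {R : realType}.
Implicit Types (z w : R[i]) (A : set R) (f g : R -> R[i]) (a b c d xi e l k r : R).
Notation mu := (@lebesgue_measure R).
Notation Re := complex.Re.
Notation Im := complex.Im.

Lemma Re_mul z w : Re (z * w) = Re z * Re w - Im z * Im w.
Proof. by case: z; case: w. Qed.

Lemma Im_mul z w : Im (z * w) = Re z * Im w + Im z * Re w.
Proof. by case: z; case: w. Qed.

Lemma Re_add z w : Re (z + w) = Re z + Re w. Proof. by case: z; case: w. Qed.

Lemma Im_add z w : Im (z + w) = Im z + Im w. Proof. by case: z; case: w. Qed.

Lemma Re_mulr_real z (r : R) : Re (z * r%:C) = Re z * r.
Proof. by rewrite Re_mul /= mulr0 subr0. Qed.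

Lemma Im_mulr_real z (r : R) : Im (z * r%:C) = Im z * r.
Proof. by rewrite Im_mul /= mulr0 add0r. Qed.

Lemma real_complexV (r : R) : (r%:C)^-1 = (r^-1)%:C.
Proof. by rewrite (fmorphV (real_complex R)). Qed.

Lemma Re_normal_factor (g : R -> R) x : Re (normal_factor g x) = 1.
Proof. by rewrite /normal_factor /= mul0r mulr0 subrr subr0. Qed.

Lemma Im_normal_factor (g : R -> R) x : Im (normal_factor g x) = - derive1 g x.
Proof. by rewrite /normal_factor /= mul0r mul1r !add0r. Qed.

(** The modulus of a complex number is itself an element of [R[i]]; this submultiplicative norm has
    real values and dominates the modulus and both parts. *)
Definition l1norm z : R := `|Re z| + `|Im z|.

Lemma l1norm_ge0 z : 0 <= l1norm z. Proof. exact: addr_ge0. Qed.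

Lemma le_norm_l1norm z : `|z| <= (l1norm z)%:C.
Proof.
case: z => p q; rewrite /l1norm normc_def/= lecR.
rewrite -[leRHS]ger0_norm ?addr_ge0// -sqrtr_sqr ler_wsqrtr//.
rewrite -(real_normK (num_real p)) -(real_normK (num_real q)) sqrrD.
by rewrite addrAC lerDl mulrn_wge0// mulr_ge0.
Qed.

Lemma Re_le_l1norm z : `|Re z| <= l1norm z. Proof. by rewrite lerDl. Qed.

Lemma Im_le_l1norm z : `|Im z| <= l1norm z. Proof. by rewrite lerDr. Qed.

Lemma l1normM z w : l1norm (z * w) <= l1norm z * l1norm w.
Proof.
rewrite /l1norm Re_mul Im_mul mulrDl !mulrDr -!normrM.
apply: (le_trans (lerD (ler_normB _ _) (ler_normD _ _))); lra.
Qed.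

(** With M the larger of |p| and |q|, (|p| + |q|) / (p^2 + q^2) <= 2 M / M^2. *)
Lemma l1norm_inv (p q m : R) : 0 < m -> m <= `|p| \/ m <= `|q| ->
  l1norm (p +i* q)^-1 <= 2 / m.
Proof.
move=> m0 mpq; rewrite /l1norm /= normrN !normrM.
have [M [pM qM mM Mpq]] : exists M : R, [/\ `|p| <= M, `|q| <= M, m <= M & M ^+ 2 <= p ^+ 2 + q ^+ 2].
  have [pq|/ltW qp] := leP `|p| `|q|.
    exists `|q|; split => //; last by rewrite real_normK ?num_real// lerDr sqr_ge0.
    by case: mpq => // /le_trans; apply.
  exists `|p|; split => //; last by rewrite real_normK ?num_real// lerDl sqr_ge0.
  by case: mpq => // /le_trans; apply.
have M0 := lt_le_trans m0 mM.
have s0 : 0 < p ^+ 2 + q ^+ 2 by apply: lt_le_trans Mpq; rewrite exprn_gt0.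
rewrite -[leLHS]mulrDl normfV (gtr0_norm s0) ler_pdivrMr// mulrAC ler_pdivlMr//.
apply: (@le_trans _ _ (2 * M * M)); last by rewrite -mulrA ler_wpM2l// -expr2.
by rewrite ler_pM ?addr_ge0//; [exact: ltW|lra].
Qed.

Definition cmeasurable A f : Prop :=
  measurable_fun A (fun t => Re (f t)) /\ measurable_fun A (fun t => Im (f t)).

Lemma cmeasurable_cst A z : cmeasurable A (fun=> z).
Proof. by split; exact: measurable_cst. Qed.

Lemma cmeasurableD A f g : cmeasurable A f -> cmeasurable A g ->
  cmeasurable A (fun t => f t + g t).
Proof.
move=> [f1 f2] [g1 g2]; split.
  under eq_fun do rewrite Re_add; exact: measurable_funD.
under eq_fun do rewrite Im_add; exact: measurable_funD.
Qed.

Lemma cmeasurableM A f g : cmeasurable A f -> cmeasurable A g ->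
  cmeasurable A (fun t => f t * g t).
Proof.
move=> [f1 f2] [g1 g2]; split.
  under eq_fun do rewrite Re_mul.
  by apply: measurable_funB; exact: measurable_funM.
under eq_fun do rewrite Im_mul.
by apply: measurable_funD; exact: measurable_funM.
Qed.

Lemma cmeasurable_real A (r : R -> R) : measurable_fun A r -> cmeasurable A (fun t => (r t)%:C).
Proof. by move=> mr; split => //=; exact: measurable_cst. Qed.

Lemma cmeasurable_inv A (p q : R -> R) : measurable_fun A p -> measurable_fun A q ->
  cmeasurable A (fun t => (p t +i* q t)^-1).
Proof.
move=> mp mq.
have ms : measurable_fun A (fun t => (p t ^+ 2 + q t ^+ 2)^-1).
  apply: (measurableT_comp (@measurable_inv R)).
  by apply: measurable_funD; exact: measurable_funX.
split => /=; first exact: measurable_funM.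
by apply: measurable_funN; exact: measurable_funM.
Qed.

Lemma cmeasurable_normal_factor A (g : R -> R) : measurable_fun A (derive1 g) ->
  cmeasurable A (normal_factor g).
Proof.
move=> mg; split.
  under eq_fun do rewrite Re_normal_factor; exact: measurable_cst.
under eq_fun do rewrite Im_normal_factor; exact: measurable_funN.
Qed.

Lemma cintegrable_le A f (h : R -> R) : measurable A -> cmeasurable A f ->
  (forall t, A t -> l1norm (f t) <= h t) ->
  mu.-integrable A (EFin \o h) -> cintegrable A f.
Proof.
move=> mA [f1 f2] fh ih; split.
  apply: (@integrable_le _ _ (fun t => Re (f t)) h) => // t At.
  exact: le_trans (Re_le_l1norm _) (fh t At).
apply: (@integrable_le _ _ (fun t => Im (f t)) h) => // t At.
exact: le_trans (Im_le_l1norm _) (fh t At).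
Qed.

Lemma cintegrable_cmeasurable A f : cintegrable A f -> cmeasurable A f.
Proof.
by move=> [i1 i2]; split; apply/measurable_EFinP; [exact: measurable_int i1|exact: measurable_int i2].
Qed.

Lemma cintegrable_boundedM A f g (B : R) : measurable A -> cmeasurable A f ->
  (forall t, A t -> l1norm (f t) <= B) -> cintegrable A g ->
  cintegrable A (fun t => f t * g t).
Proof.
move=> mA mf fB ig; have [i1 i2] := ig.
apply: (@cintegrable_le _ _ (fun t => B * (`|Re (g t)| + `|Im (g t)|))) => //.
- by apply: cmeasurableM => //; exact: cintegrable_cmeasurable.
- move=> t At; apply: (le_trans (l1normM _ _)); rewrite ler_wpM2r ?fB//.
  exact: l1norm_ge0.
- by apply: integrableZ_real => //; apply: integrableD_real => //; exact: integrable_norm_real.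
Qed.

Lemma ccontinuous_cmeasurable a b f : ccontinuous_on `[a, b] f -> cmeasurable `[a, b] f.
Proof.
by move=> [c1 c2]; split; apply: subspace_continuous_measurable_fun.
Qed.

Lemma ccontinuous_bounded a b f : a <= b -> ccontinuous_on `[a, b] f ->
  exists2 B : R, 0 <= B & forall t, a <= t <= b -> l1norm (f t) <= B.
Proof.
move=> ab [c1 c2].
have [B1 B10 H1] := within_continuous_bounded ab c1.
have [B2 B20 H2] := within_continuous_bounded ab c2.
by exists (B1 + B2) => [|t tab]; [exact: addr_ge0|rewrite lerD ?H1 ?H2].
Qed.

Definition is_rpv a b (f : R -> R) xi (l : R) : Prop :=
  (forall e, 0 < e -> mu.-integrable (excised a b xi e) (EFin \o (fun t => f t / (t - xi)))) /\
  pv_cut a b f xi e @[e --> 0^'+] --> l.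

Lemma cvg_at_right0_eq (v u : R -> R) l : (forall e : R, 0 < e -> u e = v e) ->
  v e @[e --> 0^'+] --> l -> u e @[e --> 0^'+] --> l.
Proof.
move=> uv; apply: cvg_trans; apply: near_eq_cvg; near=> e.
by rewrite uv//; near: e; exact: nbhs_right_gt.
Unshelve. all: by end_near. Qed.

Lemma is_rpv_off_ends a b (f g : R -> R) xi l :
  (forall t, a < t < b -> f t = g t) -> is_rpv a b g xi l -> is_rpv a b f xi l.
Proof.
move=> fg [ig cg].
have h e (e0 : 0 < e) := @integrable_off_ends R a b (fun t => f t / (t - xi)) _ _
  (measurable_excised a b xi e) (@excised_sub _ _ _ _ _)
  (fun t _ tab => congr1 (fun z : R => z / (t - xi)) (fg t tab)) (ig e e0).
split=> [e /h[]//|]; apply: cvg_at_right0_eq cg => e /h[] //.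
Qed.

Lemma is_rpv_off_point a b (f g : R -> R) xi c l :
  (forall t, a <= t <= b -> t != c -> f t = g t) -> is_rpv a b g xi l -> is_rpv a b f xi l.
Proof.
move=> fg [ig cg].
have fg' e t : excised a b xi e t -> t != c -> f t / (t - xi) = g t / (t - xi).
  by move=> [tab _] tc; rewrite fg//; move: tab; rewrite /= in_itv.
have h e (e0 : 0 < e) := integrable_off_point (measurable_excised a b xi e) (@fg' e) (ig e e0).
split=> [e /h[]//|]; apply: cvg_at_right0_eq cg => e /h[] //.
Qed.

Lemma is_rpvD a b (f g : R -> R) xi (l1 l2 : R) : is_rpv a b f xi l1 -> is_rpv a b g xi l2 ->
  is_rpv a b (fun t => f t + g t) xi (l1 + l2).
Proof.
move=> [if_ cf] [ig cg].
have E t : (f t + g t) / (t - xi) = f t / (t - xi) + g t / (t - xi) by rewrite mulrDl.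
have mX e := measurable_excised a b xi e.
split=> [e e0|].
  rewrite (_ : (fun t => _) = (fun t => f t / (t - xi) + g t / (t - xi))); last exact/funext.
  by apply: integrableD_real => //; [exact: if_|exact: ig].
apply: (@cvg_at_right0_eq (fun e => pv_cut a b f xi e + pv_cut a b g xi e)).
  move=> e e0; rewrite /pv_cut -RintegralD//; try exact: if_; try exact: ig; try exact: mX.
  by apply: eq_Rintegral => t _; rewrite E.
exact: cvgD.
Qed.

Lemma is_rpvZ a b k (f : R -> R) xi l : is_rpv a b f xi l ->
  is_rpv a b (fun t => k * f t) xi (k * l).
Proof.
move=> [if_ cf].
have mX e := measurable_excised a b xi e.
split=> [e e0|].
  rewrite (_ : (fun t => _) = (fun t => k * (f t / (t - xi)))).
    by apply: integrableZ_real => //; exact: if_.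
  by apply/funext => t; rewrite mulrA.
apply: (@cvg_at_right0_eq (fun e => k * pv_cut a b f xi e)).
  move=> e e0; rewrite /pv_cut -RintegralZl//; try exact: if_; try exact: mX.
  by apply: eq_Rintegral => t _; rewrite mulrA.
by apply: cvgM => //; exact: cvg_cst.
Qed.

Lemma is_rpvB a b (f g : R -> R) xi (l1 l2 : R) : is_rpv a b f xi l1 -> is_rpv a b g xi l2 ->
  is_rpv a b (fun t => f t - g t) xi (l1 - l2).
Proof.
move=> hf /(is_rpvZ (- 1)) hg; have := is_rpvD hf hg; rewrite mulN1r.
by under eq_fun do rewrite mulN1r.
Qed.

(** The Cauchy factor 1 / (t - xi) is real and therefore acts on each part separately. *)
Lemma is_pvE a b f xi z : is_pv a b f xi z <->
  is_rpv a b (fun t => Re (f t)) xi (Re z) /\ is_rpv a b (fun t => Im (f t)) xi (Im z).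
Proof.
have EE t : cauchy_integrand f xi t = f t * ((t - xi)^-1)%:C.
  by rewrite /cauchy_integrand real_complexV.
have ER : (fun t => Re (cauchy_integrand f xi t)) = (fun t => Re (f t) / (t - xi)).
  by apply/funext => t; rewrite EE Re_mulr_real.
have EI : (fun t => Im (cauchy_integrand f xi t)) = (fun t => Im (f t) / (t - xi)).
  by apply/funext => t; rewrite EE Im_mulr_real.
rewrite /is_pv /is_rpv /cintegrable /ccvg /cint /= /pv_cut -ER -EI; split.
  by move=> [h [h1 h2]]; do 2 split => //; move=> e /h[].
by move=> [[h1 h3] [h2 h4]]; split => // e e0; split; [exact: h1|exact: h2].
Qed.

Lemma is_pv_lim a b f xi z : is_pv a b f xi z -> pv a b f xi = z.
Proof.
move=> [_ [h1 h2]]; rewrite /pv.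
by rewrite (cvg_lim _ h1)// (cvg_lim _ h2)//; case: (z).
Qed.

Lemma is_pvD a b f g xi z w : is_pv a b f xi z -> is_pv a b g xi w ->
  is_pv a b (fun t => f t + g t) xi (z + w).
Proof.
move=> /is_pvE[f1 f2] /is_pvE[g1 g2]; apply/is_pvE; rewrite Re_add Im_add; split.
  under eq_fun do rewrite Re_add; exact: is_rpvD.
under eq_fun do rewrite Im_add; exact: is_rpvD.
Qed.

Lemma is_pvZ a b (k : R[i]) f xi z : is_pv a b f xi z -> is_pv a b (fun t => k * f t) xi (k * z).
Proof.
move=> /is_pvE[f1 f2]; apply/is_pvE; rewrite Re_mul Im_mul; split.
  by under eq_fun do rewrite Re_mul; apply: is_rpvB; exact: is_rpvZ.
by under eq_fun do rewrite Im_mul; apply: is_rpvD; exact: is_rpvZ.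
Qed.

Lemma C1_lipschitz a b f : a < b -> C1_on a b f -> exists2 M : R, 0 <= M &
  forall s t, a <= s <= b -> a <= t <= b ->
    `|Re (f s) - Re (f t)| <= M * `|s - t| /\ `|Im (f s) - Im (f t)| <= M * `|s - t|.
Proof.
move=> ab [[c1 c2] [df cdf Hdf]].
have [M M0 HM] := ccontinuous_bounded (ltW ab) cdf.
have lip (F dF : R -> R) : {within `[a, b], continuous F} ->
    (forall t, a < t < b -> is_derive t 1 F (dF t)) ->
    (forall t, a <= t <= b -> `|dF t| <= M) ->
    forall s t, a <= s <= b -> a <= t <= b -> `|F s - F t| <= M * `|s - t|.
  move=> cF hF hM s t; wlog st : s t / s <= t.
    move=> wl; have [st|/ltW ts] := leP s t; first exact: wl.
    by move=> h1 h2; rewrite distrC [`|s - t|]distrC; exact: wl.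
  move=> /andP[as_ sb] /andP[at_ tb]; rewrite distrC [`|s - t|]distrC.
  have [||r rst ->] := @MVT_segment R F dF s t st.
  - move=> r; rewrite in_itv/= => /andP[sr rt]; apply: hF.
    by rewrite (le_lt_trans as_)//= (lt_le_trans rt).
  - apply: continuous_subspaceW cF => r /=; rewrite !in_itv/= => /andP[sr rt].
    by rewrite (le_trans as_)//= (le_trans rt).
  move: rst; rewrite in_itv/= => /andP[sr rt].
  by rewrite normrM ler_wpM2r// hM// (le_trans as_)//= (le_trans rt).
exists M => // s t sab tab; split.
  apply: (lip (fun t => Re (f t)) (fun t => Re (df t))) => // r rab.
    have [[d1 _] E] := Hdf r rab; rewrite -E /cderive/= derive1E; exact/derivableP.
  exact: le_trans (Re_le_l1norm _) (HM r rab).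
apply: (lip (fun t => Im (f t)) (fun t => Im (df t))) => // r rab.
  have [[_ d2] E] := Hdf r rab; rewrite -E /cderive/= derive1E; exact/derivableP.
exact: le_trans (Im_le_l1norm _) (HM r rab).
Qed.

Lemma C1_pv_exists a b f xi : a < b -> C1_on a b f -> f a = 0 -> f b = 0 -> a <= xi <= b ->
  pv_exists a b f xi.
Proof.
move=> ab fC1 fa fb xiab; have [M M0 HM] := C1_lipschitz ab fC1.
have [[c1 c2] _] := fC1.
(* At the ends the density vanishes and any radius will do; inside, the distance to the nearer end
   leaves room for the symmetric interval. *)
have [r r0 Hr] : exists2 r : R, 0 < r & f xi = 0 \/ (a <= xi - r /\ xi + r <= b).
  have [->|xia] := eqVneq xi a; first by exists 1 => //; left.
  have [->|xib] := eqVneq xi b; first by exists 1 => //; left.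
  have /andP[axi xib'] : a < xi < b.
    by rewrite !lt_neqAle xib eq_sym xia; case/andP : xiab => -> ->.
  exists (Num.min (xi - a) (b - xi)); first by rewrite lt_min !subr_gt0 axi.
  by right; have [h|h] := leP (xi - a) (b - xi); split; lra.
have ex (F : R -> R) : {within `[a, b], continuous F} ->
    (forall s t, a <= s <= b -> a <= t <= b -> `|F s - F t| <= M * `|s - t|) ->
    F xi = 0 \/ (a <= xi - r /\ xi + r <= b) -> exists l, is_rpv a b F xi l.
  move=> cF FL Fr.
  have iF : mu.-integrable `[a, b] (EFin \o F).
    by apply: continuous_compact_integrable => //; exact: segment_compact.
  have [_ [l Hl]] := pv_cut_lipschitz r0 M0 xiab iF (fun x xab _ => FL x xi xab xiab) Fr.
  by exists l; split => // e e0; exact: integrable_excised_div.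
have [||p Hp] := ex _ c1.
- by move=> s t sab tab; have [] := HM s t sab tab.
- by case: Hr => [->|]; [left|right].
have [||q Hq] := ex _ c2.
- by move=> s t sab tab; have [] := HM s t sab tab.
- by case: Hr => [->|]; [left|right].
by exists (p +i* q); apply/is_pvE.
Qed.

End complex_tools.

(** * The kernels of R1 and R2 *)

Section regular_graphs.
Context {R : realType}.
Implicit Types (a b c d r s t xi eta lam H B : R) (g gj gk : R -> R).
Notation mu := (@lebesgue_measure R).
Notation Re := complex.Re.
Notation Im := complex.Im.

(** What the Lyapunov condition gives for a single line: the slope is integrable up to the ends, but
    Hoelder only on compact subintervals, with an exponent common to all of them. *)
Record regular_graph a b g : Prop := RegularGraph {
  rg_cont : {within `[a, b], continuous g};
  rg_derivable : forall t, a < t < b -> derivable g t 1;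
  rg_integrable : mu.-integrable `]a, b[ (EFin \o derive1 g);
  rg_hoelder : exists2 lam, 0 < lam <= 1 & forall c d, a < c -> d < b ->
    exists2 H, 0 <= H & forall s t, c <= s <= d -> c <= t <= d ->
      `|derive1 g s - derive1 g t| <= H * `|s - t| `^ lam }.

Lemma lyapunov_regular_graph a b g h : a < b ->
  lyapunov_curve (graph_over a b g `|` graph_over a b h) ->
  {within `[a, b], continuous g} ->
  (forall t, a < t < b -> g t != h t) ->
  (forall t, a < t < b -> derivable g t 1) ->
  (forall t, a < t < b -> derivable h t 1) ->
  regular_graph a b g.
Proof.
move=> ab [L [x [y [[L0 per] _ GE dxy [C [lam [lam01 hoelder]]]]]]] cg gh dg dh.
have onG s : graph_over a b g (x s, y s) \/ graph_over a b h (x s, y s).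
  have : (graph_over a b g `|` graph_over a b h) (x s, y s) by rewrite GE; exists s.
  by case; [left|right].
have inG t : a <= t <= b -> exists s, x s = t /\ y s = g t.
  move=> tab; have : (graph_over a b g `|` graph_over a b h) (t, g t) by left.
  by rewrite GE => -[s _ [<- <-]]; exists s.
split => //.
  exact: (graph_derivative_integrable ab L0 per dxy lam01 hoelder onG inG gh dg dh).
exists lam => // c d ac db.
exact: (graph_derivative_hoelder ab L0 per dxy lam01 hoelder onG inG gh dg dh ac db).
Qed.

Section one_graph.
Variables (a b : R) (g : R -> R).
Hypotheses (rg : regular_graph a b g).

Lemma regular_graph_measurable_slope : measurable_fun `]a, b[ (derive1 g).
Proof. by apply/measurable_EFinP; exact: measurable_int (rg_integrable rg). Qed.

Lemma regular_graph_slope_bounded : locally_bounded_oo a b (derive1 g).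
Proof.
move=> c d ac db; have [lam /andP[lam0 _] HH] := rg_hoelder rg.
have [H H0 HL] := HH c d ac db.
exists (`|derive1 g c| + H * (d - c) `^ lam) => s /andP[cs sd].
rewrite -[X in `|X|](subrK (derive1 g c)) addrC (le_trans (ler_normD _ _))// lerD//.
have cd := le_trans cs sd.
apply: (le_trans (HL s c _ _)); rewrite ?cs ?sd ?lexx ?cd//.
rewrite ler_wpM2l// ger0_norm ?subr_ge0//.
by apply: ge0_ler_powR; rewrite ?nnegrE ?subr_ge0 ?lerB// ltW.
Qed.

Let mean_value c d s t : a < c -> d < b -> c <= s <= d -> c <= t <= d ->
  exists2 r, c <= r <= d /\ `|s - r| <= `|s - t| & g s - g t = derive1 g r * (s - t).
Proof.
move=> ac db; have sub r : c <= r <= d -> a < r < b.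
  by move=> /andP[cr rd]; rewrite (lt_le_trans ac)//= (le_lt_trans rd).
have mv x y : c <= x -> y <= d -> x <= y ->
    exists2 r, r \in `[x, y] & g y - g x = derive1 g r * (y - x).
  move=> cx yd xy; apply: MVT_segment => //.
  - move=> r; rewrite in_itv/= => /andP[xr ry].
    rewrite derive1E; apply/derivableP/(rg_derivable rg)/sub.
    by rewrite (le_trans cx (ltW xr))//= (le_trans (ltW ry)).
  - apply: continuous_subspaceW (rg_cont rg) => r /=; rewrite !in_itv/= => /andP[xr ry].
    by rewrite !ltW//; have /sub/andP[] // : c <= r <= d; rewrite (le_trans cx)//= (le_trans ry).
move=> /andP[cs sd] /andP[ct td]; have [st|/ltW ts] := leP s t.
  have [r] := mv s t cs td st; rewrite in_itv/= => /andP[sr rt] E.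
  exists r; last by rewrite -[LHS]opprB E; ring.
  split; first by rewrite (le_trans cs)//= (le_trans rt).
  by rewrite distrC [leRHS]distrC !ger0_norm ?subr_ge0// lerB.
have [r] := mv t s ct sd ts; rewrite in_itv/= => /andP[tr rs] E.
exists r; last exact: E.
split; first by rewrite (le_trans ct)//= (le_trans rs).
by rewrite !ger0_norm ?subr_ge0// lerB.
Qed.

Lemma regular_graph_lipschitz c d : a < c -> d < b -> exists2 L, 0 <= L &
  forall s t, c <= s <= d -> c <= t <= d -> `|g s - g t| <= L * `|s - t|.
Proof.
move=> ac db; have [W HW] := regular_graph_slope_bounded ac db.
exists `|W| => // s t scd tcd; have [r [rcd _] ->] := mean_value ac db scd tcd.
by rewrite normrM ler_wpM2r// (le_trans (HW r rcd))// ler_norm.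
Qed.

(** By the mean value theorem the remainder is (g' r - g' s) (s - t) with |s - r| <= |s - t|. *)
Lemma regular_graph_taylor : exists2 lam, 0 < lam <= 1 & forall c d, a < c -> d < b ->
  exists2 H, 0 <= H & forall s t, c <= s <= d -> c <= t <= d ->
    `|g s - g t - derive1 g s * (s - t)| <= H * `|s - t| `^ lam * `|s - t|.
Proof.
have [lam lam01 HH] := rg_hoelder rg; exists lam => // c d ac db.
have /andP[lam0 _] := lam01; have [H H0 HL] := HH c d ac db; exists H => // s t scd tcd.
have [r [rcd srt] ->] := mean_value ac db scd tcd.
rewrite -mulrBl normrM ler_wpM2r//; apply: (le_trans (HL r s rcd scd)).
by rewrite ler_wpM2l// distrC; apply: ge0_ler_powR; rewrite ?nnegrE// ltW.
Qed.

End one_graph.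

Lemma integrable_cst_oo a b (k : R) : mu.-integrable `]a, b[ (EFin \o (fun=> k)).
Proof. by apply: (@integrable_cst_itv R _ k a b) => //; exact: subset_itv_oo_cc. Qed.

Lemma itv_radius a b xi : a < xi < b ->
  exists2 r : R, 0 < r & a < xi - r /\ xi + r < b.
Proof.
move=> /andP[axi xib]; exists (Num.min (xi - a) (b - xi) / 2).
  by rewrite divr_gt0// lt_min !subr_gt0 axi.
by have [h|h] := leP (xi - a) (b - xi); split; lra.
Qed.

Lemma l1norm_real r : l1norm (r%:C) = `|r|.
Proof. by rewrite /l1norm /= normr0 addr0. Qed.

Lemma l1norm_normal_factor g t : l1norm (normal_factor g t) = 1 + `|derive1 g t|.
Proof. by rewrite /l1norm Re_normal_factor Im_normal_factor normr1 normrN. Qed.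

Let kpi : R := (2 * pi)^-1.

Let kpi0 : 0 <= kpi. Proof. by rewrite invr_ge0 mulr_ge0 ?pi_ge0. Qed.

Lemma cmeasurable_crossE a b gj gk xi : regular_graph a b gj ->
  cmeasurable `]a, b[ (fun eta => crossE gj gk eta xi).
Proof.
move=> rj; apply: cmeasurableM; last first.
  apply: cmeasurable_normal_factor; exact: regular_graph_measurable_slope rj.
apply: cmeasurableM; first exact: cmeasurable_cst.
apply: cmeasurable_inv; apply: measurable_funB => //.
apply: (@measurable_funS _ _ _ _ `[a, b]%classic) => //; first exact: subset_itv_oo_cc.
by apply: subspace_continuous_measurable_fun => //; exact: rg_cont rj.
Qed.

Section two_graphs.
Variables (a b : R) (gj gk : R -> R).
Hypotheses (rj : regular_graph a b gj) (rk : regular_graph a b gk).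

Let inverse_bounded c d : (forall t, a < t < b -> gj t != gk t) -> a < c -> d < b ->
  exists2 Z : R, 0 <= Z & forall eta xi, c <= eta <= d -> c <= xi <= d ->
    l1norm ((gj eta - gk xi) +i* (eta - xi))^-1 <= Z.
Proof.
move=> neq ac db; have [cd|dc] := leP c d; last first.
  by exists 0 => // eta xi /andP[h1 h2]; have := le_trans h1 h2; rewrite leNgt dc.
have [L L0 HL] := regular_graph_lipschitz rk ac db.
have sub : `[c, d] `<=` `[a, b].
  move=> t /=; rewrite !in_itv/= => /andP[ct td].
  by rewrite (le_trans (ltW ac))//= (le_trans td)// ltW.
have cf : {within `[c, d], continuous (fun t => `|gj t - gk t|)}.
  apply: (continuous_subspaceW sub) => t.
  apply: (@continuous_comp (subspace `[a, b]) _ _ (fun t => gj t - gk t) (@Num.norm _ R)).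
    by apply: continuousB; [exact: (rg_cont rj)|exact: (rg_cont rk)].
  exact: norm_continuous.
have [t0 t0cd Hmin] := EVT_min cd cf.
pose m : R := `|gj t0 - gk t0|.
have m0 : 0 < m.
  rewrite normr_gt0 subr_eq0 neq//; move: t0cd; rewrite in_itv/= => /andP[ct td].
  by rewrite (lt_le_trans ac)//= (le_lt_trans td).
(* If |eta - xi| < m', then gk varies by at most L m' between eta and xi, and m - L m' >= m' bounds
   the real part from below. *)
pose m' := m / (2 * (L + 1)).
have L1 : 0 < 2 * (L + 1) by lra.
have m'0 : 0 < m' by rewrite divr_gt0.
exists (2 / m') => [|eta xi ecd xcd]; first by rewrite divr_ge0// ltW.
apply: l1norm_inv => //; have [h|h] := leP m' `|eta - xi|; [by right|left].
have h1 : m <= `|gj eta - gk eta| by apply: Hmin; rewrite in_itv.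
have h2 := HL eta xi ecd xcd.
have h3 : `|gj eta - gk eta| <= `|gj eta - gk xi| + `|gk eta - gk xi|.
  have -> : gj eta - gk eta = (gj eta - gk xi) - (gk eta - gk xi) by ring.
  exact: ler_normB.
have h4 : L * `|eta - xi| <= L * m' by rewrite ler_wpM2l// ltW.
have E : m = m' * (2 * (L + 1)) by rewrite /m' divfK// gt_eqF.
have h5 : 0 <= L * m' by rewrite mulr_ge0// ltW.
move: h1 h2 h3 h4 E h5 m'0; clear; lra.
Qed.

Lemma crossE_weakly_singular : (forall t, a < t < b -> gj t != gk t) ->
  weakly_singular a b (crossE gj gk).
Proof.
move=> neq; split=> [xi xiab|c d ac cd db].
  have [r r0 [ar rb]] := itv_radius xiab.
  have [Z Z0 HZ] := inverse_bounded neq ar rb.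
  (* [Z] bounds the inverse for eta within r of xi, and 2 / r bounds it farther away, where the
     imaginary part exceeds r in modulus. *)
  apply: (@cintegrable_le _ _ _ (fun eta => kpi * (Z + 2 / r) * (1 + `|derive1 gj eta|))) => //.
  - exact: cmeasurable_crossE.
  - move=> eta _; apply: (le_trans (l1normM _ _)).
    rewrite l1norm_normal_factor ler_wpM2r ?addr_ge0//.
    apply: (le_trans (l1normM _ _)); rewrite l1norm_real ger0_norm// ler_wpM2l//.
    have [er|er] := leP `|eta - xi| r.
      rewrite ler_wpDr ?divr_ge0 ?(ltW r0)// HZ//; move: er; rewrite ler_norml => /andP[? ?];
        by apply/andP; split; lra.
    by rewrite ler_wpDl// l1norm_inv//; right; exact: ltW.
  - apply: integrableZ_real => //; apply: integrableD_real => //.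
      exact: integrable_cst_oo.
    exact: integrable_norm_real (rg_integrable rj).
have [Z Z0 HZ] := inverse_bounded neq ac db.
have [W HW] := regular_graph_slope_bounded rj ac db.
exists (kpi * Z * (1 + W)), 0; split => [|eta xi ecd xcd _]; first by rewrite lexx ltr01.
apply: (le_trans (le_norm_l1norm _)); rewrite lecR oppr0 powRr0 mulr1.
apply: (le_trans (l1normM _ _)); rewrite l1norm_normal_factor.
apply: ler_pM; rewrite ?l1norm_ge0 ?addr_ge0//; last by rewrite lerD2l HW.
apply: (le_trans (l1normM _ _)); rewrite l1norm_real ger0_norm// ler_wpM2l//.
exact: HZ.
Qed.

End two_graphs.

(** The algebra of the cancellation in an arbitrary field, where [field] applies: z stands for p + i
    q, and I z = I P - Q is what remains of i^2 = -1. *)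
Let diagonal_identity (F : fieldType) (I P Q D PI z : F) :
  (2 : F) != 0 -> z != 0 -> Q != 0 -> PI != 0 -> I * z = I * P - Q ->
  2 * ((2 * PI)^-1 * z^-1 * (1 - I * D)) + I / PI * Q^-1 = (P - D * Q) / (Q * PI) * (I * z^-1).
Proof.
move=> n20 z0 Q0 PI0 E.
have -> : 2 * ((2 * PI)^-1 * z^-1 * (1 - I * D)) + I / PI * Q^-1 =
    (z * Q * PI)^-1 * (Q * (1 - I * D) + I * z) by field; rewrite n20 z0 Q0 PI0.
by rewrite E; field; rewrite z0 Q0 PI0.
Qed.

(* From i z = i p - q for z = p +i* q: the poles 1/q of both summands cancel. *)
Lemma diagE_factor g eta xi : eta != xi ->
  diagE g eta xi = ((g eta - g xi - derive1 g eta * (eta - xi)) / ((eta - xi) * pi))%:C *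
    ('i * ((g eta - g xi) +i* (eta - xi))^-1).
Proof.
rewrite -subr_eq0 => q0; rewrite /diagE /crossE /Ebd /normal_factor /i_over_pi.
set p := g eta - g xi; set q := eta - xi in q0 *.
have rC x y : (x - y)%:C = x%:C - y%:C :> R[i] by rewrite (rmorphB (real_complex R)).
have mC x y : (x * y)%:C = x%:C * y%:C :> R[i] by rewrite (rmorphM (real_complex R)).
have nz (x : R) : x != 0 -> x%:C != 0 :> R[i].
  by move=> x0; rewrite (fmorph_eq0 (real_complex R)).
have twoC : (2 : R)%:C = 2 :> R[i] by rewrite (rmorph_nat (real_complex R)).
have -> : ((p - derive1 g eta * q) / (q * pi))%:C =
    (p%:C - (derive1 g eta)%:C * q%:C) / (q%:C * pi%:C) by rewrite mC rC mC -real_complexV mC.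
have -> : ((2 * pi)^-1)%:C = (2 * pi%:C)^-1 :> R[i] by rewrite -real_complexV mC twoC.
rewrite -real_complexV; apply: diagonal_identity.
- by rewrite pnatr_eq0.
- by apply/eqP => -[_ /eqP]; apply/negP.
- exact: nz.
- by apply: nz; rewrite gt_eqF// pi_gt0.
- by apply/eqP; rewrite eq_complex/=; apply/andP; split; apply/eqP; ring.
Qed.

Let l1norm_diagE g eta xi : eta != xi ->
  l1norm (diagE g eta xi) <=
  `|g eta - g xi - derive1 g eta * (eta - xi)| / `|eta - xi| * (2 / pi) * `|eta - xi|^-1.
Proof.
move=> ex; have q0 : 0 < `|eta - xi| by rewrite normr_gt0 subr_eq0.
rewrite diagE_factor//; apply: (le_trans (l1normM _ _)).
rewrite l1norm_real normrM normfV normrM [`|pi|]ger0_norm ?pi_ge0//.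
have -> : `|g eta - g xi - derive1 g eta * (eta - xi)| / `|eta - xi| * (2 / pi) * `|eta - xi|^-1 =
  `|g eta - g xi - derive1 g eta * (eta - xi)| / (`|eta - xi| * pi) * (2 / `|eta - xi|).
  by rewrite invfM; ring.
apply: ler_wpM2l; first by rewrite divr_ge0// mulr_ge0// pi_ge0.
apply: (le_trans (l1normM _ _)).
have -> : l1norm ('i : R[i]) = 1 by rewrite /l1norm /= normr0 normr1 add0r.
by rewrite mul1r; apply: l1norm_inv => //; right.
Qed.

Lemma diagE_weakly_singular a b g : regular_graph a b g -> weakly_singular a b (diagE g).
Proof.
move=> rg; have [lam lam01 HT] := regular_graph_taylor rg.
have /andP[lam0 lam1] := lam01.
have pi0 : 0 <= 2 / pi :> R by rewrite divr_ge0 ?pi_ge0.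
(* The Taylor remainder O(|eta - xi|^(1 + lam)) over |eta - xi|^2 leaves the exponent 1 - lam <
   1. *)
have local c d : a < c -> d < b -> exists2 H, 0 <= H & forall eta xi,
    c <= eta <= d -> c <= xi <= d -> eta != xi ->
    l1norm (diagE g eta xi) <= H * dpow (1 - lam) xi eta.
  move=> ac db; have [H H0 HL] := HT c d ac db; exists (H * (2 / pi)) => [|eta xi ecd xcd ex].
    exact: mulr_ge0.
  have q0 : 0 < `|eta - xi| by rewrite normr_gt0 subr_eq0.
  apply: (le_trans (l1norm_diagE _ ex)).
  have -> : dpow (1 - lam) xi eta = `|eta - xi| `^ lam * `|eta - xi|^-1.
    rewrite /dpow opprB powRB; last by rewrite (gt_eqF q0) implybT.
    by rewrite powRr1.
  have -> : H * (2 / pi) * (`|eta - xi| `^ lam * `|eta - xi|^-1) =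
     H * `|eta - xi| `^ lam * (2 / pi) * `|eta - xi|^-1 by ring.
  rewrite ler_wpM2r ?invr_ge0// ler_wpM2r// ler_pdivrMr//.
  exact: HL.
split=> [xi xiab|c d ac cd db]; last first.
  have [H H0 HL] := local c d ac db.
  exists H, (1 - lam); split; first by apply/andP; split; lra.
  move=> eta xi ecd xcd ex; apply: (le_trans (le_norm_l1norm _)).
  by rewrite lecR; exact: HL.
have ab : a < b by case/andP : xiab => /lt_trans; apply.
have [r r0 [ar rb]] := itv_radius xiab.
have [H H0 HL] := local _ _ ar rb.
have [B B0 HB] := within_continuous_bounded (ltW ab) (rg_cont rg).
have lam' : 0 <= 1 - lam < 1 by apply/andP; split; lra.
have [J J0 HJ] := integral_dpow_itv lam' ab.
have xab : a <= xi <= b by case/andP : xiab => ? ?; rewrite !ltW.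
have [iJ _] := HJ xi xab `]a, b[%classic (measurable_itv _) (@subset_itv_oo_cc _ _ a b).
(* The three summands dominate the kernel for eta near xi, for eta farther than r, where |g| <= B
   and the slope is integrable, and at eta = xi. *)
apply: (@cintegrable_le _ _ _ (fun eta => H * dpow (1 - lam) xi eta +
  2 / pi * r^-1 * (2 * B / r + `|derive1 g eta|) + l1norm (diagE g xi xi))) => //.
- apply: cmeasurableD.
    apply: cmeasurableM; first exact: cmeasurable_cst.
    exact: cmeasurable_crossE.
  apply: cmeasurableM; first exact: cmeasurable_cst.
  apply: cmeasurable_real; apply: (measurableT_comp (@measurable_inv R)).
  exact: measurable_funB.
- move=> eta /=; rewrite in_itv/= => eab.
  have rinv : 0 <= r^-1 by rewrite invr_ge0 ltW.
  have t1 : 0 <= H * dpow (1 - lam) xi eta by rewrite mulr_ge0// dpow_ge0.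
  have t2 : 0 <= 2 / pi * r^-1 * (2 * B / r + `|derive1 g eta|).
    by apply: mulr_ge0; [exact: mulr_ge0|rewrite addr_ge0// mulr_ge0// mulr_ge0].
  have [E|ex] := eqVneq eta xi; first by rewrite [in leLHS]E ler_wpDl// addr_ge0.
  have [er|er] := leP `|eta - xi| r.
    rewrite ler_wpDr ?l1norm_ge0// ler_wpDr// HL//.
      by move: er; rewrite ler_norml => /andP[? ?]; apply/andP; split; lra.
    by apply/andP; split; lra.
  rewrite ler_wpDr ?l1norm_ge0// ler_wpDl//.
  have q0 : 0 < `|eta - xi| by exact: lt_trans er.
  apply: (le_trans (l1norm_diagE _ ex)).
  rewrite (_ : 2 / pi * r^-1 * (2 * B / r + `|derive1 g eta|) =
    (2 * B / r + `|derive1 g eta|) * (2 / pi) * r^-1); last by ring.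
  have qr : `|eta - xi|^-1 <= r^-1 by rewrite lef_pV2 ?posrE// ltW.
  have qi : 0 <= `|eta - xi|^-1 by rewrite invr_ge0.
  apply: ler_pM => //; first by apply: mulr_ge0 => //; exact: mulr_ge0.
  apply: ler_wpM2r => //; rewrite ler_pdivrMr//.
  apply: (le_trans (ler_normB _ _)); rewrite mulrDl normrM lerD//.
  apply: (@le_trans _ _ (2 * B)).
    apply: (le_trans (ler_normB _ _)); rewrite [leRHS]mulr_natl mulr2n lerD ?HB//.
    by case/andP : eab => ? ?; rewrite !ltW.
  by rewrite mulrAC ler_pdivlMr// ler_wpM2l ?mulr_ge0// ltW.
- apply: integrableD_real => //; last exact: integrable_cst_oo.
  apply: integrableD_real => //; apply: integrableZ_real => //.
  apply: integrableD_real => //; first exact: integrable_cst_oo.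
  exact: integrable_norm_real (rg_integrable rg).
Qed.

End regular_graphs.

(** * Interchange of the order of integration *)

Section complex_interchange.
Context {R : realType}.
Notation mu := (@lebesgue_measure R).
Notation Re := complex.Re.
Notation Im := complex.Im.
Variables (a b : R) (gj gk : R -> R).
Hypotheses (ab : a < b) (rj : regular_graph a b gj) (rk : regular_graph a b gk).

Lemma cvg_at_right0_norm_le (v : R -> R) (l B : R) : (forall e : R, 0 < e -> `|v e| <= B) ->
  v e @[e --> 0^'+] --> l -> `|l| <= B.
Proof.
move=> vB cv; rewrite ler_norml; apply/andP; split.
  apply: (cvgr_to_ge cv); near=> e.
  have /vB : 0 < e by near: e; exact: nbhs_right_gt.
  by rewrite ler_norml => /andP[].
apply: (cvgr_to_le cv); near=> e.
have /vB : 0 < e by near: e; exact: nbhs_right_gt.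
by rewrite ler_norml => /andP[].
Unshelve. all: by end_near. Qed.

Lemma cintegrableM_parts A (f g : R -> R[i]) : measurable A ->
  mu.-integrable A (EFin \o (fun t => Re (f t) * Re (g t))) ->
  mu.-integrable A (EFin \o (fun t => Im (f t) * Im (g t))) ->
  mu.-integrable A (EFin \o (fun t => Re (f t) * Im (g t))) ->
  mu.-integrable A (EFin \o (fun t => Im (f t) * Re (g t))) ->
  cintegrable A (fun t => f t * g t) /\
  cint A (fun t => f t * g t) =
    (\int[mu]_(t in A) (Re (f t) * Re (g t)) - \int[mu]_(t in A) (Im (f t) * Im (g t))) +i*
    (\int[mu]_(t in A) (Re (f t) * Im (g t)) + \int[mu]_(t in A) (Im (f t) * Re (g t))).
Proof.
move=> mA i1 i2 i3 i4.
have eR : (fun t => Re (f t * g t)) = (fun t => Re (f t) * Re (g t) - Im (f t) * Im (g t)).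
  by apply/funext => t; rewrite Re_mul.
have eI : (fun t => Im (f t * g t)) = (fun t => Re (f t) * Im (g t) + Im (f t) * Re (g t)).
  by apply/funext => t; rewrite Im_mul.
rewrite /cintegrable /cint.
have -> : (fun t => (Re (f t * g t))%:E) = EFin \o (fun t => Re (f t * g t)) by [].
have -> : (fun t => (Im (f t * g t))%:E) = EFin \o (fun t => Im (f t * g t)) by [].
rewrite eR eI; split; first by split; [exact: integrableB_real|exact: integrableD_real].
by rewrite RintegralB// RintegralD.
Qed.

Let kernels := Ubd_singular_kernel ab (rg_cont rj) (rg_cont rk)
  (fun c d ac db => regular_graph_lipschitz rk ac db).

(** The principal values exist and inherit the bound of the truncated integrals, which is uniform in
    e. *)
Lemma Ubd_pv c d : a < c -> c <= d -> d < b -> exists2 C : R, 0 <= C &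
  forall eta xi, a <= eta <= b -> c <= xi <= d -> eta != xi ->
    is_pv a b (Ubd gj gk eta) xi (pv a b (Ubd gj gk eta) xi) /\
    l1norm (pv a b (Ubd gj gk eta) xi) <= C * dpow 2^-1 xi eta.
Proof.
move=> ac cd db; have [KR [KI [sR sI UK]]] := kernels.
have [CR CR0 HR] := singular_kernel_cut ac cd db sR.
have [CI CI0 HI] := singular_kernel_cut ac cd db sI.
exists (CR + CI) => [|eta xi eab xcd ex]; first exact: addr_ge0.
have [bR [lR cR]] := HR xi eta xcd eab ex.
have [bI [lI cI]] := HI xi eta xcd eab ex.
have iR := singular_kernel_integrable ab eab sR.
have iI := singular_kernel_integrable ab eab sI.
have pR : is_rpv a b (fun t => Re (Ubd gj gk eta t)) xi lR.
  apply: (@is_rpv_off_point _ _ _ _ (KR eta) _ eta).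
    by move=> t tab te; have [] := UK eta t eab tab (ltac:(by rewrite eq_sym)).
  by split => // e e0; exact: integrable_excised_div.
have pI : is_rpv a b (fun t => Im (Ubd gj gk eta t)) xi lI.
  apply: (@is_rpv_off_point _ _ _ _ (KI eta) _ eta).
    by move=> t tab te; have [] := UK eta t eab tab (ltac:(by rewrite eq_sym)).
  by split => // e e0; exact: integrable_excised_div.
have pU : is_pv a b (Ubd gj gk eta) xi (lR +i* lI) by apply/is_pvE.
rewrite (is_pv_lim pU); split => //.
rewrite mulrDl; apply: lerD => /=.
  exact: cvg_at_right0_norm_le bR cR.
exact: cvg_at_right0_norm_le bI cI.
Qed.

Section weight.
Variables (W : R -> R[i]).
Hypotheses (iW : cintegrable `]a, b[ W)
  (bWR : locally_bounded_oo a b (fun t => Re (W t)))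
  (bWI : locally_bounded_oo a b (fun t => Im (W t))).

Let integrable_off_diagonal (w K U : R -> R) (x : R) :
  (forall eta, a < eta < b -> eta != x -> U eta = K eta) ->
  mu.-integrable `]a, b[ (EFin \o (fun eta => w eta * K eta)) ->
  mu.-integrable `]a, b[ (EFin \o (fun eta => w eta * U eta)) /\
  \int[mu]_(eta in `]a, b[) (w eta * U eta) = \int[mu]_(eta in `]a, b[) (w eta * K eta).
Proof.
move=> UK; move=> iK; apply: (@integrable_off_point R _ x) iK => // eta /=.
by rewrite in_itv/= => eab ex; rewrite UK.
Qed.

Lemma weighted_Ubd_integrable x : a < x < b ->
  cintegrable `]a, b[ (fun eta => W eta * Ubd gj gk eta x).
Proof.
move=> xab; have [KR [KI [sR sI UK]]] := kernels; have [iWR iWI] := iW.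
have le t : a < t < b -> a <= t <= b by move=> /andP[? ?]; rewrite !ltW.
have UR eta : a < eta < b -> eta != x -> Re (Ubd gj gk eta x) = KR eta x.
  by move=> eab ex; have [] := UK eta x (le _ eab) (le _ xab) ex.
have UI eta : a < eta < b -> eta != x -> Im (Ubd gj gk eta x) = KI eta x.
  by move=> eab ex; have [] := UK eta x (le _ eab) (le _ xab) ex.
have [i1 _] := integrable_off_diagonal UR (integrable_weight_kernel sR iWR bWR xab).
have [i2 _] := integrable_off_diagonal UI (integrable_weight_kernel sI iWI bWI xab).
have [i3 _] := integrable_off_diagonal UI (integrable_weight_kernel sI iWR bWR xab).
have [i4 _] := integrable_off_diagonal UR (integrable_weight_kernel sR iWI bWI xab).
by have [] := cintegrableM_parts (measurable_itv _) i1 i2 i3 i4.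
Qed.

(** Complex multiplication reduces this to four real interchanges, of the two parts of W against the
    two kernels. Replacing these kernels by the parts of U_jk alters the integrands at one point
    only. *)
Lemma weighted_Ubd_interchange xi : a < xi < b ->
  cintegrable `]a, b[ (fun eta => W eta * pv a b (Ubd gj gk eta) xi) /\
  is_pv a b (fun x => cint `]a, b[ (fun eta => W eta * Ubd gj gk eta x)) xi
    (cint `]a, b[ (fun eta => W eta * pv a b (Ubd gj gk eta) xi)).
Proof.
move=> xiab; have [KR [KI [sR sI UK]]] := kernels; have [iWR iWI] := iW.
have le t : a < t < b -> a <= t <= b by move=> /andP[? ?]; rewrite !ltW.
have /andP[axi xib] := xiab.
have [C C0 HC] := Ubd_pv axi (lexx xi) xib.
pose TR eta := Re (pv a b (Ubd gj gk eta) xi).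
pose TI eta := Im (pv a b (Ubd gj gk eta) xi).
have KTR s : a < s < b -> s != xi -> is_rpv a b (KR s) xi (TR s).
  move=> sab sx; have [/is_pvE[h _] _] := HC s xi (le _ sab) (ltac:(by rewrite lexx)) sx.
  apply: (@is_rpv_off_point _ _ _ _ _ _ s) h => t tab ts.
  by have [] := UK s t (le _ sab) tab (ltac:(by rewrite eq_sym)).
have KTI s : a < s < b -> s != xi -> is_rpv a b (KI s) xi (TI s).
  move=> sab sx; have [/is_pvE[_ h] _] := HC s xi (le _ sab) (ltac:(by rewrite lexx)) sx.
  apply: (@is_rpv_off_point _ _ _ _ _ _ s) h => t tab ts.
  by have [] := UK s t (le _ sab) tab (ltac:(by rewrite eq_sym)).
have cTR s sab sx := (KTR s sab sx).2; have cTI s sab sx := (KTI s sab sx).2.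
have [j1 p1 l1] := singular_interchange sR xiab iWR bWR cTR.
have [j2 p2 l2] := singular_interchange sI xiab iWI bWI cTI.
have [j3 p3 l3] := singular_interchange sI xiab iWR bWR cTI.
have [j4 p4 l4] := singular_interchange sR xiab iWI bWI cTR.
have UR x eta : a < x < b -> a < eta < b -> eta != x -> Re (Ubd gj gk eta x) = KR eta x.
  by move=> xab eab ex; have [] := UK eta x (le _ eab) (le _ xab) ex.
have UI x eta : a < x < b -> a < eta < b -> eta != x -> Im (Ubd gj gk eta x) = KI eta x.
  by move=> xab eab ex; have [] := UK eta x (le _ eab) (le _ xab) ex.
have [iT ->] : cintegrable `]a, b[ (fun eta => W eta * pv a b (Ubd gj gk eta) xi) /\
    cint `]a, b[ (fun eta => W eta * pv a b (Ubd gj gk eta) xi) = _ :=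
  cintegrableM_parts (measurable_itv _) j1 j2 j3 j4.
split => //; apply/is_pvE.
have key x : a < x < b ->
    cint `]a, b[ (fun eta => W eta * Ubd gj gk eta x) =
    (\int[mu]_(t in `]a, b[) (Re (W t) * KR t x) - \int[mu]_(t in `]a, b[) (Im (W t) * KI t x)) +i*
    (\int[mu]_(t in `]a, b[) (Re (W t) * KI t x) + \int[mu]_(t in `]a, b[) (Im (W t) * KR t x)).
  move=> xab.
  have [i1 e1] := integrable_off_diagonal (fun eta => UR x eta xab) (integrable_weight_kernel sR iWR bWR xab).
  have [i2 e2] := integrable_off_diagonal (fun eta => UI x eta xab) (integrable_weight_kernel sI iWI bWI xab).
  have [i3 e3] := integrable_off_diagonal (fun eta => UI x eta xab) (integrable_weight_kernel sI iWR bWR xab).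
  have [i4 e4] := integrable_off_diagonal (fun eta => UR x eta xab) (integrable_weight_kernel sR iWI bWI xab).
  have [_ ->] := cintegrableM_parts (measurable_itv _) i1 i2 i3 i4.
  by rewrite e1 e2 e3 e4.
split.
  by apply: is_rpv_off_ends (is_rpvB (conj p1 l1) (conj p2 l2)) => x xab; rewrite key.
by apply: is_rpv_off_ends (is_rpvD (conj p3 l3) (conj p4 l4)) => x xab; rewrite key.
Qed.

End weight.

Lemma cintegrable_normal_factor : cintegrable `]a, b[ (normal_factor gj).
Proof.
apply: (@cintegrable_le _ _ _ (fun t => 1 + `|derive1 gj t|)) => //.
- by apply: cmeasurable_normal_factor; exact: regular_graph_measurable_slope rj.
- by move=> t _; rewrite l1norm_normal_factor.
- apply: integrableD_real => //; first exact: integrable_cst_oo.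
  exact: integrable_norm_real (rg_integrable rj).
Qed.

Lemma normal_factor_locally_bounded c d : a < c -> d < b ->
  exists2 M : R, 0 <= M & forall t, c <= t <= d -> l1norm (normal_factor gj t) <= M.
Proof.
move=> ac db; have [M HM] := regular_graph_slope_bounded rj ac db.
exists (1 + `|M|) => [|t tcd]; first by rewrite addr_ge0.
by rewrite l1norm_normal_factor lerD2l (le_trans (HM t tcd))// ler_norm.
Qed.

(** Integrability in eta is the weighted interchange with the weight 1 - i gj' alone; the local
    bound multiplies the exponent 1/2 of [Ubd_pv] by a bound on the slope. *)
Lemma crossU_weakly_singular : weakly_singular a b (crossU a b gj gk).
Proof.
split=> [xi xiab|c d ac cd db].
  have loc (f : R[i] -> R) : (forall z, `|f z| <= l1norm z) ->
      locally_bounded_oo a b (fun t => f (normal_factor gj t)).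
    move=> fl c d ac db; have [M M0 HM] := normal_factor_locally_bounded ac db.
    by exists M => s scd; exact: le_trans (fl _) (HM s scd).
  have [h _] := weighted_Ubd_interchange cintegrable_normal_factor
    (loc (fun z => Re z) (@Re_le_l1norm R)) (loc (fun z => Im z) (@Im_le_l1norm R)) xiab.
  suff -> : (crossU a b gj gk)^~ xi =
      (fun eta => normal_factor gj eta * pv a b (Ubd gj gk eta) xi) by [].
  by apply/funext => eta; rewrite /crossU mulrC.
have [C C0 HC] := Ubd_pv ac (ltW cd) db.
have [M M0 HM] := normal_factor_locally_bounded ac db.
exists (C * M), 2^-1; split; first by apply/andP; split; lra.
move=> eta xi ecd xcd ex; apply: (le_trans (le_norm_l1norm _)); rewrite lecR.
have eab : a <= eta <= b.
  by case/andP : ecd => h1 h2; rewrite (le_trans (ltW ac))//= (le_trans h2)// ltW.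
have [_ h] := HC eta xi eab xcd ex.
apply: (le_trans (l1normM _ _)); rewrite mulrAC.
by apply: ler_pM; rewrite ?l1norm_ge0// HM.
Qed.

Section density.
Variable p : R -> R[i].
Hypothesis cp : ccontinuous_on `[a, b] p.

Let W eta := p eta * normal_factor gj eta.

Let p_oo : cmeasurable `]a, b[ p.
Proof.
have [m1 m2] := ccontinuous_cmeasurable cp.
by split; [apply: measurable_funS m1|apply: measurable_funS m2] => //; exact: subset_itv_oo_cc.
Qed.

Let iW : cintegrable `]a, b[ W.
Proof.
have [B B0 HB] := ccontinuous_bounded (ltW ab) cp.
apply: (cintegrable_boundedM (B := B)) => //; last exact: cintegrable_normal_factor.
by move=> t /=; rewrite in_itv/= => /andP[? ?]; rewrite HB// !ltW.
Qed.

Let bW (f : R[i] -> R) : (forall z, `|f z| <= l1norm z) ->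
  locally_bounded_oo a b (fun t => f (W t)).
Proof.
move=> fl c d ac db; have [M M0 HM] := normal_factor_locally_bounded ac db.
have [B B0 HB] := ccontinuous_bounded (ltW ab) cp.
exists (B * M) => s scd; apply: (le_trans (fl _)); apply: (le_trans (l1normM _ _)).
apply: ler_pM; rewrite ?l1norm_ge0// ?HM// HB//.
by case/andP : scd => h1 h2; rewrite (le_trans (ltW ac))//= (le_trans h2)// ltW.
Qed.

Lemma density_Ubd_integrable x : a < x < b ->
  cintegrable `]a, b[ (fun eta => p eta * Ubd gj gk eta x * normal_factor gj eta).
Proof.
move=> xab; have := weighted_Ubd_integrable iW
  (bW (f := fun z => Re z) (@Re_le_l1norm R)) (bW (f := fun z => Im z) (@Im_le_l1norm R)) xab.
congr (cintegrable _ _).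
by apply/funext => eta; rewrite /W mulrAC.
Qed.

Lemma density_Ubd_interchange xi : a < xi < b ->
  is_pv a b (fun x => cint `]a, b[ (fun eta => p eta * Ubd gj gk eta x * normal_factor gj eta)) xi
    (cint `]a, b[ (fun eta => p eta * crossU a b gj gk eta xi)).
Proof.
move=> xiab; have [_] := weighted_Ubd_interchange iW
  (bW (f := fun z => Re z) (@Re_le_l1norm R)) (bW (f := fun z => Im z) (@Im_le_l1norm R)) xiab.
congr (is_pv a b _ xi _).
  by apply/funext => x; congr (cint _ _); apply/funext => eta; rewrite /W mulrAC.
by congr (cint _ _); apply/funext => eta; rewrite /W /crossU mulrA mulrAC.
Qed.

End density.

End complex_interchange.

(** * Continuity of the boundary values, and splitting of the regular terms *)

Section boundary_values.
Context {R : realType}.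
Implicit Types (a b : R) (g : R -> R) (u : R * R -> R[i]).

Lemma ccontinuous_graph a b g u (A : set (R * R)) :
  ccontinuous_on A u -> {within `[a, b], continuous g} -> graph_over a b g `<=` A ->
  ccontinuous_on `[a, b] (fun x => u (x, g x)).
Proof.
have real (f : R * R -> R) : {within A, continuous f} -> {within `[a, b], continuous g} ->
    graph_over a b g `<=` A -> {within `[a, b], continuous (fun x => f (x, g x))}.
  move=> /subspace_continuousP cf /subspace_continuousP cg gA.
  apply/subspace_continuousP => x xab.
  have gx t : t \in `[a, b] -> A (t, g t) by move=> tab; apply: gA; split => //=; move: tab; rewrite in_itv.
  apply: (cvg_comp (fun t => (t, g t)) f) (cf _ (gx _ xab)).
  move=> S; rewrite /within/= => hS.
  have cp : (t, g t) @[t --> within [set` `[a, b]] (nbhs x)] --> (x, g x).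
    have c1 : t @[t --> within `[a, b] (nbhs x)] --> x by exact: cvg_within.
    exact: cvg_pair c1 (cg x xab).
  have h : \forall t \near x, `[a, b]%classic t -> A (t, g t) -> S (t, g t) := cp _ hS.
  suff : \forall t \near x, `[a, b]%classic t -> S (t, g t) by [].
  by apply: filterS h => t ht tab; exact: ht (gx _ tab).
move=> [c1 c2] cg gA; split.
  exact: (real (fun p => complex.Re (u p))).
exact: (real (fun p => complex.Im (u p))).
Qed.

Lemma ccontinuous_onB (A : set R) (f g : R -> R[i]) :
  ccontinuous_on A f -> ccontinuous_on A g -> ccontinuous_on A (fun t => f t - g t).
Proof.
move=> [f1 f2] [g1 g2]; split.
  have -> : (fun t => complex.Re (f t - g t)) = (fun t => complex.Re (f t) - complex.Re (g t)).
    by apply/funext => t; case: (f t) => ? ?; case: (g t).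
  by move=> x; apply: cvgB; [exact: f1|exact: g1].
have -> : (fun t => complex.Im (f t - g t)) = (fun t => complex.Im (f t) - complex.Im (g t)).
  by apply/funext => t; case: (f t) => ? ?; case: (g t).
by move=> x; apply: cvgB; [exact: f2|exact: g2].
Qed.

Lemma ccontinuous_onZ (A : set R) (k : R[i]) (f : R -> R[i]) :
  ccontinuous_on A f -> ccontinuous_on A (fun t => k * f t).
Proof.
move=> [f1 f2]; split.
  have -> : (fun t => complex.Re (k * f t)) =
      (fun t => complex.Re k * complex.Re (f t) - complex.Im k * complex.Im (f t)).
    by apply/funext => t; rewrite Re_mul.
  by move=> x; apply: cvgB; (apply: cvgM; first exact: cvg_cst); [exact: f1|exact: f2].
have -> : (fun t => complex.Im (k * f t)) =
    (fun t => complex.Re k * complex.Im (f t) + complex.Im k * complex.Re (f t)).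
  by apply/funext => t; rewrite Im_mul.
by move=> x; apply: cvgD; (apply: cvgM; first exact: cvg_cst); [exact: f2|exact: f1].
Qed.

Lemma weakly_singular_term a b (N : R -> R -> R[i]) (ph uk : R -> R[i]) : a < b ->
  weakly_singular a b N -> ccontinuous_on `[a, b] ph -> ccontinuous_on `[a, b] uk ->
  regular_term a b N ph uk.
Proof.
move=> ab ws cph cuk; split => // xi xiab.
have int f : ccontinuous_on `[a, b] f -> cintegrable `]a, b[ (fun eta => f eta * N eta xi).
  move=> cf; have [B B0 HB] := ccontinuous_bounded (ltW ab) cf.
  apply: (cintegrable_boundedM (B := B)) => //; last exact: ws.1.
    have [m1 m2] := ccontinuous_cmeasurable cf.
    by split; [apply: measurable_funS m1|apply: measurable_funS m2] => //; exact: subset_itv_oo_cc.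
  by move=> t /=; rewrite in_itv/= => /andP[? ?]; rewrite HB// !ltW.
by split; exact: int.
Qed.

End boundary_values.

Theorem theorem3 (R : realType) (D : set (R * R)) (a1 b1 : R)
    (gamma1 gamma2 : R -> R) (alpha1 alpha2 : R[i]) (phi1 phi2 : R -> R[i])
    (u : R * R -> R[i])
    (hD : bounded_domain D) (hconv : convex_in_x2 D)
    (hlyap : lyapunov_curve (closure D `\` D))
    (hlines : boundary_lines D a1 b1 gamma1 gamma2)
    (halpha1 : alpha1 != 0) (halpha2 : alpha2 != 0)
    (hu : solves_equation D u)
    (hbc1 : boundary_condition D a1 b1 u gamma1 alpha1 phi1)
    (hbc2 : boundary_condition D a1 b1 u gamma2 alpha2 phi2)
    (hphi1 : C1_on a1 b1 phi1) (hphi2 : C1_on a1 b1 phi2)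
    (hphi1_ends : phi1 a1 = 0 /\ phi1 b1 = 0)
    (hphi2_ends : phi2 a1 = 0 /\ phi2 b1 = 0) :
  regular_relation a1 b1 gamma1 gamma2 alpha1 alpha2 phi1 phi2 u.
Proof.
have [ab bd _ [cg1 cg2] dg] := hlines.
have neq t : a1 < t < b1 -> gamma1 t != gamma2 t by exact: boundary_lines_neq hD hlines.
have neq' t : a1 < t < b1 -> gamma2 t != gamma1 t by move=> /neq; rewrite eq_sym.
have d1 t : a1 < t < b1 -> derivable gamma1 t 1 by move=> /dg[].
have d2 t : a1 < t < b1 -> derivable gamma2 t 1 by move=> /dg[].
rewrite bd in hlyap.
have rg1 := lyapunov_regular_graph ab hlyap cg1 neq d1 d2.
(* The second line takes the place of the first in [lyapunov_regular_graph]. *)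
rewrite setUC in hlyap.
have rg2 := lyapunov_regular_graph ab hlyap cg2 neq' d2 d1.
have cu1 : ccontinuous_on `[a1, b1] (u1 gamma1 u).
  apply: ccontinuous_graph hu.1 cg1 _ => p pG.
  by have [] : (closure D `\` D) p by rewrite bd; left.
have cu2 : ccontinuous_on `[a1, b1] (u2 gamma2 u).
  apply: ccontinuous_graph hu.1 cg2 _ => p pG.
  by have [] : (closure D `\` D) p by rewrite bd; right.
have cp1 : ccontinuous_on `[a1, b1] (p1 gamma1 alpha1 phi1 u).
  by apply: ccontinuous_onB hphi1.1 _; exact: ccontinuous_onZ.
have cp2 : ccontinuous_on `[a1, b1] (p2 gamma2 alpha2 phi2 u).
  by apply: ccontinuous_onB hphi2.1 _; exact: ccontinuous_onZ.
(* Naming the limit yields at once the existence of the outer principal value and the interchange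
   formula. *)
have outer xi : a1 < xi < b1 -> is_pv a1 b1 (inner a1 b1 gamma1 gamma2 alpha1 alpha2 phi1 phi2 u)
    xi (interchanged a1 b1 gamma1 gamma2 alpha1 alpha2 phi1 phi2 u xi).
  move=> xiab; apply: is_pvD; apply: is_pvZ.
    exact: density_Ubd_interchange.
  exact: density_Ubd_interchange.
have inter xi : a1 < xi < b1 ->
    iterated a1 b1 gamma1 gamma2 alpha1 alpha2 phi1 phi2 u xi =
    interchanged a1 b1 gamma1 gamma2 alpha1 alpha2 phi1 phi2 u xi.
  by move=> /outer; exact: is_pv_lim.
have term N ph uk (ws : weakly_singular a1 b1 N) := weakly_singular_term (ph := ph) (uk := uk) ab ws.
split.
- move=> xi xiab.
  have [z1 h1] := C1_pv_exists ab hphi1 hphi1_ends.1 hphi1_ends.2 xiab.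
  have [z2 h2] := C1_pv_exists ab hphi2 hphi2_ends.1 hphi2_ends.2 xiab.
  exists (alpha1^-1 * z1 + (- alpha2^-1) * z2).
  have := is_pvD (is_pvZ alpha1^-1 h1) (is_pvZ (- alpha2^-1) h2).
  congr (is_pv _ _ _ _ _); apply/funext => t.
  by rewrite /known_density mulNr ![_^-1 * _]mulrC.
- by move=> x xab; split; exact: density_Ubd_integrable.
- by move=> xi /outer h; exists (interchanged a1 b1 gamma1 gamma2 alpha1 alpha2 phi1 phi2 u xi).
- move=> eta xi /andP[ae eb] xiab ex.
  have eab : a1 <= eta <= b1 by rewrite !ltW.
  have xx : xi <= xi <= xi by rewrite lexx.
  have /andP[ax xb] := xiab.
  have [C1 _ H1] := Ubd_pv ab rg1 rg1 ax (lexx xi) xb.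
  have [C2 _ H2] := Ubd_pv ab rg2 rg1 ax (lexx xi) xb.
  split; first by exists (pv a1 b1 (Ubd gamma1 gamma1 eta) xi); have [] := H1 eta xi eab xx ex.
  by exists (pv a1 b1 (Ubd gamma2 gamma1 eta) xi); have [] := H2 eta xi eab xx ex.
- exact: inter.
- by move=> xi /inter E; rewrite /relation /interchanged_relation /relation_with E.
- by apply: term hphi1.1 cu1; exact: crossU_weakly_singular.
- by apply: term hphi2.1 cu2; exact: crossU_weakly_singular.
- by apply: term hphi1.1 cu1; exact: diagE_weakly_singular.
- by apply: term hphi2.1 cu2; exact: crossE_weakly_singular.
- by apply: term hphi1.1 cu1; exact: crossE_weakly_singular.
- by apply: term hphi2.1 cu2; exact: diagE_weakly_singular.
Qed.
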